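(* Fix a finite relational signature $\tau$ and $k,k'\in\mathbb{N}$. The $\mathsf{Datalog}(k,k')$ synthesis problem is decidable in $\mathsf{EXPTIME}$: there is an algorithm that, given a finite $\tau$-structure $A$, a target intensional predicate symbol $P_i$, sets $\mathit{Pos},\mathit{Neg}\subseteq\mathrm{dom}(A)^{\mathrm{ar}(P_i)}$, and a regular tree grammar $G$ over the ranked alphabet of $\mathsf{Datalog}(k,k')$, runs in time exponential in the input size and either outputs a program $\Pi\in L(G)$ such that, writing $\mathsf{lfp}(P_i)$ for the interpretation of $P_i$ in $A$ under $\Pi$, $\mathit{Pos}\subseteq\mathsf{lfp}(P_i)$ and $\mathit{Neg}\cap\mathsf{lfp}(P_i)=\emptyset$, or correctly answers ''No'' if no such program exists.
   Context: $\mathsf{Datalog}(k,k')$ programs use first-order variables from $V=\{v_1,\dots,v_k\}$, extensional predicates from $\tau$, and intensional predicate symbols $P_1,\dots,P_{k'}$. A program is a set $\Pi$ of rules $P_j(\bar y)\leftarrow\psi_1(\bar y,\bar x),\dots,\psi_l(\bar y,\bar x)$ (logically $P_j(\bar y)\leftrightarrow$ the disjunction over its rules of $\exists\bar x.\bigwedge_i\psi_i$), where each $\psi_i$ is $R(\cdot)$, $\neg R(\cdot)$ for $R\in\tau$, or $P_{j'}(\cdot)$ over variables in $V$; rules may be (mutually) recursive. Semantics over $A$: the intensional predicates are interpreted as the simultaneous least fixed point of the monotone immediate-consequence operators $F_{P_j}(U)=\{\bar a: (A,U)\models\bigvee_{\text{rules of }P_j}\exists\bar x.\bigwedge_i\psi_i(\bar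 a,\bar x)\}$, where $U$ is a tuple of interpretations for $P_1,\dots,P_{k'}$. Programs are represented as trees over a suitable finite ranked alphabet for $\mathsf{Datalog}(k,k')$. A regular tree grammar $G=\langle N,\Sigma,S,P\rangle$ has nonterminals, axiom $S$ and rules $B\to t$ ($t$ a tree over $\Sigma\cup N$); $L(G)$ is the set of trees over $\Sigma$ derivable from $S$. *)

(* Defs.v *)
From HB Require Import structures.
From mathcomp Require Import all_boot.
From Stdlib Require List Relation_Operators.

Set Implicit Arguments.
Unset Strict Implicit.
Unset Printing Implicit Defensive.

Record signature := Signature { symbol :> finType; arity : symbol -> nat }.

Definition atom (sg : signature) (X : Type) := {R : sg & (arity R).-tuple X}.

Definition mk_atom (sg : signature) (X : Type) (R : sg)
  (xs : (arity R).-tuple X) : atom sg X :=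
  Tagged (fun R : sg => (arity R).-tuple X) xs.

Definition subst (sg : signature) (X Y : Type) (f : X -> Y)
  (a : atom sg X) : atom sg Y :=
  mk_atom (map_tuple f (tagged a)).

(* Up to renaming, the domain of a finite structure is {0, ..., n - 1}. *)
Record structure (tau : signature) := Structure {
  dsize : nat;
  rel : forall R : tau, {set (arity R).-tuple 'I_dsize}
}.

(* The intensional predicates P_1, ..., P_k' have arbitrary arities. *)
Definition int_sig (k' : nat) (ar : 'I_k' -> nat) : signature := Signature ar.

Section Datalog.
Variables (tau : signature) (k k' : nat) (ar : 'I_k' -> nat).

Notation var := 'I_k.

Inductive literal :=
  | LPos of atom tau var
  | LNeg of atom tau var
  | LInt of atom (int_sig ar) var.

Record rule := Rule { head : atom (int_sig ar) var; body : seq literal }.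

Definition program := seq rule.

Section Semantics.
Variable A : structure tau.

(* A set of facts is a simultaneous interpretation of P_1, ..., P_k' over A. *)
Definition fact : finType := atom (int_sig ar) 'I_(dsize A).

Definition holds (U : {set fact}) (v : {ffun var -> 'I_(dsize A)})
  (l : literal) : bool :=
  match l with
  | LPos a => tagged (subst v a) \in rel A (tag a)
  | LNeg a => tagged (subst v a) \notin rel A (tag a)
  | LInt a => (subst v a : fact) \in U
  end.

(* The variables of a rule that are not in its head are existentially
   quantified, as is the choice of values for the head variables; a head may
   repeat variables or use variables that do not occur in the body. *)
Definition fires (U : {set fact}) (a : fact) (r : rule) : bool :=
  [exists v : {ffun var -> 'I_(dsize A)},
     ((subst v (head r) : fact) == a) && all (holds U v) (body r)].

Definition consequences (Pi : program) (U : {set fact}) : {set fact} :=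
  [set a | has (fires U a) Pi].

Definition lfp_facts (Pi : program) : {set fact} := fixset (consequences Pi).

Definition lfp (Pi : program) (i : 'I_k') : {set (ar i).-tuple 'I_(dsize A)} :=
  [set t | (@mk_atom (int_sig ar) _ i t : fact) \in lfp_facts Pi].

(* fixset is the least fixed point only for monotone operators. *)
Lemma consequences_mono (Pi : program) :
  {homo consequences Pi : U W / U \subset W}.
Proof.
move=> U W /subsetP UW; apply/subsetP => a; rewrite !inE.
apply: sub_has => r /existsP[v /andP[hv bv]].
apply/existsP; exists v; rewrite hv /=; apply: sub_all bv => -[] //= b.
exact: UW.
Qed.

Lemma lfp_facts_fix (Pi : program) :
  consequences Pi (lfp_facts Pi) = lfp_facts Pi.
Proof. exact: fixsetK (@consequences_mono Pi). Qed.

Lemma lfp_facts_least (Pi : program) (U : {set fact}) :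
  consequences Pi U \subset U -> lfp_facts Pi \subset U.
Proof.
move=> preU; rewrite /lfp_facts /fixset.
elim: #|_| => [|m IH] /=; first exact: sub0set.
by apply: subset_trans preU; apply: consequences_mono.
Qed.

End Semantics.
End Datalog.

Inductive tree (F : Type) := Node of F & seq (tree F).

Fixpoint well_ranked (F : Type) (rank : F -> nat) (t : tree F) : bool :=
  let: Node f ts := t in (size ts == rank f) && all (well_ranked rank) ts.

Fixpoint map_tree (F G : Type) (h : F -> G) (t : tree F) : tree G :=
  let: Node f ts := t in Node (h f) (map (map_tree h) ts).

Section Grammar.
Variables (F : Type) (rank : F -> nat).

(* Nonterminals are symbols of rank 0 added to the alphabet. *)
Definition sent_rank (N : Type) (x : F + N) : nat :=
  match x with inl f => rank f | inr _ => 0 end.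

Record grammar := Grammar {
  nonterms : nat;
  axiom : 'I_nonterms;
  productions : seq ('I_nonterms * tree (F + 'I_nonterms));
  productions_ranked :
    all (fun p => well_ranked (@sent_rank 'I_nonterms) p.2) productions
}.

Inductive derives1 (G : grammar) :
    tree (F + 'I_(nonterms G)) -> tree (F + 'I_(nonterms G)) -> Prop :=
  | Derives_root B t :
      List.In (B, t) (productions G) -> derives1 (Node (inr B) [::]) t
  | Derives_child x ts1 u u' ts2 :
      derives1 u u' ->
      derives1 (Node x (ts1 ++ u :: ts2)) (Node x (ts1 ++ u' :: ts2)).

Definition language (G : grammar) (t : tree F) : Prop :=
  Relation_Operators.clos_refl_trans_1n _ (@derives1 G) (Node (inr (axiom G)) [::])
    (map_tree inl t).

End Grammar.

Section ProgramTrees.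
Variables (tau : signature) (k k' : nat) (ar : 'I_k' -> nat).

Inductive dsym :=
  | DEmpty                              (* no rules *)
  | DUnion                              (* union of two sets of rules *)
  | DRule of atom (int_sig ar) 'I_k     (* rule with this head; child = body *)
  | DTrue                               (* empty conjunction *)
  | DAnd                                (* conjunction of two bodies *)
  | DPos of atom tau 'I_k
  | DNeg of atom tau 'I_k
  | DInt of atom (int_sig ar) 'I_k.

Definition drank (s : dsym) : nat :=
  match s with
  | DUnion | DAnd => 2
  | DRule _ => 1
  | _ => 0
  end.

Definition dcode : Type :=
  (atom (int_sig ar) 'I_k + atom tau 'I_k + atom tau 'I_k
   + atom (int_sig ar) 'I_k + 'I_4)%type.

Definition dsym_code (s : dsym) : dcode :=
  match s with
  | DEmpty => inr (inord 0)
  | DUnion => inr (inord 1)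
  | DTrue => inr (inord 2)
  | DAnd => inr (inord 3)
  | DRule a => inl (inl (inl (inl a)))
  | DPos a => inl (inl (inl (inr a)))
  | DNeg a => inl (inl (inr a))
  | DInt a => inl (inr a)
  end.

Definition dsym_decode (c : dcode) : dsym :=
  match c with
  | inr i => nth DEmpty [:: DEmpty; DUnion; DTrue; DAnd] i
  | inl (inl (inl (inl a))) => DRule a
  | inl (inl (inl (inr a))) => DPos a
  | inl (inl (inr a)) => DNeg a
  | inl (inr a) => DInt a
  end.

Lemma dsym_codeK : cancel dsym_code dsym_decode.
Proof. by case=> //=; rewrite inordK. Qed.

HB.instance Definition _ := Finite.copy dsym (can_type dsym_codeK).

Fixpoint body_of_tree (t : tree dsym) : option (seq (literal tau k ar)) :=
  match t with
  | Node DTrue [::] => Some [::]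
  | Node (DPos a) [::] => Some [:: LPos ar a]
  | Node (DNeg a) [::] => Some [:: LNeg ar a]
  | Node (DInt a) [::] => Some [:: LInt tau a]
  | Node DAnd [:: t1; t2] =>
      if body_of_tree t1 is Some b1 then
        if body_of_tree t2 is Some b2 then Some (b1 ++ b2) else None
      else None
  | _ => None
  end.

(* Trees that do not respect the sorts (rule sets above bodies) represent no
   program. *)
Fixpoint program_of_tree (t : tree dsym) : option (program tau k ar) :=
  match t with
  | Node DEmpty [::] => Some [::]
  | Node (DRule h) [:: t1] =>
      if body_of_tree t1 is Some b then Some [:: Rule h b] else None
  | Node DUnion [:: t1; t2] =>
      if program_of_tree t1 is Some p1 then
        if program_of_tree t2 is Some p2 then Some (p1 ++ p2) else None
      else None
  | _ => None
  end.

End ProgramTrees.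

Section Synthesis.
Variables (tau : signature) (k k' : nat) (ar : 'I_k' -> nat).

Notation sym := (dsym tau k ar).

Record instance := Instance {
  struct : structure tau;
  target : 'I_k';
  pos : {set (ar target).-tuple 'I_(dsize struct)};
  neg : {set (ar target).-tuple 'I_(dsize struct)};
  gram : grammar (@drank tau k k' ar)
}.

Definition solution (I : instance) (t : tree sym) : Prop :=
  language (gram I) t /\
  exists Pi : program tau k ar,
    [/\ program_of_tree t = Some Pi,
        pos I \subset lfp (struct I) Pi (target I)
      & [disjoint neg I & lfp (struct I) Pi (target I)]].

(* None is the answer "No". *)
Definition correct_answer (I : instance) (ans : option (tree sym)) : Prop :=
  match ans with
  | Some t => solution I t
  | None => ~ exists t, solution I t
  end.

End Synthesis.

Inductive move := MoveLeft | Stay | MoveRight.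

Section Machines.
Variable L : finType.

(* The tape alphabet extends the input/output alphabet L by the letters in
   work; None is the blank. *)
Record machine := Machine {
  ntapes : nat;
  work : finType;
  state : finType;
  init : state;
  final : pred state;
  trans : state -> {ffun 'I_ntapes.+1 -> option (L + work)} ->
          state * {ffun 'I_ntapes.+1 -> option (L + work) * move}
}.

Variable M : machine.

Notation cell := (option (L + work M)).

(* A two-way infinite tape: the cells to the left of the head, nearest first,
   and the cells from the head on rightwards; all other cells are blank. *)
Definition tape := (seq cell * seq cell)%type.

Definition read (tp : tape) : cell := seq.head None tp.2.

Definition act (a : cell * move) (tp : tape) : tape :=
  let: (l, r) := (tp.1, a.1 :: behead tp.2) in
  match a.2 with
  | MoveLeft => (behead l, seq.head None l :: r)
  | Stay => (l, r)
  | MoveRight => (seq.head None r :: l, behead r)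
  end.

Definition config := (state M * {ffun 'I_(ntapes M).+1 -> tape})%type.

Definition step (c : config) : config :=
  if final c.1 then c else
  let: (q, a) := trans c.1 [ffun i => read (c.2 i)] in
  (q, [ffun i => act (a i) (c.2 i)]).

Definition initial (w : seq L) : config :=
  (init M,
   [ffun i => ([::], if i == ord0 then [seq Some (inl x) | x <- w] else [::])]).

Fixpoint word_at (s : seq cell) : seq L :=
  if s is Some (inl x) :: s' then x :: word_at s' else [::].

(* The output is the word that starts under the head of the first tape. *)
Definition output (c : config) : seq L := word_at (c.2 ord0).2.

Definition outputs_within (n : nat) (w w' : seq L) : Prop :=
  let c := iter n step (initial w) in final c.1 /\ output c = w'.

End Machines.

(* The search problem spec is solved in time 2 ^ poly, where inputs and answers
   are presented as words over L. *)
Definition exptime_solvable (L : finType) (X Y : Type) (enc_in : X -> seq L)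
  (enc_out : Y -> seq L) (spec : X -> Y -> Prop) : Prop :=
  exists (M : machine L) (c : nat), forall x : X,
  exists y : Y, spec x y /\
    outputs_within M (2 ^ (size (enc_in x) ^ c + c)) (enc_in x) (enc_out y).

Section Encoding.
Variables (tau : signature) (k k' : nat) (ar : 'I_k' -> nat).

Notation sym := (dsym tau k ar).

(* The fixed ranked alphabet is available as letters, next to two digits. *)
Definition letter : finType := (bool + sym)%type.

(* Numbers (domain elements, nonterminals, lengths of lists) are written in
   unary. Each of them is bounded by the number of elements of the domain, of
   nonterminals, or of the items of a list, so the length of the word is
   polynomial in the usual size of the structure and of the grammar. *)
Definition enc_nat (n : nat) : seq letter :=
  rcons (nseq n (inl true)) (inl false).

Definition enc_list (X : Type) (e : X -> seq letter) (s : seq X) : seq letter :=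
  enc_nat (size s) ++ flatten (map e s).

Definition enc_tuple (m n : nat) (t : m.-tuple 'I_n) : seq letter :=
  flatten [seq enc_nat (i : 'I_n) | i <- t].

Definition enc_relation (m n : nat) (S : {set m.-tuple 'I_n}) : seq letter :=
  enc_list (@enc_tuple m n) (enum S).

Definition enc_structure (A : structure tau) : seq letter :=
  enc_nat (dsize A) ++ flatten [seq enc_relation (rel A R) | R <- enum tau].

(* Trees are written in prefix notation, which is unambiguous as the ranks are
   known. *)
Fixpoint enc_tree (t : tree sym) : seq letter :=
  let: Node f ts := t in inr f :: flatten (map enc_tree ts).

Fixpoint enc_sent_tree (N : nat) (t : tree (sym + 'I_N)) : seq letter :=
  let: Node x ts := t in
  (match x with inl f => [:: inr f] | inr B => enc_nat B end)
    ++ flatten (map (@enc_sent_tree N) ts).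

Definition enc_grammar (G : grammar (@drank tau k k' ar)) : seq letter :=
  enc_nat (nonterms G) ++ enc_nat (axiom G) ++
  enc_list (fun p : 'I__ * tree _ => enc_nat p.1 ++ enc_sent_tree p.2) (productions G).

Definition enc_instance (I : instance tau k ar) : seq letter :=
  enc_structure (struct I) ++ enc_nat (target I) ++
  enc_relation (pos I) ++ enc_relation (neg I) ++ enc_grammar (gram I).

Definition enc_answer (ans : option (tree sym)) : seq letter :=
  if ans is Some t then inl true :: enc_tree t else [:: inl false].

End Encoding.

(* Main.v *)
Require Import Defs.
From mathcomp Require Import all_boot zify.
From Stdlib Require List Relation_Operators.

Set Implicit Arguments.
Unset Strict Implicit.
Unset Printing Implicit Defensive.

(** Since tau, k and ar are fixed, there are only finitely many literals, hence
finitely many bodies and rules up to order and repetition, and the semantics of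
a program depends only on the set of its rules.  Trees over the alphabet are
thus evaluated by a bottom-up automaton with a constant number of states.  A
table of pairs (nonterminal, state), each with the prefix notation of a witness
tree, is saturated under the productions; the number of passes is at most the
number of such pairs, so that the witnesses have at most exponential length.
For every state that is a rule set, the least fixed point over the structure is
computed by iteration over all valuations, and the answer is the witness of an
accepting state of the axiom.

For the running time, programs over five stacks are compiled to Turing
machines, and functions on values serialized on one of these stacks are shown
to run in polynomial time, with closure under composition, case analysis and
folds whose intermediate states are polynomially bounded.  The saturation is
the only fold with exponentially large states. *)

(** Witness words cannot be kept polynomial: a chain of n rules that send [B_i] to [DUnion] of two
    copies of [B_(i+1)] generates only trees of size at least 2^n. Exponential-time functions are
    not closed under composition, so the algorithm is arranged as a polynomial-time parser, one
    exponential fold, and an output stage that is polynomial in the exponentially large table. In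
    that fold a step multiplies the longest word, shifted by 5, by at most M + 1, where M bounds the
    size of a production. There are polynomially many steps, and (M + 1)^poly is at most 2^poly.
    That the states are constant in number is used a second time on the machine side. A state, even
    one that is a whole rule set, is a single tape symbol; the transition function of the automaton,
    the loop over all states and one fixed-point evaluator per rule set are wired into the finite
    control. What is left to loop over, the n^k valuations and the intensional facts, is polynomial
    because [k] and [ar] are fixed. *)

(* RIO is the input and output tape, RD holds the data; the others are workspace. *)
Notation RIO := (@Ordinal 5 0 isT).
Notation RD := (@Ordinal 5 1 isT).
Notation RT := (@Ordinal 5 2 isT).
Notation RU := (@Ordinal 5 3 isT).
Notation RC := (@Ordinal 5 4 isT).

(** * Stack programs and their compilation to Turing machines *)

Section StackPrograms.
Variable S : finType.

(** The continuation of [Pop] is a function on the finite alphabet, so it also serves as the only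
    branching construct; it receives [None] on an empty stack. *)
Inductive cmd :=
  | Skip
  | Push of 'I_5 & S
  | Pop of 'I_5 & (option S -> cmd)
  | Seq of cmd & cmd
  | While of 'I_5 & pred (option S) & cmd.

Definition store := seq (seq S).
Definition stack (st : store) (r : 'I_5) : seq S := nth [::] st r.
Definition set_stack (st : store) (r : 'I_5) (s : seq S) : store := set_nth [::] st r s.

Lemma stack_set st r s r' : stack (set_stack st r s) r' = if r' == r then s else stack st r'.
Proof. by rewrite /stack nth_set_nth. Qed.

Definition stack_top (s : seq S) : option S := ohead s.

Inductive exec : cmd -> store -> nat -> store -> Prop :=
  | ExecSkip st : exec Skip st 1 st
  | ExecPush r a st : exec (Push r a) st 2 (set_stack st r (a :: stack st r))
  | ExecPop r f st t st' :
      exec (f (stack_top (stack st r))) (set_stack st r (behead (stack st r))) t st' ->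
      exec (Pop r f) st t.+1 st'
  | ExecSeq c1 c2 st t1 st1 t2 st2 :
      exec c1 st t1 st1 -> exec c2 st1 t2 st2 ->
      exec (Seq c1 c2) st (t1 + t2) st2
  | ExecWhileF r (p : pred (option S)) c st :
      ~~ p (stack_top (stack st r)) -> exec (While r p c) st 1 st
  | ExecWhileT r (p : pred (option S)) c st t1 st1 t2 st2 :
      p (stack_top (stack st r)) -> exec c st t1 st1 ->
      exec (While r p c) st1 t2 st2 ->
      exec (While r p c) st (t1 + t2).+1 st2.

Definition store_size (st : store) := \sum_(r < 5) size (stack st r).

Lemma store_size_set st r s :
  store_size (set_stack st r s) + size (stack st r) = store_size st + size s.
Proof.
rewrite /store_size (bigD1 r) //= [in RHS](bigD1 r) //= stack_set eqxx.
rewrite (eq_bigr (fun i => size (stack st i))); first by lia.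
by move=> i ir; rewrite stack_set (negbTE ir).
Qed.

(** Only a push enlarges the store, by one symbol for two units of time. Time bounds therefore also
    bound the size of results, which [computes_size] exploits. *)
Lemma exec_store_size c st t st' : exec c st t st' -> store_size st' <= store_size st + t.
Proof.
elim=> {c st t st'}; try by move=> *; lia.
- by move=> r a st; have := store_size_set st r (a :: stack st r); rewrite /=; lia.
- move=> r f st t st' _.
  by have := store_size_set st r (behead (stack st r)); rewrite size_behead; lia.
Qed.

(** Control states are program points. For [Pop] and [While], [None] is the point before the pop or
    the test; a point inside the continuation of a [Pop] remembers the popped symbol, which
    determines the program being run. *)
Fixpoint control (c : cmd) : finType :=
  match c with
  | Skip => unit : finType
  | Push _ _ => bool : finType
  | Pop _ f => option {a : option S & control (f a)} : finType
  | Seq c1 c2 => (control c1 + control c2)%type : finType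
  | While _ _ c => option (control c) : finType
  end.

(* A push takes two steps: the head first moves to the free cell on its left. *)
Fixpoint control_start (c : cmd) : control c :=
  match c return control c with
  | Skip => tt
  | Push _ _ => false
  | Pop _ f => None
  | Seq c1 c2 => inl (control_start c1)
  | While _ _ c => None
  end.

Definition tape_write := option ('I_5 * (option S * move)).

(** The next point [None] means exit. Leaving one command and entering the next share a step, so
    that machine time agrees exactly with the time in [exec]. *)
Fixpoint transition (c : cmd) (tops : 'I_5 -> option S) :
    control c -> option (control c) * tape_write :=
  match c return control c -> option (control c) * tape_write with
  | Skip => fun _ => (None, None)
  | Push r a => fun b =>
      if b then (None, Some (r, (Some a, Stay)))
      else (Some true, Some (r, (tops r, MoveLeft)))
  | Pop r f => fun p =>
      match p with
      | None => (Some (Some (Tagged (fun a => control (f a)) (control_start (f (tops r))))),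
                 if tops r is Some _ then Some (r, (None, MoveRight)) else None)
      | Some p =>
          let: (q, w) := transition tops (tagged p) in
          (omap (fun q => Some (Tagged (fun a => control (f a)) q)) q, w)
      end
  | Seq c1 c2 => fun p =>
      match p with
      | inl p => let: (q, w) := transition tops p in
                 (Some (if q is Some q then inl q else inr (control_start c2)), w)
      | inr p => let: (q, w) := transition tops p in (omap inr q, w)
      end
  | While r test c => fun p =>
      match p with
      | None => (if test (tops r) then Some (Some (control_start c)) else None, None)
      | Some p => let: (q, w) := transition tops p in (Some q, w)
      end
  end.

End StackPrograms.

(** * Simulation of stack programs by five-tape machines *)

Section Compilation.
Variables (L : finType) (K : finType).
Notation S := (L + K)%type.

Definition tapeT := (seq (option S) * seq (option S))%type.
Definition readT (tp : tapeT) : option S := seq.head None tp.2.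

Definition trans_of (c : cmd S) (q : option (control c))
  (tops : {ffun 'I_5 -> option S}) :
  option (control c) * {ffun 'I_5 -> option S * move} :=
  let: (q', w) := if q is Some p then transition tops p else (None, None) in
  (q', [ffun i => if w is Some (r, a) then if i == r then a else (tops i, Stay)
                  else (tops i, Stay)]).

Definition machine_of (c : cmd S) : machine L :=
  @Machine L 4 K (option (control c)) (Some (control_start c)) (fun q => q == None)
    (@trans_of c).

Definition actT (a : option S * move) (tp : tapeT) : tapeT :=
  let: (l, r) := (tp.1, a.1 :: behead tp.2) in
  match a.2 with
  | MoveLeft => (behead l, seq.head None l :: r)
  | Stay => (l, r)
  | MoveRight => (seq.head None r :: l, behead r)
  end.

Definition tapesT := {ffun 'I_5 -> tapeT}.
Definition topsT (tp : tapesT) : {ffun 'I_5 -> option S} := [ffun i => readT (tp i)].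
Definition apply_tape_write (w : tape_write S) (tp : tapesT) : tapesT :=
  [ffun i => actT (if w is Some (r, a) then if i == r then a else (readT (tp i), Stay)
                   else (readT (tp i), Stay)) (tp i)].

Inductive runs (c : cmd S) : control c -> tapesT -> nat -> tapesT -> Prop :=
  | RunsExit p tp w : transition (topsT tp) p = (None, w) ->
      runs p tp 1 (apply_tape_write w tp)
  | RunsStep p tp w p' n tp' : transition (topsT tp) p = (Some p', w) ->
      runs p' (apply_tape_write w tp) n tp' -> runs p tp n.+1 tp'.

Lemma runs_seqr c1 c2 (p : control c2) tp n tp' :
  runs p tp n tp' -> runs (c := Seq c1 c2) (inr p) tp n tp'.
Proof.
elim=> {p tp n tp'} [p tp w E|p tp w p' n tp' E _ IH].
  by apply: RunsExit; rewrite /= E.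
by apply: RunsStep IH; rewrite /= E.
Qed.

Lemma runs_seql c1 c2 (p : control c1) tp n tp' m tp'' :
  runs p tp n tp' -> runs (control_start c2) tp' m tp'' ->
  runs (c := Seq c1 c2) (inl p) tp (n + m) tp''.
Proof.
move=> r1 r2; elim: r1 r2 => {p tp n tp'} [p tp w E|p tp w p' n tp' E _ IH] r2.
  by rewrite add1n; apply: RunsStep (runs_seqr _ r2); rewrite /= E.
by rewrite addSn; apply: RunsStep (IH r2); rewrite /= E.
Qed.

Lemma runs_pop r f a (p : control (f a)) tp n tp' :
  runs p tp n tp' ->
  runs (c := Pop r f) (Some (Tagged (fun a => control (f a)) p)) tp n tp'.
Proof.
elim=> {p tp n tp'} [p tp w E|p tp w p' n tp' E _ IH].
  by apply: RunsExit; rewrite /= E.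
by apply: RunsStep IH; rewrite /= E.
Qed.

Lemma runs_while r test c (p : control c) tp n tp' m tp'' :
  runs p tp n tp' ->
  runs (c := While r test c) None tp' m tp'' ->
  runs (c := While r test c) (Some p) tp (n + m) tp''.
Proof.
move=> r1 r2; elim: r1 r2 => {p tp n tp'} [p tp w E|p tp w p' n tp' E _ IH] r2.
  by rewrite add1n; apply: RunsStep r2; rewrite /= E.
by rewrite addSn; apply: RunsStep (IH r2); rewrite /= E.
Qed.

(* Only the cells from the head on matter: a push overwrites what is left of it. *)
Definition represents (tp : tapeT) (s : seq S) : Prop :=
  exists m, tp.2 = map Some s ++ nseq m None.

Definition stores (tp : tapesT) (st : store S) : Prop :=
  forall i, represents (tp i) (stack st i).

Lemma represents_read tp s : represents tp s -> readT tp = stack_top s.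
Proof. by case=> m E; rewrite /readT E; case: s {E} => //=; case: m. Qed.

Lemma stores_tops tp st i : stores tp st -> topsT tp i = stack_top (stack st i).
Proof. by move=> h; rewrite ffunE; apply: represents_read. Qed.

Lemma represents_stay tp s :
  represents tp s -> represents (actT (readT tp, Stay) tp) s.
Proof.
case=> m E; rewrite /represents /= /readT E.
(* Writing back the blank read on an exhausted tape turns it into an explicit cell, so [m] may grow
   from 0 to 1. *)
by case: s {E} => [|a s] /=; [case: m => [|m]; [exists 1 | exists m.+1] | exists m].
Qed.

Lemma stores_none tp st : stores tp st -> stores (apply_tape_write None tp) st.
Proof. by move=> h i; rewrite ffunE; apply: represents_stay. Qed.

Lemma stores_set tp st r a s :
  stores tp st -> represents (actT a (tp r)) s ->
  stores (apply_tape_write (Some (r, a)) tp) (set_stack st r s).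
Proof.
move=> h hr i; rewrite stack_set ffunE; case: eqP => [->|_] //.
exact: represents_stay.
Qed.

Lemma exec_runs c st t st' : exec c st t st' -> forall tp, stores tp st ->
  exists2 tp', runs (control_start c) tp t tp' & stores tp' st'.
Proof.
elim=> {c st t st'}.
- move=> st tp h; exists (apply_tape_write None tp); last exact: stores_none.
  exact: RunsExit.
- move=> r a st tp h.
  eexists.
    apply: (RunsStep (p := control_start (Push r a))); first by rewrite /=.
    by apply: RunsExit; rewrite /=.
  move=> i; rewrite stack_set !ffunE; have [->|ir] := eqVneq i r; last first.
    by apply: represents_stay; apply: represents_stay.
  have [m E] := h r; rewrite /represents /= /readT.
  case Es: (stack st r) => [|b s]; rewrite E Es /=; last by exists m.
  by case: m {E} => [|m]; [exists 1 | exists m.+1].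
- move=> r f st t st' _ IH tp h.
  have E := stores_tops r h.
  have hs : stores (apply_tape_write (if topsT tp r is Some _ then
      Some (r, (None, MoveRight)) else None) tp) (set_stack st r (behead (stack st r))).
    rewrite E; case Es: (stack st r) => [|a s] /=.
      move=> i; rewrite stack_set; have [->|_] := eqVneq i r.
        by rewrite -[X in represents _ X]Es; apply: (stores_none h).
      by apply: (stores_none h).
    apply: stores_set => //.
    by have [m Em] := h r; exists m; rewrite /= Em Es.
  have [tp' r' h'] := IH _ hs; exists tp' => //.
  move: r'; rewrite -E => r'.
  by apply: RunsStep (runs_pop _ r'); rewrite /=.
- move=> c1 c2 st t1 st1 t2 st2 _ IH1 _ IH2 tp /IH1[tp1 r1 /IH2[tp2 r2 h2]].
  by exists tp2 => //; apply: runs_seql r1 r2.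
- move=> r p c st np tp h; exists (apply_tape_write None tp); last exact: stores_none.
  by apply: RunsExit; rewrite /= (stores_tops r h) (negbTE np).
- move=> r p c st t1 st1 t2 st2 pr _ IH1 _ IH2 tp h.
  have [tp1 r1 /IH2[tp2 r2 h2]] := IH1 _ (stores_none h).
  exists tp2 => //; apply: RunsStep (runs_while r1 r2).
  by rewrite /= (stores_tops r h) pr.
Qed.

Lemma step_machine_of (c : cmd S) (p : control c) (tp : tapesT) :
  step (M := machine_of c) (Some p, tp) =
    ((transition (topsT tp) p).1, apply_tape_write (transition (topsT tp) p).2 tp).
Proof.
rewrite /step /= /trans_of.
have -> : [ffun i => read (M := machine_of c) (tp i)] = topsT tp.
  by apply/ffunP=> i; rewrite !ffunE.
case: (transition _ p) => q w /=; congr (_, _); apply/ffunP=> i; rewrite !ffunE.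
by case: w => [[r a]|] /=; rewrite ?ffunE.
Qed.

Lemma runs_machine (c : cmd S) (p : control c) tp n tp' :
  runs p tp n tp' -> iter n (@step L (machine_of c)) (Some p, tp) = (None, tp').
Proof.
elim=> {p tp n tp'} [p tp w E|p tp w p' n tp' E _ IH].
  by rewrite /= step_machine_of E.
by rewrite iterSr step_machine_of E.
Qed.

Lemma word_at_letters c (w : seq L) m :
  word_at (M := machine_of c) ([seq Some x | x <- map inl w] ++ nseq m None) = w.
Proof. by elim: w => [|a w IH] /=; [case: m | rewrite IH]. Qed.

Lemma exec_machine (c : cmd S) (w w' : seq L) t st n :
  exec c [:: map inl w; [::]; [::]; [::]; [::]] t st -> t <= n ->
  stack st ord0 = map inl w' -> outputs_within (machine_of c) n w w'.
Proof.
move=> ex tn Ew.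
have h0 : stores [ffun i => ([::], if i == ord0 then [seq Some (inl x) | x <- w] else [::])]
                 [:: map inl w; [::]; [::]; [::]; [::]].
  move=> i; rewrite ffunE; exists 0; rewrite /stack /= cats0.
  have [->|] := eqVneq i ord0; first by rewrite /= -map_comp.
  by case: i => -[|[|[|[|[|]]]]].
have [tp' /runs_machine r h] := exec_runs ex h0.
rewrite /outputs_within /= -(subnK tn) iterD /initial /= r.
(* [step] fixes final configurations, so the surplus [n - t] steps change nothing. *)
have -> : iter (n - t) (@step L (machine_of c)) (None, tp') = (None, tp').
  by elim: (n - t) => //= m ->.
split=> //; rewrite /output /=.
by have [m ->] := h ord0; rewrite Ew word_at_letters.
Qed.

End Compilation.

(** * Values and polynomial-time functions *)

Section Values.
Variables (L W : finType).

Inductive value := Leaf of option W | Pair of value & value.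

Notation K := (option (option W)).
Notation S := (L + K)%type.

Definition sym_pair : S := inr None.
Definition sym_leaf (a : option W) : S := inr (Some a).

(** Prefix notation is self-delimiting: a value can be cut off the top of a stack whatever lies
    below it. *)
Fixpoint ser (x : value) : seq S :=
  match x with
  | Leaf a => [:: sym_leaf a]
  | Pair x y => sym_pair :: ser x ++ ser y
  end.

Definition vsize (x : value) := size (ser x).

Lemma vsize_pair x y : vsize (Pair x y) = (vsize x + vsize y).+1.
Proof. by rewrite /vsize /= size_cat. Qed.

Lemma vsize_gt0 x : 0 < vsize x. Proof. by case: x. Qed.

Definition xexec (c : cmd S) st n st' := exists2 t, t <= n & exec c st t st'.

Lemma xseq c1 c2 st n1 st1 n2 st2 n :
  xexec c1 st n1 st1 -> xexec c2 st1 n2 st2 -> n1 + n2 <= n ->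
  xexec (Seq c1 c2) st n st2.
Proof.
move=> [t1 l1 e1] [t2 l2 e2] le; exists (t1 + t2); first by lia.
exact: ExecSeq e1 e2.
Qed.

Lemma xskip st n : 1 <= n -> xexec (Skip S) st n st.
Proof. by exists 1 => //; constructor. Qed.

Lemma xpush r a st n : 2 <= n -> xexec (Push r a) st n (set_stack st r (a :: stack st r)).
Proof. by exists 2 => //; constructor. Qed.

Lemma xpop r f st n n' st' :
  xexec (f (stack_top (stack st r))) (set_stack st r (behead (stack st r))) n st' -> n < n' ->
  xexec (Pop r f) st n' st'.
Proof. by move=> [t l e] ln; exists t.+1; [lia | constructor]. Qed.

Lemma xwhileF r (p : pred (option S)) c st n :
  ~~ p (stack_top (stack st r)) -> 1 <= n -> xexec (While r p c) st n st.
Proof. by move=> np; exists 1 => //; constructor. Qed.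

Lemma xwhileT r (p : pred (option S)) c st n1 st1 n2 st2 n :
  p (stack_top (stack st r)) -> xexec c st n1 st1 -> xexec (While r p c) st1 n2 st2 ->
  n1 + n2 < n -> xexec (While r p c) st n st2.
Proof.
move=> pr [t1 l1 e1] [t2 l2 e2] le; exists (t1 + t2).+1; first by lia.
exact: ExecWhileT e1 e2.
Qed.

Lemma xle c st n n' st' : xexec c st n st' -> n <= n' -> xexec c st n' st'.
Proof. by move=> [t l e] le; exists t => //; lia. Qed.

(* The counter stack RC holds one symbol for each value that is still to be read. *)
Definition grab_body (r : 'I_5) : cmd S :=
  Pop RC (fun=> Pop RD (fun a =>
    if a is Some s then
      Seq (Push r s) (if s == sym_pair then Seq (Push RC s) (Push RC s) else Skip S)
    else Skip S)).

Definition grab (r : 'I_5) : cmd S :=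
  Seq (Push RC sym_pair) (While RC isSome (grab_body r)).

(** Reading a pair symbol replaces one pending value by two, hence the statement for a list [vs] of
    pending values, with one counter symbol for each. The induction is on the bound [m], because the
    total size drops with every symbol read whereas [size vs] may grow; [b] selects the target
    stack. *)
Lemma grab_loop (b : bool) io vs rest t u c m :
  size (flatten (map ser vs)) <= m -> size c = size vs ->
  xexec (While RC isSome (grab_body (if b then RT else RU)))
    [:: io; flatten (map ser vs) ++ rest; t; u; c] (10 * m + 1)
    [:: io; rest; if b then catrev (flatten (map ser vs)) t else t;
        if b then u else catrev (flatten (map ser vs)) u; [::]].
Proof.
elim: m vs t u c => [|m IH] vs t u c.
  case: vs c => [|[a|x y] vs] [|a0 c] //= _ _.
  by case: b; apply: xwhileF.
case: vs c => [|v vs] [|a0 c] // sm sc.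
  by case: (b); apply: xwhileF => //=; lia.
case: sc => sc.
case: v sm => [a|x y] sm.
  apply: (xwhileT (n1 := 5) (n2 := 10 * m + 1)) => //; last 1 first.
  - by lia.
  - apply: (xpop (n := 4)) => //; apply: (xpop (n := 3)) => //.
    apply: (xseq (n1 := 2) (n2 := 1)) => //; first exact: xpush.
    exact: xskip.
  have /= := IH vs (if b then sym_leaf a :: t else t) (if b then u else sym_leaf a :: u) c.
  by move: sm => /=; case: (b) => /= sm; apply => //; lia.
apply: (xwhileT (n1 := 9) (n2 := 10 * m + 1)) => //; last 1 first.
- by lia.
- apply: (xpop (n := 8)) => //; apply: (xpop (n := 7)) => //=.
  apply: (xseq (n1 := 2) (n2 := 4)) => //; first exact: xpush.
  apply: (xseq (n1 := 2) (n2 := 2)) => //; exact: xpush.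
have /= := IH (x :: y :: vs) (if b then sym_pair :: t else t)
   (if b then u else sym_pair :: u) [:: sym_pair, sym_pair & c].
rewrite !catA.
by move: sm; rewrite /= !size_cat sc; case: (b) => /= sm; apply => //; lia.
Qed.

Lemma grabP (b : bool) io x rest t u :
  xexec (grab (if b then RT else RU))
    [:: io; ser x ++ rest; t; u; [::]] (10 * vsize x + 3)
    [:: io; rest; if b then catrev (ser x) t else t;
        if b then u else catrev (ser x) u; [::]].
Proof.
apply: (xseq (n1 := 2) (n2 := 10 * vsize x + 1)); first exact: xpush; last by lia.
have := @grab_loop b io [:: x] rest t u [:: sym_pair] (vsize x).
by rewrite /= cats0; apply.
Qed.

Definition pour (r r' : 'I_5) : cmd S :=
  While r isSome (Pop r (fun a => if a is Some s then Push r' s else Skip S)).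

Lemma pour_TD io d s u :
  xexec (pour RT RD) [:: io; d; s; u; [::]] (4 * size s + 1)
    [:: io; catrev s d; [::]; u; [::]].
Proof.
elim: s d => [|a s IH] d; first exact: xwhileF.
apply: (xwhileT (n1 := 3) _ _ (IH _)) => //=; last by lia.
by apply: (xpop (n := 2)) => //; exact: xpush.
Qed.

Lemma pour_UD io d s t :
  xexec (pour RU RD) [:: io; d; t; s; [::]] (4 * size s + 1)
    [:: io; catrev s d; t; [::]; [::]].
Proof.
elim: s d => [|a s IH] d; first exact: xwhileF.
apply: (xwhileT (n1 := 3) _ _ (IH _)) => //=; last by lia.
by apply: (xpop (n := 2)) => //; exact: xpush.
Qed.

Lemma pour_UT io d s t :
  xexec (pour RU RT) [:: io; d; t; s; [::]] (4 * size s + 1)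
    [:: io; d; catrev s t; [::]; [::]].
Proof.
elim: s t => [|a s IH] t; first exact: xwhileF.
apply: (xwhileT (n1 := 3) _ _ (IH _)) => //=; last by lia.
by apply: (xpop (n := 2)) => //; exact: xpush.
Qed.

Definition pour2 : cmd S :=
  While RT isSome (Pop RT (fun a =>
    if a is Some s then Seq (Push RD s) (Push RU s) else Skip S)).

Lemma pour2P io d s u :
  xexec pour2 [:: io; d; s; u; [::]] (6 * size s + 1)
    [:: io; catrev s d; [::]; catrev s u; [::]].
Proof.
elim: s d u => [|a s IH] d u; first exact: xwhileF.
apply: (xwhileT (n1 := 5) _ _ (IH _ _)) => //=; last by lia.
apply: (xpop (n := 4)) => //.
by apply: (xseq (n1 := 2) (n2 := 2)) => //; exact: xpush.
Qed.

Definition discard : cmd S := While RT isSome (Pop RT (fun=> Skip S)).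

Lemma discardP io d s u :
  xexec discard [:: io; d; s; u; [::]] (3 * size s + 1)
    [:: io; d; [::]; u; [::]].
Proof.
elim: s => [|a s IH]; first exact: xwhileF.
apply: (xwhileT (n1 := 2) _ _ IH) => //=; last by lia.
by apply: (xpop (n := 1)) => //; exact: xskip.
Qed.

Definition dst (s : seq S) : store S := [:: [::]; s; [::]; [::]; [::]].

Definition drop_val := Seq (grab RT) discard.

Lemma drop_valP x rest :
  xexec drop_val (dst (ser x ++ rest)) (20 * vsize x) (dst rest).
Proof.
apply: xseq (grabP true _ _ _ _ _) (discardP _ _ _ _) _.
by rewrite catrevE cats0 size_rev -/(vsize x); have := vsize_gt0 x; lia.
Qed.

Lemma xto c st n st' n' st'' :
  xexec c st n st' -> st' = st'' -> n <= n' -> xexec c st n' st''.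
Proof. by move=> h <-; apply: xle h. Qed.

(** Every move between stacks reverses. After [grab], [pour2] restores the value on [RD] and [RU]
    together; the copy on [RU] needs two further pours to reach [RD] in the right order. *)
Definition dup_val := Seq (grab RT) (Seq pour2 (Seq (pour RU RT) (pour RT RD))).

Lemma dup_valP x rest :
  xexec dup_val (dst (ser x ++ rest)) (30 * vsize x) (dst (ser x ++ ser x ++ rest)).
Proof.
have x0 := vsize_gt0 x.
apply: xto.
- apply: xseq (grabP true _ _ _ _ _) _ (leqnn _).
  apply: xseq (pour2P _ _ _ _) _ (leqnn _).
  exact: xseq (pour_UT _ _ _ _) (pour_TD _ _ _ _) (leqnn _).
- by rewrite !catrevE !cats0 !revK.
by rewrite !catrevE !cats0 !revK !size_rev -/(vsize x); lia.
Qed.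

Definition swap_val := Seq (grab RT) (Seq (grab RU) (Seq (pour RT RD) (pour RU RD))).

Lemma swap_valP x y rest :
  xexec swap_val (dst (ser x ++ ser y ++ rest)) (20 * (vsize x + vsize y))
    (dst (ser y ++ ser x ++ rest)).
Proof.
have x0 := vsize_gt0 x; have y0 := vsize_gt0 y.
apply: xto.
- apply: xseq (grabP true _ _ _ _ _) _ (leqnn _).
  apply: xseq (grabP false _ _ _ _ _) _ (leqnn _).
  exact: xseq (pour_TD _ _ _ _) (pour_UD _ _ _ _) (leqnn _).
- by rewrite !catrevE !cats0 !revK.
by rewrite !catrevE !cats0 !size_rev -/(vsize x) -/(vsize y); lia.
Qed.

(** The quantifier over [rest] is a frame condition: other values can wait below on the data stack
    during a subcomputation. *)
Definition computes (c : cmd S) (x y : value) n :=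
  forall rest, xexec c (dst (ser x ++ rest)) n (dst (ser y ++ rest)).

Lemma computes_size c x y n : computes c x y n -> vsize y <= vsize x + n.
Proof.
move=> /(_ [::])[t le /exec_store_size].
rewrite /store_size.
rewrite !big_ord_recl !big_ord0 /stack /= !cats0 -/(vsize x) -/(vsize y).
by lia.
Qed.

Lemma computes_le c x y n n' : computes c x y n -> n <= n' -> computes c x y n'.
Proof. by move=> h le rest; apply: xle (h rest) le. Qed.

Lemma computes_seq c1 c2 x y z n1 n2 :
  computes c1 x y n1 -> computes c2 y z n2 -> computes (Seq c1 c2) x z (n1 + n2).
Proof. by move=> h1 h2 rest; apply: xseq (h1 rest) (h2 rest) _. Qed.

Definition pop_pair : cmd S := Pop RD (fun=> Skip S).

Lemma pop_pairP x y rest :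
  xexec pop_pair (dst (ser (Pair x y) ++ rest)) 2 (dst (ser x ++ ser y ++ rest)).
Proof. by apply: (xpop (n := 1)) => //; rewrite /= -catA; exact: xskip. Qed.

Lemma push_pairP x y rest :
  xexec (Push RD sym_pair) (dst (ser x ++ ser y ++ rest)) 2 (dst (ser (Pair x y) ++ rest)).
Proof. by rewrite /= -catA; apply: xpush. Qed.

Fixpoint push_all (s : seq S) : cmd S :=
  if s is a :: s then Seq (push_all s) (Push RD a) else Skip S.

Lemma push_allP s rest :
  xexec (push_all s) (dst rest) (2 * size s + 1) (dst (s ++ rest)).
Proof.
elim: s => [|a s IH]; first exact: xskip.
apply: xseq IH (xpush _ _ _ (leqnn 2)) _.
by rewrite /=; lia.
Qed.

Class Coded (X : Type) := code : X -> value.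
(** Elements of [T] are stored as single symbols; [dec] recovers them when a program branches on
    such a symbol. *)
Class Atom (T : Type) := { inj : T -> W; dec : W -> option T; injK : pcancel inj dec }.

Global Instance coded_atom (T : Type) {A : Atom T} : Coded T :=
  fun x => Leaf (Some (inj x)).
Global Instance coded_seq (X : Type) {cX : Coded X} : Coded (seq X) :=
  foldr (fun x v => Pair (code x) v) (Leaf None).
Global Instance coded_prod (X Y : Type) {cX : Coded X} {cY : Coded Y} : Coded (X * Y) :=
  fun p => Pair (code p.1) (code p.2).
Global Instance coded_unit : Coded unit := fun=> Leaf None.
Global Instance coded_nat : Coded nat := fun n => code (nseq n tt).

Definition csize (X : Type) {cX : Coded X} (x : X) := vsize (code x).

Lemma csize_gt0 X {cX : Coded X} (x : X) : 0 < csize x.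
Proof. exact: vsize_gt0. Qed.

Lemma csize_pair X Y {cX : Coded X} {cY : Coded Y} (x : X) (y : Y) :
  csize (x, y) = (csize x + csize y).+1.
Proof. exact: vsize_pair. Qed.

Lemma csize_nil X {cX : Coded X} : csize ([::] : seq X) = 1. Proof. by []. Qed.

Lemma csize_cons X {cX : Coded X} (x : X) s : csize (x :: s) = (csize x + csize s).+1.
Proof. exact: vsize_pair. Qed.

Lemma csize_atom T {A : Atom T} (x : T) : csize x = 1. Proof. by []. Qed.

Lemma csize_nseq X {cX : Coded X} n (x : X) : csize (nseq n x) = n * (csize x).+1 + 1.
Proof. by elim: n => //= n IH; rewrite csize_cons IH; lia. Qed.

Lemma csize_nat (n : nat) : csize n = n.*2.+1.
Proof.
have -> : csize n = csize (nseq n tt) by [].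
by rewrite csize_nseq; change (csize tt) with 1; lia.
Qed.

Lemma csize_cat X {cX : Coded X} (s t : seq X) : csize (s ++ t) + 1 = csize s + csize t.
Proof. by elim: s => [|x s IH] /=; [rewrite csize_nil addnC | rewrite !csize_cons; lia]. Qed.

Lemma csize_rev X {cX : Coded X} (s : seq X) : csize (rev s) = csize s.
Proof.
elim: s => // x s IH; rewrite rev_cons -cats1.
by have := csize_cat (cX := cX) (rev s) [:: x]; rewrite !csize_cons csize_nil IH; lia.
Qed.

Lemma size_csize X {cX : Coded X} (s : seq X) : (size s).*2 < csize s.
Proof. by elim: s => //= x s IH; rewrite csize_cons; have := csize_gt0 (cX := cX) x; lia. Qed.

Lemma csize_take X {cX : Coded X} n (s : seq X) : csize (take n s) <= csize s.
Proof. by elim: s n => [|x s IH] [|n] //=; rewrite ?csize_nil // !csize_cons; have := IH n; lia. Qed.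

Lemma csize_drop X {cX : Coded X} n (s : seq X) : csize (drop n s) <= csize s.
Proof. by elim: s n => [|x s IH] [|n] //=; rewrite csize_cons; have := IH n; lia. Qed.

(* The base n.+1 is at least 2, so that these bounds absorb sums and products. *)
Definition polybounded X {cX : Coded X} (g : X -> nat) :=
  exists d, forall x, g x <= (csize x).+1 ^ d.

Lemma expn_le (a b d e : nat) : a <= b -> d <= e -> a.+1 ^ d <= b.+1 ^ e.
Proof.
move=> ab de; apply: (@leq_trans (b.+1 ^ d)); first by case: d {de} => // d; rewrite leq_exp2r.
by apply: leq_pexp2l.
Qed.

Section Polybounded.
Context {X : Type} {cX : Coded X}.
Implicit Types g h : X -> nat.

Lemma pb_le g h : (forall x, g x <= h x) -> polybounded h -> polybounded g.
Proof. by move=> gh [d H]; exists d => x; apply: leq_trans (H x). Qed.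

Lemma pb_const n : polybounded (fun _ : X => n).
Proof.
exists n => x; have := csize_gt0 (cX := cX) x; case: (csize x) => // m _.
by apply: leq_trans (ltnW (ltn_expl n (leqnn 2))) _; apply: expn_le.
Qed.

Lemma pb_csize : polybounded (fun x : X => csize x).
Proof. by exists 1 => x; rewrite expn1. Qed.

Lemma pb_mul g h : polybounded g -> polybounded h -> polybounded (fun x => g x * h x).
Proof. by move=> [d D] [e E]; exists (d + e) => x; rewrite expnD leq_mul. Qed.

Lemma pb_add g h : polybounded g -> polybounded h -> polybounded (fun x => g x + h x).
Proof.
move=> [d D] [e E]; exists (maxn d e).+1 => x.
have x2 : 2 <= (csize x).+1 by exact: csize_gt0.
rewrite expnS; apply: leq_trans (leq_mul x2 (leqnn _)).
rewrite mul2n -addnn; apply: leq_add.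
  by apply: leq_trans (D x) _; apply: expn_le => //; lia.
by apply: leq_trans (E x) _; apply: expn_le => //; lia.
Qed.

Lemma pb_exp g d : polybounded g -> polybounded (fun x => g x ^ d).
Proof. by move=> [e E]; exists (e * d) => x; rewrite expnM; case: d => // d; rewrite leq_exp2r. Qed.

Lemma pb_comp Y {cY : Coded Y} (f : X -> Y) (h : Y -> nat) :
  polybounded (fun x => csize (f x)) -> polybounded h -> polybounded (fun x => h (f x)).
Proof.
move=> pf [e E]; apply: pb_le (fun x => E (f x)) _; apply: pb_exp.
by apply: pb_le (pb_add pf (pb_const 1)) => x; lia.
Qed.

End Polybounded.

Definition polytime X Y {cX : Coded X} {cY : Coded Y} (f : X -> Y) :=
  exists c, exists2 t : X -> nat, polybounded t &
    forall x, computes c (code x) (code (f x)) (t x).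

Lemma pt_size X Y {cX : Coded X} {cY : Coded Y} (f : X -> Y) :
  polytime f -> polybounded (fun x => csize (f x)).
Proof.
move=> [c [t pt H]]; apply: pb_le (pb_add pb_csize pt) => x.
exact: computes_size (H x).
Qed.

Lemma pt_ext X Y {cX : Coded X} {cY : Coded Y} (f g : X -> Y) :
  polytime f -> f =1 g -> polytime g.
Proof. by move=> [c [t pt H]] e; exists c, t => // x; rewrite -e. Qed.

(** Types that share serializations are converted for free, for instance [(y, s)] to [y :: s] and
    [n] to [nseq n tt]. *)
Lemma pt_recode X Y {cX : Coded X} {cY : Coded Y} (f : X -> Y) :
  (forall x, code (f x) = code x) -> polytime f.
Proof.
move=> E; exists (Skip S), (fun=> 1); first exact: pb_const.
by move=> x rest; rewrite E; exact: xskip.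
Qed.

Lemma pt_id X {cX : Coded X} : polytime (fun x : X => x).
Proof. exact: pt_recode. Qed.

Lemma pt_comp X Y Z {cX : Coded X} {cY : Coded Y} {cZ : Coded Z}
  (f : X -> Y) (g : Y -> Z) : polytime f -> polytime g -> polytime (fun x => g (f x)).
Proof.
move=> pf; have sf := pt_size pf; case: pf => [c1 [t1 p1 H1]] [c2 [t2 p2 H2]].
exists (Seq c1 c2), (fun x => t1 x + t2 (f x)).
  by apply: pb_add => //; apply: pb_comp.
by move=> x; apply: computes_seq.
Qed.

(** The argument is duplicated and [f] is run on the top copy; a swap brings up the other copy for
    [g], and a second swap restores the order. *)
Lemma pt_pair X Y Z {cX : Coded X} {cY : Coded Y} {cZ : Coded Z}
  (f : X -> Y) (g : X -> Z) :
  polytime f -> polytime g -> polytime (fun x => (f x, g x)).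
Proof.
move=> pf pg; have sf := pt_size pf; have sg := pt_size pg.
case: pf => [c1 [t1 p1 H1]]; case: pg => [c2 [t2 p2 H2]].
exists (Seq dup_val (Seq c1 (Seq swap_val (Seq c2 (Seq swap_val (Push RD sym_pair)))))).
exists (fun x => 30 * csize x + (t1 x + (20 * (csize (f x) + csize x) +
    (t2 x + (20 * (csize (g x) + csize (f x)) + 2))))).
  have pc := @pb_csize X cX.
  by do !(exact: pc || exact: sf || exact: sg || exact: p1 || exact: p2 ||
          exact: pb_const || apply: pb_add || apply: pb_mul).
move=> x rest.
apply: xseq (dup_valP _ _) _ (leqnn _).
apply: xseq (H1 _ _) _ (leqnn _).
apply: xseq (swap_valP _ _ _) _ (leqnn _).
apply: xseq (H2 _ _) _ (leqnn _).
apply: xseq (swap_valP _ _ _) _ (leqnn _).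
exact: push_pairP.
Qed.

Lemma pt_fst X Y {cX : Coded X} {cY : Coded Y} : polytime (fun p : X * Y => p.1).
Proof.
exists (Seq pop_pair (Seq swap_val drop_val)), (fun p => 50 * csize p).
  by apply: pb_mul; [exact: pb_const | exact: pb_csize].
case=> x y rest; apply: xseq (pop_pairP _ _ _) _ _.
  exact: xseq (swap_valP _ _ _) (drop_valP _ _) (leqnn _).
rewrite csize_pair /=; rewrite /csize; lia.
Qed.

Lemma pt_snd X Y {cX : Coded X} {cY : Coded Y} : polytime (fun p : X * Y => p.2).
Proof.
exists (Seq pop_pair drop_val), (fun p => 50 * csize p).
  by apply: pb_mul; [exact: pb_const | exact: pb_csize].
case=> x y rest; apply: xseq (pop_pairP _ _ _) (drop_valP _ _) _.
rewrite csize_pair /=; rewrite /csize; lia.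
Qed.

Lemma pt_const X Y {cX : Coded X} {cY : Coded Y} (y : Y) : polytime (fun _ : X => y).
Proof.
exists (Seq drop_val (push_all (ser (code y)))), (fun x => 20 * csize x + (2 * csize y + 1)).
  by apply: pb_add; [apply: pb_mul; [exact: pb_const | exact: pb_csize] | exact: pb_const].
move=> x rest; exact: xseq (drop_valP _ _) (push_allP _ _) (leqnn _).
Qed.

(** As [W] is finite, a separate program for each symbol fits into the continuation of one [Pop]; no
    uniformity in the atom is asked of [f]. Symbols that decode to nothing get a dummy program, and
    the sum over all symbols bounds the time. *)
Lemma pt_atom T X Z {A : Atom T} {cX : Coded X} {cZ : Coded Z} (f : T -> X -> Z) :
  (forall a, polytime (f a)) -> polytime (fun p : T * X => f p.1 p.2).
Proof.
move=> pf.
have H (w : W) : exists c : cmd S, exists t : X -> nat, polybounded t /\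
    if dec w is Some a then forall x, computes c (code x) (code (f a x)) (t x) else True.
  case: (dec w) => [a|]; last by exists (Skip S), (fun=> 0); split=> //; exact: pb_const.
  by have [c [t pt H]] := pf a; exists c, t.
have [c Hc] := fin_all_exists H; have [t Ht] := fin_all_exists Hc.
exists (Seq pop_pair (Pop RD (fun s =>
  if s is Some (inr (Some (Some w))) then c w else Skip S))).
exists (fun p => 2 + (1 + \sum_w t w p.2)).
  do 2 (apply: pb_add; first exact: pb_const).
  apply: (pb_comp (f := snd) (h := fun x => \sum_w t w x)) (pt_size (@pt_snd T X _ _)) _.
  elim: (index_enum W) => [|w s IH].
    by apply: pb_le (pb_const 0) => x; rewrite big_nil.
  by apply: pb_le (pb_add (Ht w).1 IH) => x; rewrite big_cons.
case=> a x rest; apply: xseq (pop_pairP _ _ _) _ (leqnn _) => /=.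
apply: (xpop (n := \sum_w t w x)) => //=.
have := (Ht (@inj T A a)).2; rewrite injK => /(_ x rest) h; apply: xle h _.
by rewrite (bigD1 (@inj T A a)) //= leq_addr.
Qed.

Lemma pt_cons X Y {cX : Coded X} {cY : Coded Y} (f : X -> Y) (g : X -> seq Y) :
  polytime f -> polytime g -> polytime (fun x => f x :: g x).
Proof.
move=> pf pg; apply: (pt_comp (g := fun p : Y * seq Y => p.1 :: p.2)) (pt_pair pf pg) _.
exact: pt_recode.
Qed.

(** The top symbol tells a cons from nil. After a cons the popped symbol is put back and the values
    are nested anew as [(x, (a, s))], since [a :: s] and [(a, s)] have the same code. *)
Lemma pt_seq_case A X Z {cA : Coded A} {cX : Coded X} {cZ : Coded Z}
  (l : X -> seq A) (f0 : X -> Z) (f1 : X -> A -> seq A -> Z) :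
  polytime l -> polytime f0 ->
  polytime (fun p : X * (A * seq A) => f1 p.1 p.2.1 p.2.2) ->
  polytime (fun x => if l x is a :: s then f1 x a s else f0 x).
Proof.
move=> pl [c0 [t0 p0 H0]] [c1 [t1 p1 H1]].
pose h (p : seq A * X) := if p.1 is a :: s then f1 p.2 a s else f0 p.2.
apply: (pt_comp (g := h)) (pt_pair pl pt_id) _.
exists (Seq pop_pair (Pop RD (fun a =>
  if a is Some (inr None) then Seq (Push RD sym_pair) (Seq swap_val (Seq (Push RD sym_pair) c1))
  else c0))).
pose g (p : seq A * X) := if p.1 is a :: s then t1 (p.2, (a, s)) else 0.
exists (fun p => 2 + (20 * csize p + (8 + (t0 p.2 + g p)))).
  apply: pb_add; first exact: pb_const.
  apply: pb_add; first by apply: pb_mul; [exact: pb_const | exact: pb_csize].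
  apply: pb_add; first exact: pb_const.
  apply: pb_add; first exact: pb_comp (pt_size (@pt_snd (seq A) X _ _)) p0.
  have [d D] := p1; exists d => -[[|a s] x] //=.
  apply: leq_trans (D _) _; apply: expn_le => //.
  by rewrite !csize_pair csize_cons /=; lia.
case=> -[|a s] x rest; apply: xseq (pop_pairP _ _ _) _ (leqnn _) => /=.
  by apply: (xpop (n := t0 x)); [exact: H0 | rewrite /g /=; lia].
apply: (xpop (n := 20 * csize (a :: s, x) + (t1 (x, (a, s)) + 6))); last by rewrite /g /=; lia.
rewrite /= -catA; apply: (xseq (n1 := 2)); first exact: (push_pairP (code a) (code s)).
  apply: xseq (swap_valP _ _ _) _ (leqnn _).
  apply: xseq (push_pairP _ _ _) (H1 (x, (a, s)) rest) (leqnn _).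
by rewrite csize_pair /csize -/(code (a, s)) -!/(csize _); lia.
Qed.

End Values.

(** * Iteration, exponential time *)

Section Folds.
Context {L W : finType}.
Notation K := (option (option W)).
Notation S := (L + K)%type.
Notation Coded := (@Coded W).
Notation Atom := (@Atom W).
Notation polytime := (@polytime L W _ _ _ _).
Notation csize := (@csize L W _ _).
Notation pt_id := (@pt_id L W).
Notation polybounded := (@polybounded L W _ _).

(** Taking off the outer pair symbol exposes the first symbol of the remaining list, a pair symbol
    exactly when an element is left. The final [Pop] discards the nil leaf. *)
Definition loop_cmd (c : cmd S) : cmd S :=
  Seq (pop_pair L W)
    (Seq (While RD (fun a => a == Some (sym_pair L W))
            (Seq (Push RD (sym_pair L W)) (Seq c (pop_pair L W))))
         (Pop RD (fun=> Skip S))).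

Section Loop.
Context {A X B : Type} {cA : Coded A} {cX : Coded X} {cB : Coded B}.
Variables (step : X -> B -> A -> B).

Definition loop_body (p : seq A * (X * B)) : seq A * (X * B) :=
  if p.1 is a :: s then (s, (p.2.1, step p.2.1 p.2.2 a)) else p.

Lemma pt_loop_body :
  polytime (fun p : X * B * A => step p.1.1 p.1.2 p.2) -> polytime loop_body.
Proof.
move=> ps.
apply: (pt_ext (f := fun p : seq A * (X * B) =>
   match p.1 with a :: s => (s, (p.2.1, step p.2.1 p.2.2 a)) | [::] => p end)) => //.
apply: (pt_seq_case (l := fst)
  (f1 := fun p a s => (s, (p.2.1, step p.2.1 p.2.2 a)))); first exact: pt_fst.
  exact: pt_id.
pose T := ((seq A * (X * B)) * (A * seq A))%type.
have p1 : polytime (fun q : T => q.1) by exact: pt_fst.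
have p2 : polytime (fun q : T => q.2) by exact: pt_snd.
have p12 : polytime (fun q : T => q.1.2) by apply: (pt_comp p1); exact: pt_snd.
have p121 : polytime (fun q : T => q.1.2.1) by apply: (pt_comp p12); exact: pt_fst.
have p122 : polytime (fun q : T => q.1.2.2) by apply: (pt_comp p12); exact: pt_snd.
have p21 : polytime (fun q : T => q.2.1) by apply: (pt_comp p2); exact: pt_fst.
have p22 : polytime (fun q : T => q.2.2) by apply: (pt_comp p2); exact: pt_snd.
apply: (pt_pair p22); apply: (pt_pair p121).
exact: pt_comp (pt_pair (pt_pair p121 p122) p21) ps.
Qed.

Lemma loop_cmdP (c : cmd S) (t : seq A * (X * B) -> nat) s x acc n :
  (forall p, computes c (code p) (code (loop_body p)) (t p)) ->
  (forall k, k < size s -> t (drop k s, (x, foldl (step x) acc (take k s))) <= n) ->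
  computes (loop_cmd c) (code (s, (x, acc))) (code (x, foldl (step x) acc s))
    (2 + (size s * (n + 6) + 1 + 2)).
Proof.
move=> H Hn rest.
apply: xseq (pop_pairP _ _ _) _ (leqnn _).
apply: (xseq (st1 := dst (ser L (code ([::] : seq A)) ++
  ser L (code (x, foldl (step x) acc s)) ++ rest)) _ _ (leqnn _)); last first.
  by apply: (xpop (n := 1)) => //; exact: xskip.
elim: s acc Hn => [|a s IH] acc Hn.
  by apply: xwhileF.
have h0 : t (a :: s, (x, acc)) <= n by exact: (Hn 0).
apply: (xwhileT (n1 := n + 4) _ _ (IH (step x acc a) _)) => //.
- apply: (xseq (n1 := 2) (n2 := t (a :: s, (x, acc)) + 2)).
  + exact: (push_pairP (code (a :: s)) (code (x, acc))).
  + by apply: xseq (H (a :: s, (x, acc)) rest) (pop_pairP _ _ _) (leqnn _).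
  + by lia.
- by move=> k ks; apply: (Hn k.+1).
- by rewrite /= mulSn; lia.
Qed.
End Loop.

(** Sums, products and fixed powers stay in this class, but a composition of two such functions can
    be doubly exponential; below, one side of every composition is polynomial. *)
Definition expbounded X {cX : Coded X} (g : X -> nat) :=
  exists d, forall x, g x <= 2 ^ ((csize x).+1 ^ d).

Section Expbounded.
Context {X : Type} {cX : Coded X}.
Implicit Types g h : X -> nat.

Lemma eb_le g h : (forall x, g x <= h x) -> expbounded h -> expbounded g.
Proof. by move=> gh [d H]; exists d => x; apply: leq_trans (H x). Qed.

Lemma eb_exp2 g : polybounded g -> expbounded (fun x => 2 ^ g x).
Proof. by move=> [d H]; exists d => x; rewrite leq_exp2l. Qed.

Lemma eb_pb g : polybounded g -> expbounded g.
Proof. by move=> pg; apply: eb_le (eb_exp2 pg) => x; apply: ltnW; apply: ltn_expl. Qed.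

Lemma eb_mul g h : expbounded g -> expbounded h -> expbounded (fun x => g x * h x).
Proof.
move=> [d D] [e E].
have p : polybounded (fun x => (csize x).+1 ^ d + (csize x).+1 ^ e).
  by apply: pb_add; [exists d | exists e].
by apply: eb_le (eb_exp2 p) => x; rewrite expnD leq_mul.
Qed.

Lemma eb_add g h : expbounded g -> expbounded h -> expbounded (fun x => g x + h x).
Proof.
move=> eg eh.
have e1 n : expbounded (fun _ : X => n) by apply: eb_pb; exact: pb_const.
have [d D] := eg; have [e E] := eh.
have p : polybounded (fun x => ((csize x).+1 ^ d + (csize x).+1 ^ e) + 1).
  apply: pb_add; last exact: pb_const.
  by apply: pb_add; [exists d | exists e].
apply: eb_le (eb_exp2 p) => x; rewrite expnD expn1 muln2 -addnn.
apply: leq_add; [apply: leq_trans (D x) _ | apply: leq_trans (E x) _];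
  rewrite leq_exp2l //; lia.
Qed.

Lemma eb_exp g d : expbounded g -> expbounded (fun x => g x ^ d).
Proof.
move=> eg; elim: d => [|d IH]; first by apply: eb_pb; exact: pb_const.
by apply: eb_le (eb_mul eg IH) => x; rewrite expnS.
Qed.

Lemma eb_comp_pb Y {cY : Coded Y} (f : X -> Y) (h : Y -> nat) :
  expbounded (fun x => csize (f x)) -> polybounded h -> expbounded (fun x => h (f x)).
Proof.
move=> ef [d D]; apply: (eb_le (fun x => D (f x))); apply: eb_exp.
apply: (eb_le (h := fun x => csize (f x) + 1)) => [x|]; first by lia.
by apply: eb_add => //; apply: eb_pb; exact: pb_const.
Qed.

Lemma eb_comp Y {cY : Coded Y} (f : X -> Y) (h : Y -> nat) :
  polybounded (fun x => csize (f x)) -> expbounded h -> expbounded (fun x => h (f x)).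
Proof.
move=> pf [d D]; apply: (eb_le (fun x => D (f x))); apply: eb_exp2.
by apply: (pb_comp (h := fun y => (csize y).+1 ^ d)) pf _; exists d.
Qed.

End Expbounded.

Definition exptime X Y {cX : Coded X} {cY : Coded Y} (f : X -> Y) :=
  exists c, exists2 t : X -> nat, expbounded t &
    forall x, computes (L := L) c (code x) (code (f x)) (t x).

Lemma et_comp_r X Y Z {cX : Coded X} {cY : Coded Y} {cZ : Coded Z}
  (f : X -> Y) (g : Y -> Z) : polytime f -> exptime g -> exptime (fun x => g (f x)).
Proof.
move=> pf; have sf := pt_size pf; case: pf => [c1 [t1 p1 H1]] [c2 [t2 p2 H2]].
exists (Seq c1 c2), (fun x => t1 x + t2 (f x)).
  by apply: eb_add; [exact: eb_pb | exact: eb_comp].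
by move=> x; apply: computes_seq.
Qed.

Lemma et_comp_l X Y Z {cX : Coded X} {cY : Coded Y} {cZ : Coded Z}
  (f : X -> Y) (g : Y -> Z) : exptime f -> polytime g -> exptime (fun x => g (f x)).
Proof.
move=> [c1 [t1 p1 H1]] [c2 [t2 p2 H2]].
exists (Seq c1 c2), (fun x => t1 x + t2 (f x)).
  apply: eb_add => //; apply: eb_comp_pb p2.
  apply: (eb_le (h := fun x => csize x + t1 x)).
    by move=> x; exact: computes_size (H1 x).
  by apply: eb_add => //; apply: eb_pb; exact: pb_csize.
by move=> x; apply: computes_seq.
Qed.

Section FoldTime.
Context {A X B : Type} {cA : Coded A} {cX : Coded X} {cB : Coded B}.
Variables (step : X -> B -> A -> B) (s : X -> seq A) (i : X -> B).
Hypotheses (ps : polytime s) (pi : polytime i).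
Hypothesis pstep : polytime (fun p : X * B * A => step p.1.1 p.1.2 p.2).

Let pstart : polytime (fun x => (s x, (x, i x))).
Proof. by apply: pt_pair => //; apply: pt_pair => //; exact: pt_id. Qed.

(** A round costs a fixed power of the size of the current state, so a single estimate covers
    polynomial as well as exponential [q]. *)
Lemma fold_time (q : X -> nat) :
  (forall x k, csize (foldl (step x) (i x) (take k (s x))) <= q x) ->
  exists c d, exists2 t : X -> nat, polybounded t & forall x,
    computes (L := L) c (code x) (code (x, foldl (step x) (i x) (s x)))
      (t x + size (s x) * ((t x + q x).+1 ^ d + 6)).
Proof.
move=> Hq; have [c [t [d pt] H]] := pt_loop_body pstep.
have [c0 [t0 pt0 H0]] := pstart.
exists (Seq c0 (loop_cmd c)), d.
exists (fun x => t0 x + 5 + (csize (s x) + csize x + 2)).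
  have [psz xsz] := (pt_size ps, @pb_csize L W X cX).
  by do !(exact: psz || exact: xsz || exact: pt0 || exact: pb_const || apply: pb_add).
move=> x; set n := (_ + q x).+1 ^ d.
apply: computes_le (computes_seq (H0 x) (loop_cmdP (n := n) H _)) _; last by lia.
move=> k ks; apply: leq_trans (pt _) _; apply: expn_le => //.
rewrite !csize_pair.
have h1 : csize (drop k (s x)) <= csize (s x) by exact: csize_drop.
have h2 := Hq x k; lia.
Qed.

Lemma pt_fold (q : X -> nat) : polybounded q ->
  (forall x k, csize (foldl (step x) (i x) (take k (s x))) <= q x) ->
  polytime (fun x => foldl (step x) (i x) (s x)).
Proof.
move=> pq Hq.
have h : polytime (fun x => (x, foldl (step x) (i x) (s x))); last first.
  by apply: (pt_comp (g := snd) h); exact: pt_snd.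
have [c [d [t pt H]]] := fold_time Hq.
exists c; eexists; last exact: H.
have psz : polybounded (fun x => size (s x)).
  apply: (pb_le (h := fun x => csize (s x))); last exact: pt_size.
  by move=> x; have h : (size (s x)).*2 < csize (s x) by [exact: size_csize]; lia.
apply: pb_add => //; apply: pb_mul => //; apply: pb_add; last exact: pb_const.
apply: (pb_exp (g := fun x => (t x + q x).+1)).
apply: (pb_le (h := fun x => t x + q x + 1)) => [x|]; first by lia.
by apply: pb_add; [exact: pb_add | exact: pb_const].
Qed.

(** The list is computed in polynomial time, so the rounds are polynomially many; only their
    accumulator may be exponentially large. The parameter is returned along with the result because
    the output stage reads both. *)
Lemma et_fold (q : X -> nat) : expbounded q ->
  (forall x k, csize (foldl (step x) (i x) (take k (s x))) <= q x) ->
  exptime (fun x => (x, foldl (step x) (i x) (s x))).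
Proof.
move=> eq Hq; have [c [d [t pt H]]] := fold_time Hq.
exists c; eexists; last exact: H.
have psz : polybounded (fun x => size (s x)).
  apply: (pb_le (h := fun x => csize (s x))); last exact: pt_size.
  by move=> x; have h : (size (s x)).*2 < csize (s x) by [exact: size_csize]; lia.
apply: eb_add; first exact: eb_pb.
apply: eb_mul; first exact: eb_pb.
apply: eb_add; last by apply: eb_pb; exact: pb_const.
apply: (eb_exp (g := fun x => (t x + q x).+1)).
apply: (eb_le (h := fun x => t x + q x + 1)) => [x|]; first by lia.
apply: eb_add; first by apply: eb_add => //; exact: eb_pb.
by apply: eb_pb; exact: pb_const.
Qed.

(** The increment may depend on the element but not on the accumulator, which excludes doubling in
    each round: the total growth is linear in the size of the list, with a polynomial factor. *)
Lemma pt_fold_add (q : X * A -> nat) : polybounded q ->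
  (forall x b a, csize (step x b a) <= csize b + q (x, a)) ->
  polytime (fun x => foldl (step x) (i x) (s x)).
Proof.
move=> [d pq] Hq.
apply: (pt_fold (q := fun x => csize (i x) +
    csize (s x) * (csize x + csize (s x) + 3) ^ d)).
  apply: pb_add; first exact: pt_size.
  apply: pb_mul; first exact: pt_size.
  apply: pb_exp; apply: pb_add; last exact: pb_const.
  by apply: pb_add; [exact: pb_csize | exact: pt_size].
move=> x k; set m := (csize x + _ + 3) ^ d.
have h2 : csize (take k (s x)) <= csize (s x) by exact: csize_take.
have h1 : csize (foldl (step x) (i x) (take k (s x))) <=
      csize (i x) + csize (take k (s x)) * m; last first.
  by apply: leq_trans h1 _; rewrite leq_add2l leq_mul2r h2 orbT.
move: h2.
elim: (take k (s x)) (i x) => [|a l IH] b /=; first by rewrite leq_addr.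
rewrite csize_cons => hl.
apply: leq_trans (IH _ _) _; first by lia.
have h1 := Hq x b a.
have h2 : q (x, a) <= m.
  apply: leq_trans (pq _) _; rewrite csize_pair /m.
  apply: (@leq_trans ((csize x + csize (s x) + 2).+1 ^ d)); first by apply: expn_le; lia.
  by apply: eq_leq; congr (_ ^ d); lia.
nia.
Qed.
End FoldTime.
End Folds.

(** * Polynomial-time functions on lists *)

Section Combinators.
Context {L W : finType}.
Notation Coded := (@Coded W).
Notation Atom := (@Atom W).
Notation polytime := (@polytime L W _ _ _ _).

Lemma pt_fst' X Y Z {cX : Coded X} {cY : Coded Y} {cZ : Coded Z} (f : X -> Y * Z) :
  polytime f -> polytime (fun x => (f x).1).
Proof. by move=> h; apply: (pt_comp (g := fst) h); exact: pt_fst. Qed.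

Lemma pt_snd' X Y Z {cX : Coded X} {cY : Coded Y} {cZ : Coded Z} (f : X -> Y * Z) :
  polytime f -> polytime (fun x => (f x).2).
Proof. by move=> h; apply: (pt_comp (g := snd) h); exact: pt_snd. Qed.

Lemma pt_comp2 X A B C {cX : Coded X} {cA : Coded A} {cB : Coded B} {cC : Coded C}
  (f : A -> B -> C) (g : X -> A) (h : X -> B) :
  polytime (fun p : A * B => f p.1 p.2) -> polytime g -> polytime h ->
  polytime (fun x => f (g x) (h x)).
Proof. by move=> pf pg ph; apply: (pt_comp (pt_pair pg ph) pf). Qed.

Lemma pt_atom_fun X T Z {cX : Coded X} {A : Atom T} {cZ : Coded Z} (g : T -> Z) (h : X -> T) :
  polytime h -> polytime (fun x => g (h x)).
Proof.
move=> ph; apply: (pt_comp (f := fun x => (h x, tt)) (g := fun p => g p.1)).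
  by apply: pt_pair => //; exact: pt_const.
by apply: (pt_atom (f := fun a _ => g a)) => a; exact: pt_const.
Qed.

Lemma pt_atom_case X T Z {cX : Coded X} {A : Atom T} {cZ : Coded Z} (g : X -> T)
  (f : T -> X -> Z) :
  polytime g -> (forall a, polytime (f a)) -> polytime (fun x => f (g x) x).
Proof.
move=> pg pf; apply: (pt_comp (f := fun x => (g x, x)) (g := fun p => f p.1 p.2)).
  by apply: pt_pair => //; exact: pt_id.
exact: pt_atom.
Qed.

Context {Abool : Atom bool}.

Lemma pt_if X Z {cX : Coded X} {cZ : Coded Z} (b : X -> bool) (f g : X -> Z) :
  polytime b -> polytime f -> polytime g ->
  polytime (fun x => if b x then f x else g x).
Proof.
move=> pb pf pg.
by apply: (pt_atom_case (f := fun b x => if b then f x else g x) pb) => -[].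
Qed.

Lemma pt_negb X {cX : Coded X} (b : X -> bool) :
  polytime b -> polytime (fun x => ~~ b x).
Proof. exact: pt_atom_fun. Qed.

Lemma pt_andb X {cX : Coded X} (b c : X -> bool) :
  polytime b -> polytime c -> polytime (fun x => b x && c x).
Proof. by move=> pb pc; apply: pt_if => //; exact: pt_const. Qed.

Lemma pt_orb X {cX : Coded X} (b c : X -> bool) :
  polytime b -> polytime c -> polytime (fun x => b x || c x).
Proof. by move=> pb pc; apply: (pt_if (f := fun=> true)) => //; exact: pt_const. Qed.

End Combinators.

Ltac pt_step :=
  first [assumption | lazymatch goal with
  | |- _ (fun x => x) => exact: pt_id
  | |- _ (@fst _ _) => exact: pt_fst
  | |- _ (@snd _ _) => exact: pt_snd
  | |- _ (fun _ => ?c) => exact: pt_const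
  | |- _ (fun x => fst (@?f x)) => apply: (pt_fst' (f := f))
  | |- _ (fun x => snd (@?f x)) => apply: (pt_snd' (f := f))
  | |- _ (fun x => (@?f x, @?g x)) => apply: (pt_pair (f := f) (g := g))
  | |- _ (fun x => @?f x :: @?g x) => apply: (pt_cons (f := f) (g := g))
  | |- _ (fun x => @?f x && @?g x) => apply: (pt_andb (b := f) (c := g))
  | |- _ (fun x => @?f x || @?g x) => apply: (pt_orb (b := f) (c := g))
  | |- _ (fun x => ~~ @?f x) => apply: (pt_negb (b := f))
  end].
Ltac pt := repeat pt_step.

Ltac pb := repeat first [ assumption | lazymatch goal with
  | |- _ (fun _ => ?c) => exact: pb_const
  | |- _ (fun x => @?f x + @?g x) => apply: (pb_add (g := f) (h := g))
  | |- _ (fun x => @?f x * @?g x) => apply: (pb_mul (g := f) (h := g))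
  | |- _ (fun x => @csize _ _ _ _ x) => exact: pb_csize
  | |- _ (fun x => @csize _ _ _ _ (@?f x)) => apply: (pt_size (f := f)); pt
  end].

Section Lists.
Context {L W : finType}.
Notation Coded := (@Coded W).
Notation Atom := (@Atom W).
Notation polytime := (@polytime L W _ _ _ _).
Notation csz := (@csize L W _ _).
Notation polybounded := (@polybounded L W _ _).
Context {Abool : Atom bool}.

Lemma foldl_cons A (s acc : seq A) : foldl (fun acc a => a :: acc) acc s = catrev s acc.
Proof. by elim: s acc => //= a s IH acc; rewrite IH. Qed.

Lemma pt_catrev X A {cX : Coded X} {cA : Coded A} (s t : X -> seq A) :
  polytime s -> polytime t -> polytime (fun x => catrev (s x) (t x)).
Proof.
move=> ps ptt.
have h : polytime (fun x => foldl (fun acc a => a :: acc) (t x) (s x)).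
  apply: (pt_fold_add (step := fun _ acc a => a :: acc) _ _ _ (q := fun p => csz p.2 + 1)); pt.
    by pb.
  by move=> x b a; rewrite csize_cons /=; lia.
by apply: (pt_ext h) => x; rewrite foldl_cons.
Qed.

Lemma pt_rev X A {cX : Coded X} {cA : Coded A} (s : X -> seq A) :
  polytime s -> polytime (fun x => rev (s x)).
Proof. by move=> ps; apply: (pt_catrev (t := fun=> [::])); pt. Qed.

Lemma pt_cat X A {cX : Coded X} {cA : Coded A} (s t : X -> seq A) :
  polytime s -> polytime t -> polytime (fun x => s x ++ t x).
Proof.
move=> ps ptt; apply: (pt_ext (pt_catrev (pt_rev ps) ptt)) => x.
by rewrite catrevE revK.
Qed.

Lemma pt_flatten X A {cX : Coded X} {cA : Coded A} (s : X -> seq (seq A)) :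
  polytime s -> polytime (fun x => flatten (s x)).
Proof.
move=> ps.
have h : polytime (fun x => foldl (fun acc l => acc ++ l) [::] (s x)).
  apply: (pt_fold_add (step := fun _ acc l => acc ++ l) _ _ _ (q := fun p => csz p.2)); pt.
  - by apply: pt_cat; pt.
  - by pb.
  - by move=> x b a; rewrite -csize_cat /=; lia.
apply: (pt_ext h) => x.
have E acc : foldl (fun acc l => acc ++ l) acc (s x) = acc ++ flatten (s x).
  by elim: (s x) acc => [|l t IH] acc /=; rewrite ?cats0 // IH catA.
by rewrite E.
Qed.

Lemma pt_map X A B {cX : Coded X} {cA : Coded A} {cB : Coded B}
  (f : X -> A -> B) (s : X -> seq A) :
  polytime (fun p : X * A => f p.1 p.2) -> polytime s ->
  polytime (fun x => map (f x) (s x)).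
Proof.
move=> pf ps.
have h : polytime (fun x => foldl (fun acc a => f x a :: acc) [::] (s x)).
  apply: (pt_fold_add (step := fun x acc a => f x a :: acc) _ _ _
            (q := fun p => csz (f p.1 p.2) + 1)); pt.
  - by apply: (pt_comp2 (f := f)) => //; pt.
  - by pb.
  - by move=> x b a; rewrite csize_cons /=; lia.
apply: (pt_ext (pt_rev h)) => x.
have E acc : foldl (fun acc a => f x a :: acc) acc (s x) = catrev (map (f x) (s x)) acc.
  by elim: (s x) acc => [|l t IH] acc /=; rewrite ?cats0 // IH.
by rewrite E catrevE cats0 revK.
Qed.

Lemma pt_all X A {cX : Coded X} {cA : Coded A} (f : X -> A -> bool) (s : X -> seq A) :
  polytime (fun p : X * A => f p.1 p.2) -> polytime s ->
  polytime (fun x => all (f x) (s x)).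
Proof.
move=> pf ps.
have h : polytime (fun x => foldl (fun b a => b && f x a) true (s x)).
  apply: (pt_fold_add (step := fun x b a => b && f x a) _ _ _ (q := fun p => 0)); pt.
  - by apply: (pt_comp2 (f := f)) => //; pt.
  - by pb.
  - by move=> x b a; rewrite !csize_atom.
apply: (pt_ext h) => x.
have E b : foldl (fun b a => b && f x a) b (s x) = b && all (f x) (s x).
  by elim: (s x) b => [|l t IH] b /=; rewrite ?andbT // IH andbA.
by rewrite E.
Qed.

Lemma pt_has X A {cX : Coded X} {cA : Coded A} (f : X -> A -> bool) (s : X -> seq A) :
  polytime (fun p : X * A => f p.1 p.2) -> polytime s ->
  polytime (fun x => has (f x) (s x)).
Proof.
move=> pf ps.
apply: (pt_ext (f := fun x => ~~ all (fun a => ~~ f x a) (s x))); last first.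
  by move=> x; rewrite -has_predC; apply: eq_has => a /=; rewrite negbK.
by apply: pt_negb; apply: (pt_all (f := fun x a => ~~ f x a)) => //; pt.
Qed.

Lemma pt_filter X A {cX : Coded X} {cA : Coded A} (f : X -> A -> bool) (s : X -> seq A) :
  polytime (fun p : X * A => f p.1 p.2) -> polytime s ->
  polytime (fun x => filter (f x) (s x)).
Proof.
move=> pf ps.
apply: (pt_ext (f := fun x => flatten (map (fun a => if f x a then [:: a] else [::]) (s x)))).
  apply: pt_flatten; apply: (pt_map (f := fun x a => if f x a then [:: a] else [::])) => //.
  by apply: pt_if; pt.
by move=> x; elim: (s x) => //= a t ->; case: (f x a).
Qed.

Lemma pt_behead X A {cX : Coded X} {cA : Coded A} (s : X -> seq A) :
  polytime s -> polytime (fun x => behead (s x)).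
Proof.
move=> ps; apply: (pt_ext (f := fun x => if s x is a :: t then t else [::])).
  by apply: (pt_seq_case (f1 := fun _ _ t => t)); pt.
by move=> x; case: (s x).
Qed.

Lemma pt_head X A {cX : Coded X} {cA : Coded A} (d : A) (s : X -> seq A) :
  polytime s -> polytime (fun x => head d (s x)).
Proof.
move=> ps; apply: (pt_ext (f := fun x => if s x is a :: t then a else d)).
  by apply: (pt_seq_case (f1 := fun _ a _ => a)); pt.
by move=> x; case: (s x).
Qed.

Lemma pt_nth X A {cX : Coded X} {cA : Coded A} (d : A) (s : X -> seq A) n :
  polytime s -> polytime (fun x => nth d (s x) n).
Proof.
elim: n s => [|n IH] s ps.
  by apply: (pt_ext (pt_head d ps)) => x; rewrite nth0.
by apply: (pt_ext (IH _ (pt_behead ps))) => x; rewrite nth_behead.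
Qed.

Lemma pt_nseq_tt X {cX : Coded X} (n : X -> nat) :
  polytime n -> polytime (fun x => nseq (n x) tt).
Proof. by move=> pn; apply: (pt_comp pn); exact: pt_recode. Qed.

Lemma nseq_size_tt (s : seq unit) : nseq (size s) tt = s.
Proof. by elim: s => //= -[] s ->. Qed.

Lemma pt_size_tt X {cX : Coded X} (s : X -> seq unit) :
  polytime s -> polytime (fun x => size (s x)).
Proof.
move=> ps; apply: (pt_comp ps); apply: pt_recode => t.
by rewrite -[in RHS](nseq_size_tt t).
Qed.

Lemma pt_succ X {cX : Coded X} (n : X -> nat) :
  polytime n -> polytime (fun x => (n x).+1).
Proof.
move=> pn; apply: (pt_ext (f := fun x => size (tt :: nseq (n x) tt))).
  by apply: pt_size_tt; pt; apply: pt_nseq_tt.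
by move=> x; rewrite /= size_nseq.
Qed.

Lemma pt_size_nat X A {cX : Coded X} {cA : Coded A} (s : X -> seq A) :
  polytime s -> polytime (fun x => size (s x)).
Proof.
move=> ps; apply: (pt_ext (f := fun x => size (map (fun=> tt) (s x)))).
  by apply: pt_size_tt; apply: (pt_map (f := fun _ _ => tt)); pt.
by move=> x; rewrite size_map.
Qed.

Lemma pt_addn X {cX : Coded X} (m n : X -> nat) :
  polytime m -> polytime n -> polytime (fun x => m x + n x).
Proof.
move=> pm pn; apply: (pt_ext (f := fun x => size (nseq (m x) tt ++ nseq (n x) tt))).
  by apply: pt_size_tt; apply: pt_cat; apply: pt_nseq_tt.
by move=> x; rewrite size_cat !size_nseq.
Qed.

Definition eqpolytime (A : eqType) {cA : Coded A} :=
  polytime (fun p : A * A => p.1 == p.2).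

Lemma pt_eq (A : eqType) X {cA : Coded A} {cX : Coded X} (f g : X -> A) :
  eqpolytime (A := A) -> polytime f -> polytime g -> polytime (fun x => f x == g x).
Proof. by move=> e pf pg; apply: (pt_comp (pt_pair pf pg) e). Qed.

Lemma eqpt_atom (T : eqType) {A : Atom T} : eqpolytime (A := T).
Proof.
apply: (pt_atom (f := fun a b => a == b)) => a.
by apply: (pt_atom_fun (fun b => a == b)); pt.
Qed.

Lemma eqpt_pair (A B : eqType) {cA : Coded A} {cB : Coded B} :
  eqpolytime (A := A) -> eqpolytime (A := B) -> eqpolytime (A := (A * B)%type).
Proof.
move=> eA eB.
apply: (pt_ext (f := fun p => (p.1.1 == p.2.1) && (p.1.2 == p.2.2))) => //.
by apply: pt_andb; apply: pt_eq => //; pt.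
Qed.

(** A fold over the first list consumes the second. The lists agree if no mismatch was flagged and
    nothing is left; if the second list runs out early, the flag stays false. *)
Lemma eqpt_seq (A : eqType) {cA : Coded A} :
  eqpolytime (A := A) -> eqpolytime (A := seq A).
Proof.
move=> eA; pose step (_ : seq A * seq A) (b : bool * seq A) a :=
  if b.2 is c :: t then (b.1 && (a == c), t) else (false, [::]).
have h : polytime (fun p : seq A * seq A => foldl (step p) (true, p.2) p.1).
  apply: (pt_fold_add (step := step) _ _ _ (q := fun p => 1)); pt.
  - apply: (pt_seq_case (l := fun p : seq A * seq A * (bool * seq A) * A => p.1.2.2)
      (f1 := fun p c t => (p.1.2.1 && (p.2 == c), t))); pt.
    by apply: pt_eq; pt.
  - by pb.
  - move=> x [b [|c t]] a; rewrite /step !csize_pair ?csize_cons /= !csize_atom ?csize_nil //.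
    by lia.
apply: (pt_ext (f := fun p => (foldl (step p) (true, p.2) p.1).1 &&
   (size (foldl (step p) (true, p.2) p.1).2 == 0))).
  apply: pt_andb; pt.
  apply: (pt_ext (f := fun p =>
    if (foldl (step p) (true, p.2) p.1).2 is _ :: _ then false else true)); last first.
    by move=> p; case: (foldl _ _ _).2.
  by apply: (pt_seq_case (f1 := fun _ _ _ => false)); pt.
case=> s t /=.
have E b : (foldl (step (s, t)) (b, t) s).1 && (size (foldl (step (s, t)) (b, t) s).2 == 0)
   = b && (s == t).
  move: (s, t) => st; elim: s t b => [|a s IH] [|c t] b //=; rewrite ?andbT ?andbF //.
    have {IH} : (foldl (step st) (false, [::]) s).1 = false by elim: s {IH}.
    by move=> ->.
  by rewrite /step /= IH eqseq_cons andbA.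
by rewrite E.
Qed.

Lemma eqpt_nat : eqpolytime (A := nat).
Proof.
have e1 : eqpolytime (A := unit).
  by apply: (pt_ext (f := fun=> true)); [pt | case=> -[] []].
apply: (pt_ext (f := fun p => nseq p.1 tt == nseq p.2 tt)).
  by apply: pt_eq; [exact: eqpt_seq | apply: pt_nseq_tt; pt | apply: pt_nseq_tt; pt].
case=> m n /=; apply/eqP/eqP => [|-> //].
by move/(congr1 size); rewrite !size_nseq.
Qed.

Lemma pt_mem (A : eqType) X {cA : Coded A} {cX : Coded X} (f : X -> A) (s : X -> seq A) :
  eqpolytime (A := A) -> polytime f -> polytime s -> polytime (fun x => f x \in s x).
Proof.
move=> eA pf ps; apply: (pt_ext (f := fun x => has (fun a => a == f x) (s x))).
  apply: (pt_has (f := fun x a => a == f x)) => //; apply: pt_eq => //; pt.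
  by apply: (pt_comp (f := fst)); pt.
by move=> x; rewrite has_pred1.
Qed.

(** Since [rs] does not depend on the input, the fold unrolls into a composition of fixed length.
    Hence there is no condition on the size of the accumulator, and each [r] may have its own
    program. *)
Lemma pt_foldl_const X B R {cX : Coded X} {cB : Coded B} (g : R -> X -> B -> B)
  (i : X -> B) (rs : seq R) :
  (forall r, polytime (fun p : X * B => g r p.1 p.2)) -> polytime i ->
  polytime (fun x => foldl (fun b r => g r x b) (i x) rs).
Proof.
move=> pg; elim: rs i => [|r rs IH] i pi //=.
by apply: (IH (fun x => g r x (i x))); apply: (pt_comp2 (f := g r)); pt.
Qed.

Lemma pt_map_const X B R {cX : Coded X} {cB : Coded B} (g : R -> X -> B) (rs : seq R) :
  (forall r, polytime (g r)) -> polytime (fun x => [seq g r x | r <- rs]).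
Proof. by move=> pg; elim: rs => [|r rs IH] /=; pt. Qed.

Lemma pt_all_const X R {cX : Coded X} (g : R -> X -> bool) (rs : seq R) :
  (forall r, polytime (g r)) -> polytime (fun x => all (g^~ x) rs).
Proof. by move=> pg; elim: rs => [|r rs IH] /=; pt. Qed.

Lemma pt_nat_case X Z {cX : Coded X} {cZ : Coded Z} (n : X -> nat) (f0 : X -> Z)
  (f1 : X -> nat -> Z) :
  polytime n -> polytime f0 -> polytime (fun p : X * nat => f1 p.1 p.2) ->
  polytime (fun x => if n x is m.+1 then f1 x m else f0 x).
Proof.
move=> pn p0 p1; apply: (pt_ext (f := fun x =>
  if nseq (n x) tt is a :: s then f1 x (size s) else f0 x)).
  apply: (pt_seq_case (cA := @coded_unit W) (l := fun x => nseq (n x) tt)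
    (f1 := fun x _ s => f1 x (size s))).
  - exact: pt_nseq_tt.
  - exact: p0.
  - apply: (pt_comp2 (f := f1) p1); [pt | apply: pt_size_tt; pt].
by move=> x; case: (n x) => //= m; rewrite size_nseq.
Qed.

Lemma csize_behead A {cA : Coded A} (s : seq A) : csz (behead s) <= csz s.
Proof. by case: s => //= a s; rewrite csize_cons; lia. Qed.

Lemma pt_nth_dyn X A {cX : Coded X} {cA : Coded A} (d : A) (s : X -> seq A) (n : X -> nat) :
  polytime s -> polytime n -> polytime (fun x => nth d (s x) (n x)).
Proof.
move=> ps pn.
have h : polytime (fun x => foldl (fun t _ => behead t) (s x) (nseq (n x) tt)).
  apply: (pt_fold_add (cA := @coded_unit W) (step := fun _ t _ => behead t) _ _ _ (q := fun=> 0)); pt.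
  - by apply: pt_behead; pt.
  - by pb.
  - by move=> x t _; rewrite addn0 csize_behead.
apply: (pt_ext (pt_head d h)) => x.
by elim: (n x) (s x) => [|m IH] t /=; [rewrite nth0 | rewrite IH nth_behead].
Qed.

(** The length of the accumulator is the next number. The increment thus depends on the accumulator,
    so an explicit bound, quadratic as numbers are unary, takes the place of [pt_fold_add]. *)
Lemma pt_iota X {cX : Coded X} (n : X -> nat) :
  polytime n -> polytime (fun x => iota 0 (n x)).
Proof.
move=> pn; pose step (_ : X) (acc : seq nat) (_ : unit) := size acc :: acc.
have E x m : foldl (step x) [::] (nseq m tt) = rev (iota 0 m).
  rewrite -[nseq m tt]cats0; elim: m => // m IH.
  rewrite -[m.+1]addn1 nseqD -catA foldl_cat -[nseq m tt]cats0 IH iotaD rev_cat /=.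
  by rewrite /step size_rev size_iota.
have Es m : csz (iota 0 m) <= m * (m.*2 + 2) + 1.
  have H i j : i + j <= m -> csz (iota i j) <= j * (m.*2 + 2) + 1; last exact: H.
  elim: j i => [|j IH] i ij //=; rewrite /= csize_cons csize_nat.
  have := IH i.+1; rewrite mulSn; lia.
have h : polytime (fun x => foldl (step x) [::] (nseq (n x) tt)).
  apply: (pt_fold (cA := @coded_unit W) (step := step) _ _ _
    (q := fun x => csz (n x) * (csz (n x) + 2) + 1)).
  - exact: pt_nseq_tt.
  - by pt.
  - by apply: pt_cons; [apply: pt_size_nat; pt | pt].
  - by pb.
  move=> x m; have -> : take m (nseq (n x) tt) = nseq (minn m (n x)) tt.
    by elim: (n x) m => [|i IH] [|m] //=; rewrite IH minnSS.
  rewrite E csize_rev; apply: leq_trans (Es _) _; rewrite csize_nat.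
  by rewrite leq_add2r; apply: leq_mul; lia.
by apply: (pt_ext (pt_rev h)) => x; rewrite E revK.
Qed.

End Lists.

(** * Words on the input and output tape *)

Section WordMachine.
Context {L W : finType} {AL : @Atom W L}.
Notation K := (option (option W)).
Notation S := (L + K)%type.

Definition read_input : cmd S :=
  Seq (Push RD (sym_leaf L None))
    (While RIO isSome (Pop RIO (fun a =>
       if a is Some (inl x) then
         Seq (Push RD (sym_leaf L (Some (inj x)))) (Push RD (sym_pair L W))
       else Skip S))).

Lemma read_inputP (w : seq L) :
  xexec read_input [:: map inl w; [::]; [::]; [::]; [::]] (6 * size w + 3)
    (dst (ser L (code (rev w)) ++ [::])).
Proof.
apply: (xseq (n1 := 2) (n2 := 6 * size w + 1)); [exact: xpush | | by lia].
rewrite -[rev w]/(catrev w [::]).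
have -> : set_stack [:: map inl w; [::]; [::]; [::]; [::]] RD
   (sym_leaf L None :: stack [:: map inl w; [::]; [::]; [::]; [::]] RD) =
   [:: map inl w; ser L (code ([::] : seq L)) ++ [::]; [::]; [::]; [::]] by [].
elim: w ([::] : seq L) => [|x w IH] acc; first by apply: xwhileF.
apply: (xwhileT (n1 := 5) _ _ (IH (x :: acc))) => //; last by rewrite /=; lia.
apply: (xpop (n := 4)) => //.
by apply: (xseq (n1 := 2) (n2 := 2)) => //; apply: xpush.
Qed.

Definition write_output : cmd S :=
  While RD (fun a => a == Some (sym_pair L W)) (Pop RD (fun=> Pop RD (fun a =>
    if a is Some (inr (Some (Some v))) then
      if dec v is Some x then Push RIO (inl x) else Skip S
    else Skip S))).

Lemma write_outputP (w : seq L) :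
  xexec write_output (dst (ser L (code w) ++ [::])) (6 * size w + 1)
    [:: map inl (rev w); [:: sym_leaf L None]; [::]; [::]; [::]].
Proof.
rewrite cats0 -[rev w]/(catrev w [::]) /dst -[X in X :: _]/(map inl ([::] : seq L)).
elim: w [::] => [|x w IH] acc; first exact: xwhileF.
apply: (xwhileT (n1 := 4) _ _ (IH (x :: acc))) => //; last by rewrite /=; lia.
apply: (xpop (n := 3)) => //; apply: (xpop (n := 2)) => //=.
by rewrite injK; apply: xpush.
Qed.

(** A word of length n has [csize] 2n + 1, so the left side is the exponent supplied by
    [expbounded], and the right side has the form required of machines. For n >= 2 it follows from
    2n + 2 <= n^3 and 3e < 4^e; the added constant covers n <= 1. *)
Lemma poly_exponent n e : (n.*2.+2) ^ e <= n ^ (4 ^ e) + 4 ^ e.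
Proof.
have h3 : 3 * e < 4 ^ e.
  by elim: e => // e IH; rewrite expnS; lia.
case: n => [|[|n]].
- by rewrite addnC; apply: leq_trans (leq_addr _ _); case: e {h3} => // e; rewrite leq_exp2r.
- by rewrite addnC; apply: leq_addr.
apply: leq_trans (leq_addr _ _).
apply: (@leq_trans (n.+2 ^ (3 * e))); last by apply: leq_pexp2l => //; lia.
rewrite expnM; case: e {h3} => // e; rewrite leq_exp2r //.
by rewrite !expnS expn0; nia.
Qed.

(* Reading the input onto the data stack and writing the output both reverse the word. *)
Lemma exptime_machine (f : seq L -> seq L) : exptime (L := L) f ->
  exists (M : machine L) (c : nat), forall w,
    outputs_within M (2 ^ (size w ^ c + c)) w (rev (f (rev w))).
Proof.
move=> [cf [t et H]].
pose g (v : seq L) := 6 * size v + 3 + (t v + (6 * size (f v) + 1)).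
have eg : expbounded (L := L) g.
  have hs : expbounded (L := L) (fun v : seq L => 6 * size v).
    apply: eb_pb; apply: pb_mul; first exact: pb_const.
    apply: (pb_le (h := fun v => csize L v)) => [v|]; last exact: pb_csize.
    by have h : (size v).*2 < csize L v by [exact: size_csize]; lia.
  have e1 n : expbounded (L := L) (fun _ : seq L => n) by apply: eb_pb; exact: pb_const.
  apply: eb_add; first exact: eb_add.
  apply: eb_add => //; apply: eb_add => //; apply: eb_mul => //.
  apply: (eb_le (h := fun v => csize L v + t v)).
    move=> v; have h : (size (f v)).*2 < csize L (f v) by exact: size_csize.
    have h1 : csize L (f v) <= csize L v + t v by exact: computes_size (H v).
    lia.
  by apply: eb_add => //; apply: eb_pb; exact: pb_csize.
have [e E] := eg.
exists (machine_of (Seq read_input (Seq cf write_output))), (4 ^ e) => w.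
have [n ln ex] : xexec (Seq read_input (Seq cf write_output))
    [:: map inl w; [::]; [::]; [::]; [::]] (g (rev w))
    [:: map inl (rev (f (rev w))); [:: sym_leaf L None]; [::]; [::]; [::]].
  apply: xseq (read_inputP w) _ _; last by rewrite /g size_rev.
  exact: xseq (H (rev w) [::]) (write_outputP _) (leqnn _).
apply: exec_machine ex _ _ => //.
apply: leq_trans ln _; apply: leq_trans (E _) _; rewrite leq_exp2l //.
have -> : csize L (rev w) = (size w).*2.+1.
  by rewrite csize_rev; elim: w => //= x w IH; rewrite csize_cons IH csize_atom; lia.
exact: poly_exponent.
Qed.

End WordMachine.

(** * Saturation of a tree grammar *)

Fixpoint AllP (T : Type) (P : T -> Prop) (s : seq T) : Prop :=
  if s is x :: s then P x /\ AllP P s else True.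

Fixpoint tree_induction (F : Type) (P : tree F -> Prop)
  (H : forall x ts, AllP P ts -> P (Node x ts)) (t : tree F) : P t :=
  match t with
  | Node x ts => H x ts
      ((fix all_subtrees (ts : seq (tree F)) : AllP P ts :=
         match ts with
         | [::] => I
         | t :: ts => conj (tree_induction H t) (all_subtrees ts)
         end) ts)
  end.

Section Generation.
Variables (F : Type) (rank : F -> nat) (G : grammar rank).
Notation N := (nonterms G).

(** Big-step generation: rewriting steps in different subtrees are independent, so their
    interleaving is forgotten and each nonterminal directly yields a terminal tree. *)
Inductive gen : tree (F + 'I_N) -> tree F -> Prop :=
  | GenRule B u t : List.In (B, u) (productions G) -> gen u t ->
      gen (Node (inr B) [::]) t
  | GenNode f us ts : gens us ts -> gen (Node (inl f) us) (Node f ts)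
with gens : seq (tree (F + 'I_N)) -> seq (tree F) -> Prop :=
  | GensNil : gens [::] [::]
  | GensCons u us t ts : gen u t -> gens us ts -> gens (u :: us) (t :: ts).

Scheme gen_mut := Minimality for gen Sort Prop
  with gens_mut := Minimality for gens Sort Prop.

Lemma gens_cat us1 us2 ts1 ts2 :
  gens us1 ts1 -> gens us2 ts2 -> gens (us1 ++ us2) (ts1 ++ ts2).
Proof.
by elim: us1 ts1 => [|u us1 IH] ts1 g1 g2; inversion g1 => //=; constructor=> //; apply: IH.
Qed.

Lemma gens_catl us1 u us2 ts : gens (us1 ++ u :: us2) ts ->
  exists ts1 t ts2, [/\ ts = ts1 ++ t :: ts2, gens us1 ts1, gen u t & gens us2 ts2].
Proof.
elim: us1 ts => [|u1 us1 IH] ts /= g; inversion g; subst.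
  by exists [::], t, ts0; split=> //; constructor.
have [ts1 [t' [ts2 [-> g1 g' g2]]]] := IH _ H3.
by exists (t :: ts1), t', ts2; split=> //; constructor.
Qed.

Lemma gen_terminal t : gen (map_tree inl t) t.
Proof.
elim/tree_induction: t => f ts H /=; constructor.
by elim: ts H => [|t ts IH] /= H; constructor; [apply: H.1 | apply: IH H.2].
Qed.

(** Absorbing single steps from the end of a derivation backwards gives one direction of
    [languageP]. *)
Lemma derives1_gen u u' t : @derives1 F rank G u u' -> gen u' t -> gen u t.
Proof.
move=> d; elim: d t => {u u'} [B u HB|x us1 u u' us2 _ IH] t g; first exact: GenRule HB g.
move Ew: (Node _ _) g => w g; case: g Ew => {w t} [B v t HB Hg [_]|f us ts Hg [-> E]].
  by case: (us1).
rewrite -E in Hg.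
have [ts1 [t' [ts2 [-> g1 g' g2]]]] := gens_catl Hg.
by constructor; apply: gens_cat => //; constructor=> //; apply: IH.
Qed.

Notation rtc := (Relation_Operators.clos_refl_trans_1n _ (@derives1 F rank G)).

Lemma rtc_trans u v w : rtc u v -> rtc v w -> rtc u w.
Proof. by elim=> // x y z xy _ IH /IH; apply: Relation_Operators.rt1n_trans. Qed.

Lemma rtc_child x us1 u u' us2 : rtc u u' ->
  rtc (Node x (us1 ++ u :: us2)) (Node x (us1 ++ u' :: us2)).
Proof.
elim=> [v|a b c ab _ IH]; first exact: Relation_Operators.rt1n_refl.
by apply: Relation_Operators.rt1n_trans IH; constructor.
Qed.

Lemma gen_rtc u t : gen u t -> rtc u (map_tree inl t).
Proof.
(* [pre] holds the siblings that are already terminal, so the children are derived from left to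
   right. *)
pose P us ts := forall x pre,
  rtc (Node x (pre ++ us)) (Node x (pre ++ map (@map_tree F (F + 'I_N) inl) ts)).
apply: (@gen_mut (fun u t => rtc u (map_tree inl t)) P) => {u t}.
- move=> B u t HB _ IH; apply: Relation_Operators.rt1n_trans IH.
  by constructor.
- by move=> f us ts _ IH; exact: (IH _ [::]).
- by move=> x pre; exact: Relation_Operators.rt1n_refl.
move=> u us t ts _ IH1 _ IH2 x pre.
apply: rtc_trans (rtc_child x pre us IH1) _.
by have := IH2 x (rcons pre (map_tree inl t)); rewrite !cat_rcons.
Qed.

Lemma languageP t : language G t <-> gen (Node (inr (axiom G)) [::]) t.
Proof.
split; last exact: gen_rtc.
rewrite /language; move: (Node (inr _) _) => u.
move Ew: (map_tree inl t) => w r; elim: r Ew => {u w} [u <-|u v w uv _ IH /IH].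
  exact: gen_terminal.
exact: derives1_gen.
Qed.

End Generation.

(** * Tables of reachable states with witness words *)

Section Saturation.
Variables (tau : signature) (k k' : nat) (ar : 'I_k' -> nat).
Notation sym := (dsym tau k ar).
Notation letter := (letter tau k ar).
Notation enc_tree := (@enc_tree tau k k' ar).

Variables (Q : finType) (delta : sym -> seq Q -> Q) (state : tree sym -> Q).
Hypothesis stateE : forall f ts, state (Node f ts) = delta f (map state ts).

Definition word := seq letter.
(** [(Some f, 0)] is a symbol of the alphabet; [(None, n)] is a nonterminal or any other number of
    the input. *)
Definition tok := (option sym * nat)%type.
Definition ntok (n : nat) : tok := (None, n).

Definition dedup_add (acc : seq (Q * word)) (e : Q * word) : seq (Q * word) :=
  if has (fun e' => e'.1 == e.1) acc then acc else e :: acc.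

(* One word per state keeps the lists bounded. *)
Definition dedup (s : seq (Q * word)) : seq (Q * word) := foldl dedup_add [::] s.

Definition lookup (T : seq ((nat * Q) * word)) (B : nat) : seq (Q * word) :=
  dedup [seq (e.1.2, e.2) | e <- [seq e <- T | e.1.1 == B]].

Definition comb1 (f : sym) (s : seq (Q * word)) : seq (Q * word) :=
  dedup [seq (delta f [:: e.1], inr f :: e.2) | e <- s].

Definition comb2 (f : sym) (s1 s2 : seq (Q * word)) : seq (Q * word) :=
  dedup (flatten [seq [seq (delta f [:: e1.1; e2.1], inr f :: (e1.2 ++ e2.2)) | e2 <- s2]
                 | e1 <- s1]).

(* Tokens are read from right to left: the list of the first child is on top. *)
Definition combine (f : sym) (st : seq (seq (Q * word))) : seq (seq (Q * word)) :=
  match drank f with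
  | 0 => [:: (delta f [::], [:: inr f])] :: st
  | 1 => comb1 f (head [::] st) :: behead st
  | _ => comb2 f (head [::] st) (head [::] (behead st)) :: behead (behead st)
  end.

Definition eval_step (T : seq ((nat * Q) * word)) st (t : tok) :=
  if t.1 is Some f then combine f st else lookup T t.2 :: st.

(** Old entries stay, repetitions included: [lookup] removes them when the table is read, and a step
    adds only boundedly many. *)
Definition saturate_step T (pr : nat * seq tok) : seq ((nat * Q) * word) :=
  [seq ((pr.1, e.1), e.2) | e <- head [::] (foldl (eval_step T) [::] pr.2)] ++ T.

Lemma dedup_sub s e : e \in dedup s -> e \in s.
Proof.
rewrite /dedup; have -> : (e \in s) = (e \in [::]) || (e \in s) by [].
elim: s [::] => [|a s IH] acc /=; first by rewrite orbF.
move/IH; rewrite /dedup_add; case: ifP => _; rewrite !inE.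
  by case/orP=> ->; rewrite ?orbT.
by case/orP=> [/orP[]|] ->; rewrite ?orbT.
Qed.

Lemma dedup_keys s : unzip1 (dedup s) =i unzip1 s.
Proof.
move=> q; rewrite /dedup.
have -> : (q \in unzip1 s) = (q \in unzip1 ([::] : seq (Q * word))) || (q \in unzip1 s) by [].
elim: s [::] => [|a s IH] acc /=; first by rewrite orbF.
rewrite IH inE /dedup_add; case: ifP => h; last by rewrite /= inE -orbA orbCA.
case: eqP => //= ->.
have -> // : a.1 \in unzip1 acc.
by move: h => /hasP[e ea /eqP <-]; apply: map_f.
Qed.

Section Correctness.
Variable G : grammar (@drank tau k k' ar).
Notation N := (nonterms G).
Notation gen := (@gen _ _ G).

Fixpoint tree_toks (u : tree (sym + 'I_N)) : seq tok :=
  let: Node x us := u in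
  (match x with inl f => (Some f, 0) | inr B => ntok B end) :: flatten (map tree_toks us).

Definition sound_list (u : tree (sym + 'I_N)) (s : seq (Q * word)) : Prop :=
  forall e, e \in s -> exists t, [/\ gen u t, e.1 = state t & e.2 = enc_tree t].

Definition sound_table (T : seq ((nat * Q) * word)) : Prop :=
  forall e, e \in T -> exists (B : 'I_N) t,
    [/\ e.1.1 = B, gen (Node (inr B) [::]) t, e.1.2 = state t & e.2 = enc_tree t].

Definition combine_sets (f : sym) (s : seq {set Q}) : {set Q} :=
  match s with
  | [::] => [set delta f [::]]
  | [:: A] => [set delta f [:: q] | q in A]
  | [:: A; B] => [set delta f [:: q1; q2] | q1 in A, q2 in B]
  | _ => set0
  end.

(** The evaluation with the words forgotten. It is monotone in [X], so the reachable pairs form a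
    least fixed point on a finite set, and completeness can be argued without words. *)
Fixpoint states (X : {set 'I_N * Q}) (u : tree (sym + 'I_N)) : {set Q} :=
  let: Node x us := u in
  match x with
  | inl f => combine_sets f (map (states X) us)
  | inr B => [set q | (B, q) \in X]
  end.

Definition produced (X : {set 'I_N * Q}) : {set 'I_N * Q} :=
  [set p | has (fun pr => (pr.1 == p.1) && (p.2 \in states X pr.2)) (productions G)].

Definition keys (T : seq ((nat * Q) * word)) : {set 'I_N * Q} :=
  [set p | (val p.1, p.2) \in unzip1 T].

Lemma states_mono (X Y : {set 'I_N * Q}) u : X \subset Y -> states X u \subset states Y u.
Proof.
move=> /subsetP XY; elim/tree_induction: u => -[f|B] us H /=; last first.
  by apply/subsetP=> q; rewrite !inE; apply: XY.
case: us H => [|u1 [|u2 [|u3 us]]] //= H; try exact: sub0set.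
- exact: imsetS H.1.
- exact: imset2S H.1 H.2.1.
Qed.

Lemma produced_mono : {homo produced : X Y / X \subset Y}.
Proof.
move=> X Y XY; apply/subsetP=> p; rewrite !inE; apply: sub_has => pr /andP[-> /=].
exact: (subsetP (states_mono _ XY)).
Qed.

Lemma sound_dedup u s : sound_list u s -> sound_list u (dedup s).
Proof. by move=> h e /dedup_sub; apply: h. Qed.

Lemma lookup_sound T (B : 'I_N) :
  sound_table T -> sound_list (Node (inr B) [::]) (lookup T B).
Proof.
move=> h; apply: sound_dedup => _ /mapP[e + ->]; rewrite mem_filter => /andP[/eqP eB eT].
have [B' [t [eB' g Es Ew]]] := h _ eT.
have -> : B = B' by apply: val_inj; rewrite /= -eB eB'.
by exists t.
Qed.

Lemma lookup_keys T (B : 'I_N) q : (q \in unzip1 (lookup T B)) = ((B, q) \in keys T).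
Proof.
rewrite dedup_keys inE; apply/mapP/mapP => /=.
  move=> [_ /mapP[e + ->] ->]; rewrite mem_filter => /andP[/eqP eB eT].
  by exists e; rewrite //= -eB; case: (e.1).
move=> [e eT /= Ee]; exists (q, e.2) => //; apply/mapP; exists e; rewrite -?Ee //.
by rewrite mem_filter eT -Ee eqxx.
Qed.

Lemma comb1_sound f u s :
  sound_list u s -> sound_list (Node (inl f) [:: u]) (comb1 f s).
Proof.
move=> h; apply: sound_dedup => _ /mapP[e /h[t [g Es Ew]] ->] /=.
exists (Node f [:: t]); split; last by rewrite /= cats0 Ew.
  by do !constructor.
by rewrite stateE /= Es.
Qed.

Lemma comb1_keys f s (A : {set Q}) : (forall q, (q \in unzip1 s) = (q \in A)) ->
  forall q, (q \in unzip1 (comb1 f s)) = (q \in combine_sets f [:: A]).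
Proof.
move=> h q; rewrite dedup_keys; apply/mapP/imsetP.
  by move=> [_ /mapP[e es ->] ->]; exists e.1 => //; rewrite -h map_f.
move=> [q']; rewrite -h => /mapP[e es ->] ->.
by exists (delta f [:: e.1], inr f :: e.2) => //; apply/mapP; exists e.
Qed.

Lemma comb2_sound f u1 u2 s1 s2 : sound_list u1 s1 -> sound_list u2 s2 ->
  sound_list (Node (inl f) [:: u1; u2]) (comb2 f s1 s2).
Proof.
move=> h1 h2; apply: sound_dedup => _ /allpairsP[[e1 e2] [/= he1 he2 ->]].
have [t1 [g1 Es1 Ew1]] := h1 _ he1; have [t2 [g2 Es2 Ew2]] := h2 _ he2.
exists (Node f [:: t1; t2]); split; last by rewrite /= cats0 Ew1 Ew2.
  by do !constructor.
by rewrite stateE /= Es1 Es2.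
Qed.

Lemma comb2_keys f s1 s2 (A B : {set Q}) : (forall q, (q \in unzip1 s1) = (q \in A)) ->
  (forall q, (q \in unzip1 s2) = (q \in B)) ->
  forall q, (q \in unzip1 (comb2 f s1 s2)) = (q \in combine_sets f [:: A; B]).
Proof.
move=> h1 h2 q; rewrite dedup_keys; apply/mapP/imset2P.
  move=> [_ /allpairsP[[e1 e2] [/= es1 es2 ->]] ->]; exists e1.1 e2.1 => //.
    by rewrite -h1 map_f.
  by rewrite -h2 map_f.
move=> [q1 q2]; rewrite -h1 -h2 => /mapP[e1 es1 ->] /mapP[e2 es2 ->] ->.
exists (delta f [:: e1.1; e2.1], inr f :: (e1.2 ++ e2.2)) => //.
by apply/allpairsP; exists (e1, e2).
Qed.

(** A prefix word read from its end is evaluated like a postfix word: it leaves one new list on an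
    untouched stack. The last child is met first, which puts the first child on top, as [combine]
    expects. *)
Lemma eval_toks T u st : sound_table T ->
  well_ranked (@sent_rank _ (@drank tau k k' ar) 'I_N) u ->
  exists s, [/\ foldl (eval_step T) st (rev (tree_toks u)) = s :: st,
    sound_list u s & forall q, (q \in unzip1 s) = (q \in states (keys T) u)].
Proof.
move=> sT; elim/tree_induction: u st => -[f|B] us H st.
  case/andP=> /eqP /=; case Ef: (drank f) => [|[|n]].
  - move/size0nil=> -> _; exists [:: (delta f [::], [:: inr f])] => /=.
    rewrite /eval_step /= /combine Ef; split=> // [e|q]; last by rewrite !inE.
    rewrite inE => /eqP ->; exists (Node f [::]).
    by split; [do !constructor | rewrite stateE |].
  - case: us H => [|u [|]] // [H _] _ /= /andP[/H{}H _].
    have [s [Es ss ks]] := H st; exists (comb1 f s); split.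
    + by rewrite /= cats0 rev_cons foldl_rcons Es /eval_step /= /combine Ef.
    + exact: comb1_sound.
    + exact: comb1_keys.
  (* No symbol has rank above 2, so the default branch of [combine] is the binary one. *)
  - have n0 : n = 0 by move: Ef; case: (f) => /= *; lia.
    subst n; case: us H => [|u1 [|u2 []]] //.
    move=> [H1 [H2 _]] _ /= /and3P[/H1{}H1 /H2{}H2 _].
    have [s2 [Es2 ss2 ks2]] := H2 st; have [s1 [Es1 ss1 ks1]] := H1 (s2 :: st).
    exists (comb2 f s1 s2); split.
    + by rewrite /= cats0 rev_cons foldl_rcons rev_cat foldl_cat Es2 Es1 /eval_step /= /combine Ef.
    + exact: comb2_sound.
    + exact: comb2_keys.
case/andP=> /eqP /size0nil -> _; exists (lookup T B); split=> // [|q].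
  exact: lookup_sound.
by rewrite lookup_keys /= [in RHS]inE.
Qed.

Definition prod_toks (p : 'I_N * tree (sym + 'I_N)) : nat * seq tok :=
  (val p.1, rev (tree_toks p.2)).

Lemma has_In (T : Type) (a : pred T) (s : seq T) :
  has a s -> exists2 x, List.In x s & a x.
Proof.
elim: s => //= y s IH /orP[ay|/IH[x xs ax]]; first by exists y => //; left.
by exists x => //; right.
Qed.

Lemma In_has (T : Type) (a : pred T) (x : T) (s : seq T) :
  List.In x s -> a x -> has a s.
Proof. by elim: s => //= y s IH [->|/IH h] ax; rewrite ?ax // h ?orbT. Qed.

Lemma all_In (T : Type) (a : pred T) (x : T) s : all a s -> List.In x s -> a x.
Proof. by elim: s => //= y s IH /andP[ay /IH as_] [<-|/as_]. Qed.

Lemma saturate_step_sound T p : sound_table T -> List.In p (productions G) ->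
  sound_table (saturate_step T (prod_toks p)).
Proof.
move=> sT Gp e; rewrite mem_cat => /orP[|/sT //].
have wp := all_In (productions_ranked G) Gp.
have [s [Es ss _]] := eval_toks [::] sT wp.
rewrite /= Es /= => /mapP[e' /ss[t [g E1 E2]] ->] /=.
exists p.1, t; split=> //; apply: GenRule g.
by case: p Gp {wp Es ss}.
Qed.

Lemma saturate_step_keys T p : sound_table T -> List.In p (productions G) ->
  keys T \subset keys (saturate_step T (prod_toks p)) /\
  forall q, q \in states (keys T) p.2 -> (p.1, q) \in keys (saturate_step T (prod_toks p)).
Proof.
move=> sT Gp; split.
  apply/subsetP=> x; rewrite !inE /saturate_step /unzip1 map_cat mem_cat => ->.
  by rewrite orbT.
move=> q; have wp := all_In (productions_ranked G) Gp.
have [s [Es _ ks]] := eval_toks [::] sT wp.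
rewrite -ks => /mapP[e es ->]; rewrite inE /saturate_step Es /= /unzip1 map_cat mem_cat.
apply/orP; left; rewrite -map_comp; apply/mapP; exists e => //.
Qed.

(** Later productions of a pass already see the entries added earlier. The keys therefore only
    contain, and need not equal, what one simultaneous step yields; the surplus is harmless since
    soundness is an invariant. *)
Lemma saturate_pass (ps : seq ('I_N * tree (sym + 'I_N))) T :
  (forall p, List.In p ps -> List.In p (productions G)) -> sound_table T ->
  let T' := foldl saturate_step T (map prod_toks ps) in
  [/\ sound_table T', keys T \subset keys T' &
   forall p, List.In p ps -> forall q, q \in states (keys T) p.2 -> (p.1, q) \in keys T'].
Proof.
elim: ps T => [|p ps IH] T psG sT /=; first by split.
have pG : List.In p (productions G) by apply: psG; left.
have sT1 := saturate_step_sound sT pG.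
have [k1 k2] := saturate_step_keys sT pG.
have [|sT' k3 k4] := IH _ _ sT1; first by move=> p' h; apply: psG; right.
split=> //; first exact: subset_trans k1 k3.
move=> p' [<- q /k2|h q hq]; first exact: (subsetP k3).
by apply: (k4 _ h); apply: (subsetP (states_mono _ k1)).
Qed.

Definition saturate_steps (m : nat) (ps : seq (nat * seq tok)) :=
  flatten (nseq m ps).

Lemma saturate_iter m :
  let T := foldl saturate_step [::] (saturate_steps m (map prod_toks (productions G))) in
  sound_table T /\ iter m produced set0 \subset keys T.
Proof.
suff H T0 (X : {set 'I_N * Q}) : sound_table T0 -> X \subset keys T0 ->
    let T := foldl saturate_step T0 (saturate_steps m (map prod_toks (productions G))) in
    sound_table T /\ iter m produced X \subset keys T.
  by apply: H; [move=> ? | apply: sub0set].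
elim: m T0 X => [|m IH] T0 X sT XT //=.
rewrite foldl_cat.
have [|sT1 k1 k2] := @saturate_pass (productions G) T0 _ sT; first by [].
rewrite -iterS iterSr; apply: IH => //.
apply/subsetP=> -[B q]; rewrite inE => /has_In[p pG /andP[/eqP /= <- qs]].
by apply: (k2 _ pG); apply: (subsetP (states_mono _ XT)).
Qed.

Lemma gen_states X u t : produced X = X -> gen u t ->
  well_ranked (@sent_rank _ (@drank tau k k' ar) 'I_N) u -> state t \in states X u.
Proof.
move=> fX g.
pose P us ts := all (well_ranked (@sent_rank _ (@drank tau k k' ar) 'I_N)) us ->
  size us = size ts /\ all2 (fun q (A : {set Q}) => q \in A) (map state ts) (map (states X) us).
apply: (@gen_mut _ _ G (fun u t => _ -> _) P) u t g => [B u t BG _ IH _|f us ts _ IH /=|_|].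
- rewrite /= inE -fX inE; apply: (In_has BG); rewrite /= eqxx /=; apply: IH.
  exact: (all_In (productions_ranked G) BG).
- case/andP=> /eqP sus /IH[]; rewrite stateE.
  have : size us <= 2 by rewrite sus; case: (f).
  case: us ts {IH sus} => [|u1 [|u2 [|u3 us]]] [|t1 [|t2 [|t3 ts]]] //= _ _.
  + by rewrite inE.
  + by rewrite andbT => h; apply: imset_f.
  + by case/and3P=> h1 h2 _; apply: imset2_f.
- by [].
- by move=> {}u us {}t ts _ IH1 _ IH2; rewrite /P /= => /andP[/IH1 -> /IH2[-> ->]].
Qed.

Lemma saturate_complete m B t : #|[set: 'I_N * Q]| <= m ->
  gen (Node (inr B) [::]) t ->
  (B, state t) \in
  keys (foldl saturate_step [::] (saturate_steps m (map prod_toks (productions G)))).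
Proof.
move=> hm g; apply: (subsetP (saturate_iter m).2).
have fX : produced (fixset produced) = fixset produced by apply: fixsetK produced_mono.
have := gen_states fX g isT; rewrite /= inE.
(* [fixset] iterates as often as there are pairs; by monotonicity, starting from the result of the
   surplus passes instead of [set0] can only enlarge the outcome. *)
apply: subsetP; rewrite cardsT in hm; rewrite /fixset -(subnKC hm) iterD.
move: (iter (m - _) _ _) => Z; elim: {hm}#|{: 'I_N * Q}| => [|n IH]; first exact: sub0set.
by rewrite !iterS; apply: produced_mono.
Qed.

End Correctness.
End Saturation.

(** * Evaluation of rule sets *)

Section Evaluation.
Variables (tau : signature) (k k' : nat) (ar : 'I_k' -> nat).
Notation sym := (dsym tau k ar).
Definition head_atom : finType := atom (int_sig ar) 'I_k.
Definition rule_key : finType := (head_atom * {set sym})%type.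

(* A fact is the list of a number for its predicate and of its arguments; the
   numbers below #|tau| are those of the extensional predicates. *)
Definition ext_key (R : tau) : nat := enum_rank R.
Definition int_key (i : 'I_k') : nat := #|tau| + i.

Definition ext_fact (a : atom tau 'I_k) (v : seq nat) : seq nat :=
  ext_key (tag a) :: [seq nth 0 v (x : 'I_k) | x <- tagged a].
Definition int_fact (a : atom (int_sig ar) 'I_k) (v : seq nat) : seq nat :=
  int_key (tag a) :: [seq nth 0 v (x : 'I_k) | x <- tagged a].

Definition literal_holds (db : seq (seq nat)) (v : seq nat) (s : sym) : bool :=
  match s with
  | DPos a => ext_fact a v \in db
  | DNeg a => ext_fact a v \notin db
  | DInt a => int_fact a v \in db
  | _ => true
  end.

Definition rule_code := (atom (int_sig ar) 'I_k * seq sym)%type.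

(** Facts are added in place and without a membership test: later rules see them at once, and
    repetitions cost only space. *)
Definition rule_step (v : seq nat) (db : seq (seq nat)) (r : rule_code) :=
  if all (literal_holds db v) r.2 then int_fact r.1 v :: db else db.

Definition valuation_step (rs : seq rule_code) (db : seq (seq nat)) (v : seq nat) :=
  foldl (rule_step v) db rs.

Fixpoint valuations (n j : nat) : seq (seq nat) :=
  if j is j.+1 then
    flatten [seq [seq x :: v | v <- valuations n j] | x <- iota 0 n]
  else [:: [::]].

Lemma mem_valuations n j v :
  (v \in valuations n j) = (size v == j) && all (fun x => x < n) v.
Proof.
elim: j v => [|j IH] [|x v] //=.
  by apply/negP=> /flatten_mapP[y _ /mapP[]].
rewrite eqSS andbCA -IH; apply/flatten_mapP/andP.
  move=> [y]; rewrite mem_iota => /andP[_ yn] /mapP[w wv [-> ->]].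
  by rewrite yn.
move=> [xn vv]; exists x; first by rewrite mem_iota.
by apply/mapP; exists v.
Qed.

Lemma size_valuations n j : size (valuations n j) = n ^ j.
Proof.
by elim: j => //= j IH; rewrite (size_allpairs (fun x v => x :: v)) size_iota IH expnS.
Qed.

(* There are as many passes over the valuations as there are intensional facts. *)
Definition passes (n : nat) := flatten [seq valuations n (ar i) | i <- enum 'I_k'].

Definition repeated (X Y : Type) (s : seq X) (t : seq Y) : seq Y :=
  flatten [seq t | _ <- s].

Definition fixpoint_facts (rs : seq rule_code) (n : nat) (db : seq (seq nat)) :=
  foldl (valuation_step rs) db (repeated (passes n) (valuations n k)).

Definition sym_of_literal (l : literal tau k ar) : sym :=
  match l with LPos a => DPos ar a | LNeg a => DNeg ar a | LInt a => DInt tau a end.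

Definition body_set (b : seq (literal tau k ar)) : {set sym} :=
  [set s in map sym_of_literal b].

Definition program_set (Pi : program tau k ar) : {set rule_key} :=
  [set r in map (fun r => (Defs.head r, body_set (body r)) : rule_key) Pi].

Definition code_of_rule (r : rule_key) : rule_code := (r.1, enum r.2).

Definition rule_codes (p : {set rule_key}) : seq rule_code :=
  [seq code_of_rule r | r <- enum p].

Section Structure.
Variable A : structure tau.
Notation n := (dsize A).
Notation fact := (fact ar A).

Definition ext_code (a : atom tau 'I_n) : seq nat :=
  ext_key (tag a) :: [seq val x | x <- tagged a].
Definition int_code (a : fact) : seq nat :=
  int_key (tag a) :: [seq val x | x <- tagged a].

Lemma map_tuple_val_inj m : injective (fun t : m.-tuple 'I_n => [seq val x | x <- t]).
Proof. by move=> s t /(inj_map val_inj) /val_inj. Qed.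

Lemma int_code_inj : injective int_code.
Proof.
move=> [i s] [j t] [/addnI /val_inj ij]; subst j.
by move/map_tuple_val_inj => ->.
Qed.

Lemma ext_int_code a b : ext_code a != int_code b.
Proof.
apply/eqP=> -[h _]; have := ltn_ord (enum_rank (tag a)).
by rewrite -/(ext_key _) h ltnNge leq_addr.
Qed.

Definition represents_facts (db : seq (seq nat)) (U : {set fact}) :=
  (forall a : atom tau 'I_n, (ext_code a \in db) = (tagged a \in Defs.rel A (tag a))) /\
  (forall a : fact, (int_code a \in db) = (a \in U)).

Definition val_list (v : {ffun 'I_k -> 'I_n}) : seq nat := [seq val (v x) | x <- enum 'I_k].

Lemma nth_val_list v (x : 'I_k) : nth 0 (val_list v) x = v x.
Proof. by rewrite (nth_map x) ?size_enum_ord // nth_ord_enum. Qed.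

Lemma int_fact_val_list a v : int_fact a (val_list v) = int_code (subst v a).
Proof.
rewrite /int_fact /int_code /=; congr (_ :: _).
by rewrite -map_comp; apply: eq_map => x /=; rewrite nth_val_list.
Qed.

Lemma ext_fact_val_list a v : ext_fact a (val_list v) = ext_code (subst v a).
Proof.
rewrite /ext_fact /ext_code /=; congr (_ :: _).
by rewrite -map_comp; apply: eq_map => x /=; rewrite nth_val_list.
Qed.

Lemma valuations_val_list w : w \in valuations n k -> exists v, w = val_list v.
Proof.
rewrite mem_valuations => /andP[/eqP sw /allP hw].
have lt (x : 'I_k) : nth 0 w x < n by apply: hw; rewrite mem_nth ?sw.
exists [ffun x => Ordinal (lt x)].
apply: (@eq_from_nth _ 0) => [|i]; first by rewrite sw size_map size_enum_ord.
by rewrite sw => ik; rewrite -[i]/(val (Ordinal ik)) nth_val_list ffunE.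
Qed.

Lemma val_list_valuations v : val_list v \in valuations n k.
Proof.
rewrite mem_valuations size_map size_enum_ord eqxx /=.
by apply/allP=> _ /mapP[x _ ->] /=.
Qed.

Definition sym_holds (U : {set fact}) v (s : sym) : bool :=
  match s with
  | DPos a => holds U v (LPos ar a)
  | DNeg a => holds U v (LNeg ar a)
  | DInt a => holds U v (LInt tau a)
  | _ => true
  end.

Lemma literal_holdsE db U v s : represents_facts db U ->
  literal_holds db (val_list v) s = sym_holds U v s.
Proof.
by case=> h1 h2; case: s => //= a; rewrite ?int_fact_val_list ?ext_fact_val_list ?h1 //.
Qed.

Lemma sym_holds_mono (U U' : {set fact}) v s :
  U \subset U' -> sym_holds U v s -> sym_holds U' v s.
Proof. by move=> /subsetP UU; case: s => //= a; apply: UU. Qed.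

Definition set_fires (U : {set fact}) (a : fact) (r : rule_key) : bool :=
  [exists v : {ffun 'I_k -> 'I_n},
     ((subst v r.1 : fact) == a) &&
       [forall s in r.2, sym_holds U v s]].

Lemma firesE U a (r : rule tau k ar) :
  fires U a r = set_fires U a (Defs.head r, body_set (body r)).
Proof.
apply: eq_existsb => v; congr (_ && _).
have -> : all (holds U v) (body r) = all (sym_holds U v) (map sym_of_literal (body r)).
  by rewrite all_map; apply: eq_all => -[].
by apply/allP/forall_inP => h s; have := h s; rewrite inE.
Qed.

Definition set_consequences (p : {set rule_key}) (U : {set fact}) : {set fact} :=
  [set a | [exists r in p, set_fires U a r]].

Lemma consequencesE Pi U : consequences Pi U = set_consequences (program_set Pi) U.
Proof.
apply/setP=> a; rewrite !inE.
have -> : has (fires U a) Pi =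
    has (set_fires U a) (map (fun r => (Defs.head r, body_set (body r)) : rule_key) Pi).
  by rewrite has_map; apply: eq_has => r; exact: firesE.
apply/hasP/exists_inP => -[r h1 h2]; exists r => //; move: h1; by rewrite inE.
Qed.

Section LeastFixpoint.
Variable Pi : program tau k ar.
Notation p := (program_set Pi).
Notation F := (consequences (A := A) Pi).
Notation X := (lfp_facts A Pi).

(** In-place updates remain below [X], because [X] is closed under consequences. Negated literals
    keep their value, as codes of intensional facts never coincide with those of extensional
    ones. *)
Lemma rule_step_represents db U v (r : rule_key) :
  represents_facts db U -> U \subset X -> r \in p ->
  exists U', [/\ represents_facts (rule_step (val_list v) db (code_of_rule r)) U',
    U \subset U', U' \subset X &
    [forall s in r.2, sym_holds U v s] -> (subst v r.1 : fact) \in U'].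
Proof.
move=> rU UX rp; rewrite /rule_step.
have -> : all (literal_holds db (val_list v)) (enum r.2) = [forall s in r.2, sym_holds U v s].
  apply/allP/forall_inP => h s; have := h s; rewrite mem_enum (literal_holdsE _ _ rU) //.
case: ifP => h; last by exists U.
exists ((subst v r.1 : fact) |: U); split.
- case: rU => h1 h2; split=> a; rewrite inE int_fact_val_list.
    by rewrite (negbTE (ext_int_code _ _)) h1.
  by rewrite h2 !inE (inj_eq int_code_inj).
- exact: subsetUr.
- rewrite subUset UX andbT sub1set -lfp_facts_fix.
  apply: (subsetP (consequences_mono Pi UX)).
  rewrite consequencesE inE; apply/exists_inP; exists r => //.
  by apply/existsP; exists v; rewrite eqxx.
- by rewrite setU11.
Qed.

Lemma rules_represent db U v (rs : seq rule_key) :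
  represents_facts db U -> U \subset X -> {subset rs <= p} ->
  exists U', [/\ represents_facts
      (valuation_step (map code_of_rule rs) db (val_list v)) U',
    U \subset U', U' \subset X &
    forall r, r \in rs -> [forall s in r.2, sym_holds U v s] ->
      (subst v r.1 : fact) \in U'].
Proof.
elim: rs db U => [|r rs IH] db U rU UX rsp; first by exists U.
have rp : r \in p by apply: rsp; rewrite mem_head.
have [U1 [r1 UU1 U1X f1]] := rule_step_represents v rU UX rp.
have [|U2 [r2 U12 U2X f2]] := IH _ _ r1 U1X.
  by move=> r' h; apply: rsp; rewrite inE h orbT.
exists U2; split=> //; first exact: subset_trans UU1 U12.
move=> r'; rewrite inE => /orP[/eqP -> /f1|h /forall_inP hs]; first exact: (subsetP U12).
by apply: f2 => //; apply/forall_inP => s /hs; apply: sym_holds_mono.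
Qed.

Lemma valuations_represent db U (vs : seq (seq nat)) :
  represents_facts db U -> U \subset X -> {subset vs <= valuations n k} ->
  exists U', [/\ represents_facts (foldl (valuation_step (rule_codes p)) db vs) U',
    U \subset U', U' \subset X &
    forall v r, val_list v \in vs -> r \in p -> [forall s in r.2, sym_holds U v s] ->
      (subst v r.1 : fact) \in U'].
Proof.
elim: vs db U => [|w vs IH] db U rU UX vsn; first by exists U.
have [v ew] := valuations_val_list (vsn w (mem_head _ _)); subst w.
have [|U1 [r1 UU1 U1X f1]] := rules_represent v rU UX (rs := enum p).
  by move=> r; rewrite mem_enum.
have [|U2 [r2 U12 U2X f2]] := IH _ _ r1 U1X.
  by move=> r' h; apply: vsn; rewrite inE h orbT.
exists U2; split=> //; first exact: subset_trans UU1 U12.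
move=> v' r; rewrite inE => /orP[/eqP e|h] rp hs.
  have ev : v' = v by apply/ffunP=> x; apply: val_inj; rewrite /= -!nth_val_list e.
  by subst v'; apply: (subsetP U12); apply: f1; rewrite ?mem_enum.
apply: (f2 _ _ h rp); apply/forall_inP => s sr.
by apply: sym_holds_mono UU1 _; move/forall_inP: hs; apply.
Qed.

(** A pass with in-place updates contains the simultaneous consequences of its starting set, so the
    result is squeezed between an iterate of [F] and [X]. *)
Lemma passes_represent (T : Type) (ps : seq T) db U :
  represents_facts db U -> U \subset X ->
  exists U', [/\ represents_facts
      (foldl (valuation_step (rule_codes p)) db (repeated ps (valuations n k))) U',
    U' \subset X & iter (size ps) F U \subset U'].
Proof.
elim: ps db U => [|x ps IH] db U rU UX; first by exists U.
rewrite /repeated /= foldl_cat.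
have [|U1 [r1 UU1 U1X f1]] := valuations_represent rU UX (vs := valuations n k); first by [].
have [U2 [r2 U2X f2]] := IH _ _ r1 U1X.
exists U2; split=> //; apply: subset_trans f2.
rewrite -iterS iterSr.
have : F U \subset U1.
  apply/subsetP=> a; rewrite consequencesE inE => /exists_inP[r rp].
  case/existsP=> v /andP[/eqP <- hs]; apply: f1 hs => //.
  exact: val_list_valuations.
by elim: (size ps) => //= m IHm /IHm; apply: consequences_mono.
Qed.

Lemma size_passes : size (passes n) = #|{: fact}|.
Proof.
rewrite /passes size_flatten /shape -map_comp card_tagged.
by congr sumn; rewrite enumT; apply: eq_map => i /=; rewrite size_valuations card_tuple card_ord.
Qed.

Lemma fixpoint_factsP db : represents_facts db set0 ->
  represents_facts (fixpoint_facts (rule_codes p) n db) X.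
Proof.
move=> r0; have [U [rU UX h]] := passes_represent (passes n) r0 (sub0set _).
suff <- : U = X by [].
apply/eqP; rewrite eqEsubset UX /=.
by apply: subset_trans h; rewrite size_passes.
Qed.

End LeastFixpoint.

End Structure.
End Evaluation.

(** * The synthesis algorithm *)

Section Algorithm.
Variables (tau : signature) (k k' : nat) (ar : 'I_k' -> nat).
Notation sym := (dsym tau k ar).
Notation letter := (letter tau k ar).
Notation tok := (tok tau k ar).
Notation ntok := (@ntok tau k k' ar).
Notation rule_key := (rule_key tau k ar).

(* A tree is abstracted to the rule set and the body that it represents, up to
   order and repetition. *)
Definition abstraction : finType := (option {set rule_key} * option {set sym})%type.

(** Both readings of a tree, as a rule set and as a body, are tracked in parallel; [None] marks a
    tree that is ill-sorted for that reading. *)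
Definition abs_delta (f : sym) (qs : seq abstraction) : abstraction :=
  (match f, qs with
   | DEmpty, [::] => Some set0
   | DRule h, [:: q] =>
       if q.2 is Some b then Some [set ((h, b) : rule_key)] else None
   | DUnion, [:: q1; q2] =>
       if q1.1 is Some p1 then if q2.1 is Some p2 then Some (p1 :|: p2) else None
       else None
   | _, _ => None
   end,
   match f, qs with
   | DTrue, [::] => Some set0
   | DPos _, [::] | DNeg _, [::] | DInt _, [::] => Some [set f]
   | DAnd, [:: q1; q2] =>
       if q1.2 is Some b1 then if q2.2 is Some b2 then Some (b1 :|: b2) else None
       else None
   | _, _ => None
   end).

Definition abs_tree (t : tree sym) : abstraction :=
  (omap (@program_set _ _ _ _) (program_of_tree t), omap (@body_set _ _ _ _) (body_of_tree t)).

Lemma abs_treeE f ts : abs_tree (Node f ts) = abs_delta f (map abs_tree ts).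
Proof.
have b0 : body_set (ar := ar) [::] = set0 :> {set sym} by apply/setP=> s; rewrite !inE.
have b1 l : body_set [:: l] = [set sym_of_literal l] :> {set sym}.
  by apply/setP=> s; rewrite !inE.
have bU l1 l2 : body_set (l1 ++ l2) = body_set l1 :|: body_set l2 :> {set sym}.
  by apply/setP=> s; rewrite !inE map_cat mem_cat.
have p0 : program_set (ar := ar) [::] = set0 :> {set rule_key} by apply/setP=> s; rewrite !inE.
have p1 r : program_set [:: r] = [set ((Defs.head r, body_set (body r)) : rule_key)].
  by apply/setP=> s; rewrite !inE.
have pU l1 l2 : program_set (l1 ++ l2) = program_set l1 :|: program_set l2 :> {set rule_key}.
  by apply/setP=> s; rewrite !inE map_cat mem_cat.
rewrite /abs_tree /abs_delta.
case: f => [||h|||a|a|a]; case: ts => [|t1 [|t2 [|t3 ts]]] //=;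
  rewrite ?b0 ?b1 ?p0 ?p1 //=.
- by case: (program_of_tree t1) (program_of_tree t2) => [q1|] [q2|] //=; rewrite pU.
- by case: (body_of_tree t1) => [l|] //=; rewrite p1.
- by case: (body_of_tree t1) (body_of_tree t2) => [q1|] [q2|] //=; rewrite bU.
Qed.

(** The machine delivers the word reversed. The terminator of a number thus comes first and opens a
    token at 0, which the digits then increment; consing puts the tokens back into their original
    order. *)
Definition tok_step (acc : seq tok) (l : letter) : seq tok :=
  match l with
  | inl false => ntok 0 :: acc
  | inl true => if acc is t :: acc then (t.1, t.2.+1) :: acc else [::]
  | inr f => (Some f, 0) :: acc
  end.

Definition tokenize (rw : seq letter) : seq tok := foldl tok_step [::] rw.

(** [acc] stands for the tokens of all that follows [w], which makes the property compose along
    concatenation. *)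
Definition lexes (w : seq letter) (ts : seq tok) : Prop :=
  forall acc, foldr (fun l acc => tok_step acc l) acc w = ts ++ acc.

Lemma lexes_cat w1 w2 ts1 ts2 :
  lexes w1 ts1 -> lexes w2 ts2 -> lexes (w1 ++ w2) (ts1 ++ ts2).
Proof. by move=> h1 h2 acc; rewrite foldr_cat h2 h1 catA. Qed.

Lemma lexes_flatten (X : Type) (e : X -> seq letter) (ts : X -> seq tok) s :
  (forall x, lexes (e x) (ts x)) -> lexes (flatten (map e s)) (flatten (map ts s)).
Proof. by move=> h; elim: s => //= x s IH; apply: lexes_cat. Qed.

Lemma lexes_nat n : lexes (enc_nat tau k ar n) [:: ntok n].
Proof.
move=> acc; rewrite /enc_nat foldr_rcons /=.
suff H m : foldr (fun l acc => tok_step acc l) (ntok m :: acc) (nseq n (inl true)) =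
           ntok (n + m) :: acc by rewrite H addn0.
by elim: n => //= n ->.
Qed.

Lemma tokenize_lexes w ts : lexes w ts -> tokenize (rev w) = ts.
Proof. by move=> h; rewrite /tokenize foldl_rev h cats0. Qed.

Definition tuple_toks n m (t : m.-tuple 'I_n) : seq tok := [seq ntok (i : 'I_n) | i <- t].

Definition relation_toks m n (S : {set m.-tuple 'I_n}) : seq tok :=
  ntok (size (enum S)) :: flatten (map (@tuple_toks n m) (enum S)).

Definition structure_toks (A : structure tau) : seq tok :=
  ntok (dsize A) :: flatten [seq relation_toks (Defs.rel A R) | R <- enum tau].

Definition production_toks (G : grammar (@drank tau k k' ar))
  (p : 'I_(nonterms G) * tree (sym + 'I_(nonterms G))) : seq tok :=
  ntok p.1 :: tree_toks p.2.

Definition grammar_toks (G : grammar (@drank tau k k' ar)) : seq tok :=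
  [:: ntok (nonterms G), ntok (axiom G), ntok (size (productions G)) &
    flatten [seq production_toks p | p <- productions G]].

Definition instance_toks (I : instance tau k ar) : seq tok :=
  structure_toks (struct I) ++ ntok (target I) :: relation_toks (pos I) ++
  relation_toks (neg I) ++ grammar_toks (gram I).

Lemma lexes_relation m n (S : {set m.-tuple 'I_n}) :
  lexes (enc_relation tau k ar S) (relation_toks S).
Proof.
apply: (lexes_cat (ts1 := [:: _])); first exact: lexes_nat.
apply: lexes_flatten => t; rewrite /enc_tuple /tuple_toks.
have -> : [seq ntok (i : 'I_n) | i <- t] = flatten [seq [:: ntok (i : 'I_n)] | i <- t].
  by rewrite flatten_map1.
by apply: lexes_flatten => i; apply: lexes_nat.
Qed.

Lemma lexes_tree (G : grammar (@drank tau k k' ar)) (u : tree (sym + 'I_(nonterms G))) :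
  lexes (enc_sent_tree u) (tree_toks u).
Proof.
elim/tree_induction: u => x us H /=.
apply: (lexes_cat (ts1 := [:: _])); first by case: x => [f|B] //; exact: lexes_nat.
by elim: us H => //= u us IH [h /IH]; apply: lexes_cat.
Qed.

Lemma lexes_instance I : lexes (enc_instance I) (instance_toks I).
Proof.
apply: lexes_cat.
  apply: (lexes_cat (ts1 := [:: _])); first exact: lexes_nat.
  by apply: lexes_flatten => R; apply: lexes_relation.
apply: (lexes_cat (ts1 := [:: _])); first exact: lexes_nat.
apply: lexes_cat; first exact: lexes_relation.
apply: lexes_cat; first exact: lexes_relation.
apply: (lexes_cat (ts1 := [:: _])); first exact: lexes_nat.
apply: (lexes_cat (ts1 := [:: _])); first exact: lexes_nat.
apply: (lexes_cat (ts1 := [:: _])); first exact: lexes_nat.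
apply: lexes_flatten => p; apply: (lexes_cat (ts1 := [:: _])); first exact: lexes_nat.
exact: lexes_tree.
Qed.

Definition take_numbers (a : nat) (s : seq tok) : seq nat * seq tok :=
  foldl (fun st _ => if st.2 is t :: s' then (t.2 :: st.1, s') else st)
    ([::], s) (nseq a tt).

Lemma take_numbersP ns s : take_numbers (size ns) (map ntok ns ++ s) = (rev ns, s).
Proof.
rewrite /take_numbers -[rev ns]/(catrev ns [::]).
by elim: ns [::] => //= n ns IH acc; rewrite IH.
Qed.

Definition parse_relation (key a : nat) (s : seq tok) : seq (seq nat) * seq tok :=
  foldl (fun st _ => ((key :: rev (take_numbers a st.2).1) :: st.1, (take_numbers a st.2).2))
    ([::], behead s) (nseq (head (ntok 0) s).2 tt).

Definition relation_facts (key : nat) m n (S : {set m.-tuple 'I_n}) : seq (seq nat) :=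
  [seq key :: map val t | t : m.-tuple 'I_n <- enum S].

Lemma parse_relationP key m n (S : {set m.-tuple 'I_n}) s :
  parse_relation key m (relation_toks S ++ s) = (rev (relation_facts key S), s).
Proof.
rewrite /parse_relation /relation_facts /= -[rev _]/(catrev _ [::]).
elim: (enum S) [::] => //= t ts IH acc.
have -> : take_numbers m ((tuple_toks t ++ flatten (map (@tuple_toks n m) ts)) ++ s) =
    (rev (map val t), flatten (map (@tuple_toks n m) ts) ++ s).
  have -> : tuple_toks t = map ntok (map val t) by rewrite -map_comp.
  have := take_numbersP (map val t) (flatten (map (@tuple_toks n m) ts) ++ s).
  by rewrite size_map size_tuple -catA.
by rewrite /= revK IH.
Qed.

Definition parse_relations (s : seq tok) : seq (seq nat) * seq tok :=
  foldl (fun st R => ((parse_relation (ext_key R) (arity R) st.2).1 ++ st.1,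
                      (parse_relation (ext_key R) (arity R) st.2).2))
    ([::], s) (enum tau).

Lemma parse_relationsP (A : structure tau) s :
  let st := parse_relations
    (flatten [seq relation_toks (Defs.rel A R) | R <- enum tau] ++ s) in
  st.2 = s /\ forall f, (f \in st.1) =
    has (fun R => f \in relation_facts (ext_key R) (Defs.rel A R)) (enum tau).
Proof.
rewrite /parse_relations.
suff H acc rs : let st := foldl (fun st R =>
        ((parse_relation (ext_key R) (arity R) st.2).1 ++ st.1,
         (parse_relation (ext_key R) (arity R) st.2).2))
      (acc, flatten [seq relation_toks (Defs.rel A R) | R <- rs] ++ s) rs in
    st.2 = s /\ forall f, (f \in st.1) =
      has (fun R => f \in relation_facts (ext_key R) (Defs.rel A R)) rs || (f \in acc).
  by have [-> h] := H [::] (enum tau); split=> // f; rewrite h orbF.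
elim: rs acc => [|R rs IH] acc //=; rewrite -catA parse_relationP /=.
have [-> h] := IH (rev (relation_facts (ext_key R) (Defs.rel A R)) ++ acc).
by split=> // f; rewrite h mem_cat mem_rev orbCA orbA.
Qed.

(** Intensional keys start at [#|tau|], so the parsed database contains no intensional fact and
    represents the start [set0] of the iteration. *)
Lemma parsed_represents (A : structure tau) db :
  (forall f, (f \in db) =
    has (fun R => f \in relation_facts (ext_key R) (Defs.rel A R)) (enum tau)) ->
  represents_facts (A := A) db (set0 : {set fact ar A}).
Proof.
move=> h; split=> a; rewrite h.
  apply/hasP/idP => [[R _ /mapP[t]]|ha].
    rewrite mem_enum => ht [/ord_inj/enum_rank_inj ER Et]; case: a ER Et => S s /= ER.
    by subst S => /map_tuple_val_inj ->.
  by exists (tag a); rewrite ?mem_enum //; apply: map_f; rewrite mem_enum.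
rewrite inE; apply/hasP => -[R _ /mapP[t _ e]].
by have := ext_int_code (Tagged (fun R : tau => (arity R).-tuple 'I_(dsize A)) t) a; rewrite e eqxx.
Qed.

Definition tok_rank (t : tok) : nat := if t.1 is Some f then drank f else 0.

(* The first component counts the subtrees that are still to be read; when it is 0,
   the next token is the left-hand side of a production. *)
Definition production_step (st : nat * seq (nat * seq tok)) (t : tok) :=
  if st.1 is p.+1 then
    (p + tok_rank t, if st.2 is r :: rs then (r.1, t :: r.2) :: rs else [::])
  else (1, (t.2, [::]) :: st.2).

Definition parse_productions (s : seq tok) : seq (nat * seq tok) :=
  rev (foldl production_step (0, [::]) s).2.

(** A complete tree settles exactly one pending subtree. Its tokens are collected in reverse, the
    order in which [eval_step] consumes them. *)
Lemma production_step_tree (G : grammar (@drank tau k k' ar)) u p B l rs :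
  well_ranked (@sent_rank _ (@drank tau k k' ar) 'I_(nonterms G)) u ->
  foldl production_step (p.+1, (B, l) :: rs) (tree_toks (G := G) u) =
    (p, (B, catrev (tree_toks u) l) :: rs).
Proof.
elim/tree_induction: u p l => x us H p l /= /andP[/eqP sus wus].
rewrite /production_step /= -/production_step.
have -> : tok_rank (match x with inl f => (Some f, 0) | inr B => ntok B end) = size us.
  by rewrite sus; case: (x).
move: (_ :: l) => l'; elim: us l' H wus {sus} => [|u us IH] l' /=.
  by rewrite addn0.
case=> [Hu Hus] /andP[wu wus]; rewrite addnS foldl_cat Hu // catrev_catl.
exact: IH.
Qed.

Lemma parse_productionsP (G : grammar (@drank tau k k' ar)) :
  parse_productions (flatten [seq production_toks p | p <- productions G]) =
  map (@prod_toks _ _ _ _ G) (productions G).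
Proof.
rewrite /parse_productions; apply: (canLR revK); rewrite -[rev _]/(catrev _ [::]).
elim: (productions G) (productions_ranked G) [::] => //= p ps IH /andP[wp wps] acc.
by rewrite foldl_cat production_step_tree // IH.
Qed.

(** * The decision procedure and its correctness *)

Definition environment :=
  ((nat * seq (seq nat)) * (seq (seq nat) * seq (seq nat)) * (nat * nat) *
   seq (nat * seq tok))%type.

Definition arity_of (i : nat) : nat := nth 0 [seq ar i | i <- enum 'I_k'] i.

Definition parse_instance (s : seq tok) : environment :=
  let n := (head (ntok 0) s).2 in
  let st := parse_relations (behead s) in
  let i := (head (ntok 0) st.2).2 in
  let pos := parse_relation (#|tau| + i) (arity_of i) (behead st.2) in
  let neg := parse_relation (#|tau| + i) (arity_of i) pos.2 in
  ((n, st.1), (pos.1, neg.1), ((nth (ntok 0) neg.2 0).2, (nth (ntok 0) neg.2 1).2),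
   parse_productions (behead (behead (behead neg.2)))).

Definition good (p : {set rule_key}) (E : environment) : bool :=
  let X := fixpoint_facts (rule_codes p) E.1.1.1.1 E.1.1.1.2 in
  all (fun f => f \in X) E.1.1.2.1 && all (fun f => f \notin X) E.1.1.2.2.

Definition table_step := @saturate_step tau k k' ar abstraction abs_delta.
Definition table := seq ((nat * abstraction) * word tau k ar).

Definition table_steps (E : environment) : seq (nat * seq tok) :=
  repeated (flatten [seq nseq E.1.2.1 tt | _ <- enum abstraction]) E.2.

Definition candidate (E : environment) (T : table) (q : abstraction) : seq (word tau k ar) :=
  if q.1 is Some p then
    if good p E then [seq e.2 | e <- [seq e <- T | e.1 == (E.1.2.2, q)]] else [::]
  else [::].

Definition answer_word (E : environment) (T : table) : word tau k ar :=
  foldl (fun acc q => if candidate E T q is w :: _ then inl true :: w else acc)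
    [:: inl false] (enum abstraction).

Definition solve (rw : seq letter) : seq letter :=
  let E := parse_instance (tokenize rw) in
  answer_word E (foldl table_step [::] (table_steps E)).

Lemma parse_instanceP (I : instance tau k ar) : exists2 db,
  represents_facts (A := struct I) db (set0 : {set fact ar (struct I)}) &
  parse_instance (instance_toks I) =
    ((dsize (struct I), db),
     (rev (relation_facts (int_key tau (target I)) (pos I)),
      rev (relation_facts (int_key tau (target I)) (neg I))),
     (nonterms (gram I), val (axiom (gram I))),
     map (@prod_toks _ _ _ _ (gram I)) (productions (gram I))).
Proof.
rewrite /parse_instance /instance_toks /=.
set s := (ntok (target I) :: _).
have [h1 h2] := @parse_relationsP (struct I) s.
exists (parse_relations (flatten [seq relation_toks (Defs.rel (struct I) R) | R <- enum tau] ++ s)).1.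
  exact: parsed_represents.
rewrite h1 /s /=.
have -> : arity_of (target I) = ar (target I).
  by rewrite /arity_of (nth_map (target I)) ?size_enum_ord // nth_ord_enum.
by rewrite !parse_relationP /= parse_productionsP.
Qed.

(** [a] will be the identity for [pos] and negation for [neg]. *)
Lemma mem_relation_facts (I : instance tau k ar)
  (S : {set (ar (target I)).-tuple 'I_(dsize (struct I))})
  (Pi : program tau k ar) X (a : pred bool) :
  represents_facts (A := struct I) X (lfp_facts (struct I) Pi) ->
  all (fun f => a (f \in X)) (relation_facts (int_key tau (target I)) S) =
  [forall t in S, a (t \in lfp (struct I) Pi (target I))].
Proof.
move=> [_ h]; rewrite /relation_facts all_map.
have e (t : (ar (target I)).-tuple 'I_(dsize (struct I))) :
    ((int_key tau (target I) :: map val t) \in X) = (t \in lfp (struct I) Pi (target I)).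
  by rewrite inE -h.
apply/allP/forall_inP => H t; first by move=> tS; have := H t; rewrite mem_enum /= e; apply.
by rewrite mem_enum /= e; apply: H.
Qed.

Lemma goodP (I : instance tau k ar) (Pi : program tau k ar) :
  good (program_set Pi) (parse_instance (instance_toks I)) =
  (pos I \subset lfp (struct I) Pi (target I)) &&
  [disjoint neg I & lfp (struct I) Pi (target I)].
Proof.
have [db rdb ->] := parse_instanceP I; rewrite /good /= !all_rev.
have rX := fixpoint_factsP Pi rdb.
rewrite (@mem_relation_facts I (pos I) _ _ id rX) (@mem_relation_facts I (neg I) _ _ negb rX).
congr (_ && _).
  by apply/forall_inP/subsetP.
rewrite disjoint_subset; apply/forall_inP/subsetP => h t tN; have := h t tN; by rewrite !inE.
Qed.

Lemma foldl_candidate (X : Type) (c : X -> seq (word tau k ar)) d s :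
  let r := foldl (fun acc x => if c x is w :: _ then inl true :: w else acc) d s in
  (exists x w, [/\ List.In x s, List.In w (c x) & r = inl true :: w]) \/
  (r = d /\ forall x, List.In x s -> c x = [::]).
Proof.
elim: s d => [|x s IH] d /=; first by right.
case E: (c x) => [|w ws]; last first.
  have [[y [v [ys vy ->]]]|[-> h]] := IH (inl true :: w).
    by left; exists y, v; split=> //; right.
  by left; exists x, w; rewrite E; split=> //; left.
have [[y [v [ys vy ->]]]|[-> h]] := IH d.
  by left; exists y, v; split=> //; right.
by right; split=> // y [<-|/h].
Qed.

Lemma In_mem (T : eqType) (x : T) (s : seq T) : List.In x s <-> x \in s.
Proof.
elim: s => //= y s IH; rewrite inE; split.
  by case=> [->|/IH ->]; rewrite ?eqxx ?orbT.
by case/orP=> [/eqP ->|/IH]; [left | right].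
Qed.

Lemma repeatedE (X Y : Type) (s : seq X) (t : seq Y) :
  repeated s t = flatten (nseq (size s) t).
Proof. by rewrite /repeated; elim: s => //= x s ->. Qed.

(** The printed witness may differ from any solution known to exist, but an equal state means an
    equal rule set and hence an equal least fixed point. *)
Theorem solve_correct (I : instance tau k ar) : exists2 ans,
  correct_answer I ans & solve (rev (enc_instance I)) = enc_answer ans.
Proof.
rewrite /solve (tokenize_lexes (lexes_instance I)).
set E := parse_instance _; set T := foldl _ _ _.
have gE Pi : good (program_set Pi) E = _ := goodP I Pi.
have [db _ EE] := parse_instanceP I; rewrite -/E in EE.
have ET : T = foldl (saturate_step abs_delta) [::]
   (saturate_steps (size (flatten [seq nseq E.1.2.1 tt | _ <- enum abstraction]))
      (map (@prod_toks _ _ _ _ (gram I)) (productions (gram I)))).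
  by rewrite /T /table_steps repeatedE /saturate_steps EE.
have [sT _] := saturate_iter abs_treeE (gram I)
   (size (flatten [seq nseq E.1.2.1 tt | _ <- enum abstraction])).
rewrite -ET in sT.
(* If some candidate exists, soundness of the table turns its word into a generated tree. Otherwise
   a solution would contradict [none] at its own state, which completeness puts into the table. *)
have [[q [w [_ + Er]]]|[Er none]] := foldl_candidate (candidate E T) [:: inl false] (enum abstraction).
  rewrite /candidate; case Eq: q.1 => [p|] //; case: ifP => // gp.
  move/In_mem/mapP => [e + ew]; rewrite mem_filter => /andP[/eqP eq /sT[B [t [eB g Es Ew]]]].
  have Bax : B = axiom (gram I) by apply: val_inj; rewrite /= -eB eq EE.
  exists (Some t); last by rewrite /answer_word Er ew Ew.
  split; first by apply/languageP; rewrite -Bax.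
  move: Es; rewrite eq /= => Eqt; move: Eq; rewrite Eqt /abs_tree /=.
  case: (program_of_tree t) => //= Pi [EPi]; exists Pi.
  by move: gp; rewrite -EPi gE => /andP[].
exists None; last by rewrite /answer_word Er.
move=> [t [/languageP g [Pi [tPi hpos hneg]]]].
have /none : List.In (abs_tree t) (enum abstraction) by apply/In_mem; rewrite mem_enum.
rewrite /candidate /= tPi /= gE hpos hneg /=.
have hm : #|[set: 'I_(nonterms (gram I)) * abstraction]| <=
    size (flatten [seq nseq E.1.2.1 tt | _ <- enum abstraction]).
  rewrite EE /= cardsT card_prod card_ord [X in _ * X]cardT mulnC.
  by elim: (enum abstraction) => //= x s IH; rewrite size_cat size_nseq mulSn leq_add2l.
have := saturate_complete abs_treeE hm g; rewrite -ET inE => /mapP[e eT /= Ee].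
have : e.2 \in [seq e.2 | e <- T & e.1 == (E.1.2.2, abs_tree t)].
  by apply: map_f; rewrite mem_filter eT andbT EE /= -Ee.
by rewrite /abs_tree tPi /= => + h; rewrite h.
Qed.

End Algorithm.

(** * Running time *)

Section Complexity.
Variables (tau : signature) (k k' : nat) (ar : 'I_k' -> nat).
Notation sym := (dsym tau k ar).
Notation L := (letter tau k ar).
Notation Q := (abstraction tau k ar).
Notation tok := (tok tau k ar).
Notation ntok := (@ntok tau k k' ar).
Notation word := (word tau k ar).

Definition atoms : finType := (bool + L + option sym + Q)%type.
Notation W := atoms.

Definition atom_bool : Atom W bool :=
  @Build_Atom W bool (fun b => inl (inl (inl b)))
    (fun w => if w is inl (inl (inl b)) then Some b else None) (fun=> erefl).
Definition atom_letter : Atom W L :=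
  @Build_Atom W L (fun b => inl (inl (inr b)))
    (fun w => if w is inl (inl (inr b)) then Some b else None) (fun=> erefl).
Definition atom_osym : Atom W (option sym) :=
  @Build_Atom W (option sym) (fun b => inl (inr b))
    (fun w => if w is inl (inr b) then Some b else None) (fun=> erefl).
Definition atom_abs : Atom W Q :=
  @Build_Atom W Q (fun b => inr b)
    (fun w => if w is inr b then Some b else None) (fun=> erefl).
Local Existing Instances atom_bool atom_letter atom_osym atom_abs.

Notation polytime := (@polytime L W _ _ _ _).
Notation csz := (@csize L W _ _).
Notation polybounded := (@polybounded L W _ _).

Lemma pt_tokenize X {cX : Coded W X} (w : X -> seq L) :
  polytime w -> polytime (fun x => tokenize (w x)).
Proof.
move=> pw; rewrite /tokenize.
apply: (pt_fold_add (step := fun _ acc l => tok_step acc l) _ _ _ (q := fun=> 10)); pt.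
- apply: (pt_atom_case (g := snd) (f := fun l p => tok_step p.1.2 l)); first by pt.
  case=> [[]|f] /=; pt.
  apply: (pt_seq_case (l := fun p : X * seq tok * L => p.1.2)
    (f1 := fun _ t acc => (t.1, t.2.+1) :: acc)); pt.
  by apply: pt_succ; pt.
- by pb.
- move=> x acc [[]|f] /=.
  + case: acc => [|[o n] acc]; rewrite /= ?csize_nil //.
    by rewrite !csize_cons !csize_pair !csize_nat /=; lia.
  + by rewrite csize_cons csize_pair !csize_nat /= csize_atom /=; lia.
  + by rewrite csize_cons csize_pair !csize_nat /= csize_atom /=; lia.
Qed.

(** Each number moves from a token to a smaller list cell; the 2 pays for the initial empty list and
    the pairing. *)
Lemma csize_take_numbers a (s : seq tok) : csz (take_numbers a s) <= csz s + 2.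
Proof.
have -> : csz s + 2 = csz (([::], s) : seq nat * seq tok).
  by rewrite csize_pair csize_nil /=; lia.
rewrite /take_numbers; move: ([::], s) => st.
elim: a st => //= a IH [l [|t r]] /=; apply: leq_trans (IH _) _ => //.
case: t => o n; rewrite !csize_pair !csize_cons csize_pair csize_atom /=; lia.
Qed.

Lemma pt_take_numbers X {cX : Coded W X} (a : X -> nat) (s : X -> seq tok) :
  polytime a -> polytime s -> polytime (fun x => take_numbers (a x) (s x)).
Proof.
move=> pa ps; rewrite /take_numbers.
pose step (_ : X) (st : seq nat * seq tok) (_ : unit) :=
  if st.2 is t :: s' then (t.2 :: st.1, s') else st.
apply: (pt_fold_add (cA := @coded_unit W) (step := step) _ _ _ (q := fun=> 0)); pt.
- apply: (pt_seq_case (l := fun p : X * (seq nat * seq tok) * unit => p.1.2.2)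
    (f1 := fun p t s' => (t.2 :: p.1.2.1, s'))); pt.
- by pb.
- move=> x [l [|[o n] r]] u; rewrite addn0 /step //= !csize_pair !csize_cons csize_pair csize_atom /=; lia.
Qed.

Lemma pt_parse_relation X {cX : Coded W X} (key a : X -> nat) (s : X -> seq tok) :
  polytime key -> polytime a -> polytime s ->
  polytime (fun x => parse_relation (key x) (a x) (s x)).
Proof.
move=> pk pa ps; rewrite /parse_relation.
pose step x (st : seq (seq nat) * seq tok) (_ : unit) :=
  ((key x :: rev (take_numbers (a x) st.2).1) :: st.1, (take_numbers (a x) st.2).2).
pose T := (X * (seq (seq nat) * seq tok) * unit)%type.
have p11 : polytime (fun p : T => p.1.1) by pt.
have pa' : polytime (fun p : T => a p.1.1) := pt_comp p11 pa.
have pk' : polytime (fun p : T => key p.1.1) := pt_comp p11 pk.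
have p1 : polytime (fun p : X * unit => p.1) by pt.
have pk1 : polytime (fun p : X * unit => key p.1) := pt_comp p1 pk.
(* The arguments of a fact are paid for by the tokens removed from the input, so a round adds only
   the key and a constant. *)
apply: (pt_fold_add (cA := @coded_unit W) (step := step) _ _ _ (q := fun p => csz (key p.1) + 10)); pt.
- by apply: pt_nseq_tt; apply: pt_snd'; apply: pt_head.
- by apply: pt_behead.
- by rewrite /step; pt; [apply: pt_rev; pt; apply: pt_take_numbers | apply: pt_take_numbers]; pt.
- by pb.
- move=> x [l r] u; rewrite /step /= !csize_pair !csize_cons csize_rev.
  have := csize_take_numbers (a x) r; case: (take_numbers (a x) r) => g1 g2.
  rewrite csize_pair /=; lia.
Qed.

Lemma pt_parse_relations X {cX : Coded W X} (s : X -> seq tok) :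
  polytime s -> polytime (fun x => @parse_relations tau k k' ar (s x)).
Proof.
move=> ps; rewrite /parse_relations.
apply: (pt_foldl_const (g := fun (R : tau) (_ : X) (st : seq (seq nat) * seq tok) =>
  ((parse_relation (ext_key R) (arity R) st.2).1 ++ st.1,
   (parse_relation (ext_key R) (arity R) st.2).2))); last by pt.
move=> R; pt.
  by apply: pt_cat; pt; apply: pt_parse_relation; pt.
by apply: pt_parse_relation; pt.
Qed.

Lemma pt_parse_productions X {cX : Coded W X} (s : X -> seq tok) :
  polytime s -> polytime (fun x => parse_productions (s x)).
Proof.
move=> ps; rewrite /parse_productions; apply: pt_rev; apply: pt_snd'.
apply: (pt_fold_add (step := fun _ st t => production_step st t) _ _ _
          (q := fun p => csz p.2 + 10)); pt.
- pose T := (X * (nat * seq (nat * seq tok)) * tok)%type.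
  apply: (pt_nat_case (n := fun p : T => p.1.2.1)
    (f0 := fun p => (1, (p.2.2, [::]) :: p.1.2.2))
    (f1 := fun p m => (m + tok_rank p.2,
       if p.1.2.2 is r :: rs then (r.1, p.2 :: r.2) :: rs else [::]))); pt.
    apply: pt_addn; pt; rewrite /tok_rank.
    by apply: (pt_atom_fun (fun o : option sym => if o is Some f then drank f else 0)); pt.
  by apply: (pt_seq_case (l := fun p : T * nat => p.1.1.2.2)
    (f1 := fun p r rs => (r.1, p.1.2 :: r.2) :: rs)); pt.
- by pb.
- move=> x [[|p] rs] [o n]; rewrite /production_step !csize_pair /=.
    by rewrite csize_cons !csize_pair !csize_nat csize_nil csize_atom /=; lia.
  have h : tok_rank (o, n) <= 2 by case: o => // -[].
  case: rs => [|[B l] rs]; rewrite ?csize_nil ?csize_cons ?csize_pair ?csize_nat.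
    by rewrite !csize_atom /=; lia.
  by rewrite csize_cons !csize_pair csize_nat !csize_atom /=; lia.
Qed.

Lemma pt_parse_instance : polytime (@parse_instance tau k k' ar).
Proof.
pose T := seq tok; pose E := (seq tok * (seq (seq nat) * seq tok))%type.
have pn : polytime (fun s : T => (head (ntok 0) s).2).
  by apply: pt_snd'; apply: pt_head; pt.
have pst : polytime (fun s : T => parse_relations (behead s)).
  by apply: pt_parse_relations; apply: pt_behead; pt.
have pst2 : polytime (fun s : T => (parse_relations (behead s)).2) by pt.
pose i (s : T) := (head (ntok 0) (parse_relations (behead s)).2).2.
have pi : polytime i by apply: pt_snd'; apply: pt_head.
have pkey : polytime (fun s : T => #|tau| + i s) by apply: pt_addn; pt.
have pa : polytime (fun s : T => arity_of ar (i s)).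
  by rewrite /arity_of; apply: pt_nth_dyn; pt.
pose pos (s : T) := parse_relation (#|tau| + i s) (arity_of ar (i s))
   (behead (parse_relations (behead s)).2).
have ppos : polytime pos by apply: pt_parse_relation; pt; apply: pt_behead.
pose neg (s : T) := parse_relation (#|tau| + i s) (arity_of ar (i s)) (pos s).2.
have pneg : polytime neg by apply: pt_parse_relation; pt.
have pneg2 : polytime (fun s => (neg s).2) by pt.
apply: (pt_ext (f := fun s : T => ((head (ntok 0) s).2, (parse_relations (behead s)).1,
   ((pos s).1, (neg s).1), ((nth (ntok 0) (neg s).2 0).2, (nth (ntok 0) (neg s).2 1).2),
   parse_productions (behead (behead (behead (neg s).2)))))) => //.
pt.
- by apply: pt_nth.
- by apply: pt_nth.
- by apply: pt_parse_productions; do 3 apply: pt_behead.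
Qed.

(** The recursion on [j] takes place outside the machine; it composes a fixed number of programs,
    which is why n^j remains polynomial. *)
Lemma pt_valuations X {cX : Coded W X} (n : X -> nat) j :
  polytime n -> polytime (fun x => valuations (n x) j).
Proof.
move=> pn; elim: j => [|j IH] /=; first by pt.
apply: pt_flatten.
apply: (pt_map (f := fun x y => [seq y :: v | v <- valuations (n x) j])); last exact: pt_iota.
apply: (pt_map (f := fun (p : X * nat) v => p.2 :: v)); first by pt.
have p1 : polytime (fun p : X * nat => p.1) by pt.
exact: pt_comp p1 IH.
Qed.

Lemma pt_repeated X A B {cX : Coded W X} {cA : Coded W A} {cB : Coded W B}
  (s : X -> seq A) (t : X -> seq B) :
  polytime s -> polytime t -> polytime (fun x => repeated (s x) (t x)).
Proof.
move=> ps pt'; apply: pt_flatten; apply: (pt_map (f := fun x _ => t x)) => //.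
have p1 : polytime (fun p : X * A => p.1) by pt.
exact: pt_comp p1 pt'.
Qed.

Lemma pt_passes X {cX : Coded W X} (n : X -> nat) :
  polytime n -> polytime (fun x => passes ar (n x)).
Proof.
move=> pn; apply: pt_flatten.
by apply: (pt_map_const (g := fun i x => valuations (n x) (ar i))) => i; exact: pt_valuations.
Qed.

Lemma pt_fact X {cX : Coded W X} key (s : seq 'I_k) (v : X -> seq nat) :
  polytime v -> polytime (fun x => key :: [seq nth 0 (v x) (i : 'I_k) | i <- s]).
Proof.
move=> pv; pt.
by apply: (pt_map_const (g := fun (i : 'I_k) x => nth 0 (v x) i)) => i; exact: pt_nth.
Qed.

Lemma pt_literal_holds X {cX : Coded W X} (db : X -> seq (seq nat)) v (s : sym) :
  polytime db -> polytime v -> polytime (fun x => literal_holds (db x) (v x) s).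
Proof.
move=> pd pv.
have e : eqpolytime (L := L) (A := seq nat) by apply: eqpt_seq; exact: eqpt_nat.
by case: s => [||h|||a|a|a] /=; pt; apply: pt_mem => //; apply: pt_fact.
Qed.

Lemma pt_valuation_step X {cX : Coded W X} rs (db : X -> seq (seq nat)) v :
  polytime db -> polytime v ->
  polytime (fun x => @valuation_step tau k k' ar rs (db x) (v x)).
Proof.
move=> pd pv.
apply: (pt_foldl_const (g := fun r x b => rule_step (v x) b r)) => // r.
have p1 : polytime (fun p : X * seq (seq nat) => p.1) by pt.
have pv1 : polytime (fun p : X * seq (seq nat) => v p.1) := pt_comp p1 pv.
rewrite /rule_step; apply: pt_if; pt.
  apply: (pt_all_const (g := fun s (p : X * seq (seq nat)) => literal_holds p.2 (v p.1) s)) => s.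
  by apply: pt_literal_holds; pt.
exact: pt_fact.
Qed.

Definition rules_cost (rs : seq (rule_code tau k ar)) (v : seq nat) : nat :=
  \sum_(r <- rs) (csz (int_fact tau r.1 v) + 1).

(** Whatever the database, a valuation adds at most one fact per rule, and the rules are fixed; so
    [pt_fold_add] applies. *)
Lemma pt_fixpoint_facts X {cX : Coded W X} rs (n : X -> nat) db :
  polytime n -> polytime db ->
  polytime (fun x => @fixpoint_facts tau k k' ar rs (n x) (db x)).
Proof.
move=> pn pd; rewrite /fixpoint_facts.
apply: (pt_fold_add (step := fun _ : X => valuation_step rs) _ _ _
  (q := fun p : X * seq nat => rules_cost rs p.2)).
- by apply: pt_repeated; [exact: pt_passes | exact: pt_valuations].
- exact: pd.
- by apply: pt_valuation_step; pt.
- rewrite /rules_cost; elim: rs => [|r rs IH].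
    by apply: (pb_le (h := fun=> 0)); [move=> p; rewrite big_nil | exact: pb_const].
  apply: (pb_le (h := fun p : X * seq nat => (csz (int_fact tau r.1 p.2) + 1) +
     \sum_(r <- rs) (csz (int_fact tau r.1 p.2) + 1))) => [p|]; first by rewrite big_cons.
  by pb; apply: pt_fact; pt.
- move=> x b v; rewrite /valuation_step /rules_cost /=; elim: rs b => [|r rs IH] b /=.
    by rewrite big_nil addn0.
  rewrite big_cons; apply: leq_trans (IH _) _.
  by rewrite /rule_step; case: ifP => _; rewrite ?csize_cons; lia.
Qed.

Lemma pt_good X {cX : Coded W X} p (E : X -> environment tau k ar) :
  polytime E -> polytime (fun x => good p (E x)).
Proof.
move=> pE; rewrite /good.
have e : eqpolytime (L := L) (A := seq nat) by apply: eqpt_seq; exact: eqpt_nat.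
have pX : polytime (fun x => fixpoint_facts (rule_codes p) (E x).1.1.1.1 (E x).1.1.1.2).
  by apply: pt_fixpoint_facts; pt.
have p1 : polytime (fun q : X * seq nat => q.1) by pt.
have pX1 := pt_comp p1 pX.
apply: pt_andb.
  apply: (pt_all (f := fun x f =>
    f \in fixpoint_facts (rule_codes p) (E x).1.1.1.1 (E x).1.1.1.2)); last by pt.
  by apply: pt_mem => //; pt.
apply: (pt_all (f := fun x f =>
    f \notin fixpoint_facts (rule_codes p) (E x).1.1.1.1 (E x).1.1.1.2)); last by pt.
by apply: pt_negb; apply: pt_mem => //; pt.
Qed.

Notation entry := (Q * word)%type.
Notation delta := (@abs_delta tau k k' ar).
Notation table := (table tau k ar).

Lemma eqpt_abs : eqpolytime (L := L) (A := Q).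
Proof. exact: eqpt_atom. Qed.

Lemma pt_dedup X {cX : Coded W X} (s : X -> seq entry) :
  polytime s -> polytime (fun x => dedup (s x)).
Proof.
move=> ps; apply: (pt_fold_add (step := fun _ acc e => dedup_add acc e) _ _ _
  (q := fun p => csz p.2 + 1)); pt.
- apply: pt_if; pt.
  apply: (pt_has (f := fun (p : X * seq entry * entry) (e' : entry) => e'.1 == p.2.1)); pt.
  by apply: pt_eq; [exact: eqpt_abs | pt | pt].
- by pb.
- by move=> x b a; rewrite /dedup_add; case: ifP => _; rewrite ?csize_cons /=; lia.
Qed.

Lemma pt_lookup X {cX : Coded W X} (T : X -> table) B :
  polytime T -> polytime B -> polytime (fun x => lookup (T x) (B x)).
Proof.
move=> pT pB; apply: pt_dedup.
apply: (pt_map (f := fun _ (e : (nat * Q) * word) => (e.1.2, e.2))); first by pt.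
apply: (pt_filter (f := fun x (e : (nat * Q) * word) => e.1.1 == B x)) => //.
have p1 : polytime (fun q : X * ((nat * Q) * word) => q.1) by pt.
by apply: pt_eq; [exact: eqpt_nat | pt | exact: pt_comp p1 pB].
Qed.

Lemma pt_comb1 X {cX : Coded W X} f (s : X -> seq entry) :
  polytime s -> polytime (fun x => comb1 delta f (s x)).
Proof.
move=> ps; apply: pt_dedup.
apply: (pt_map (f := fun _ (e : entry) => (delta f [:: e.1], inr f :: e.2))) => //.
by pt; apply: (pt_atom_fun (fun q => delta f [:: q])); pt.
Qed.

Lemma pt_comb2 X {cX : Coded W X} f (s1 s2 : X -> seq entry) :
  polytime s1 -> polytime s2 -> polytime (fun x => comb2 delta f (s1 x) (s2 x)).
Proof.
move=> ps1 ps2; apply: pt_dedup; apply: pt_flatten.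
apply: (pt_map (f := fun x (e1 : entry) =>
  [seq (delta f [:: e1.1; e2.1], inr f :: (e1.2 ++ e2.2)) | e2 <- s2 x])) => //.
have p1 : polytime (fun q : X * entry => q.1) by pt.
apply: (pt_map (f := fun (p : X * entry) (e2 : entry) =>
  (delta f [:: p.2.1; e2.1], inr f :: (p.2.2 ++ e2.2)))); last exact: pt_comp p1 ps2.
pt; last by apply: pt_cat; pt.
apply: (pt_atom_case (g := fun p : X * entry * entry => p.1.2.1)
  (f := fun q p => delta f [:: q; p.2.1])); first by pt.
by move=> q; apply: (pt_atom_fun (fun q' => delta f [:: q; q'])); pt.
Qed.

Lemma pt_combine X {cX : Coded W X} f (st : X -> seq (seq entry)) :
  polytime st -> polytime (fun x => combine delta f (st x)).
Proof.
move=> pst; rewrite /combine; case: (drank f) => [|[|n]]; pt.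
- by apply: pt_comb1; apply: pt_head.
- by apply: pt_behead.
- by apply: pt_comb2; apply: pt_head => //; apply: pt_behead.
- by do 2 apply: pt_behead.
Qed.

Lemma pt_eval_step X {cX : Coded W X} (T : X -> table) st (t : X -> tok) :
  polytime T -> polytime st -> polytime t ->
  polytime (fun x => eval_step delta (T x) (st x) (t x)).
Proof.
move=> pT pst ptk; rewrite /eval_step.
apply: (pt_atom_case (g := fun x => (t x).1) (f := fun o x =>
  if o is Some f then combine delta f (st x) else lookup (T x) (t x).2 :: st x)); first by pt.
case=> [f|]; first exact: pt_combine.
by pt; apply: pt_lookup; pt.
Qed.

(** * Growth of the witness words during saturation *)

Definition maxword (s : seq entry) : nat := \max_(e <- s) csz e.2.

(* The offset 2 pays for combining two lists into one. *)
Definition stack_weight (st : seq (seq entry)) : nat := \sum_(s <- st) (maxword s).+2.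

Definition table_maxword (T : table) : nat := \max_(e <- T) csz e.2.

Lemma maxword_sub (s t : seq entry) m :
  {subset s <= t} -> (forall e, e \in t -> csz e.2 <= m) -> maxword s <= m.
Proof. by move=> st h; apply/bigmax_leqP_seq => e es _; apply: h; apply: st. Qed.

Lemma leq_maxword (s : seq entry) e : e \in s -> csz e.2 <= maxword s.
Proof. by move=> es; rewrite /maxword (big_rem e) //= leq_maxl. Qed.

Lemma maxword_dedup (s : seq entry) m :
  (forall e, e \in s -> csz e.2 <= m) -> maxword (dedup s) <= m.
Proof. by apply: maxword_sub => e; exact: dedup_sub. Qed.

Lemma size_dedup (s : seq entry) : size (dedup s) <= #|Q|.
Proof.
have u : uniq (unzip1 (dedup s)).
  rewrite /dedup; have : uniq (unzip1 ([::] : seq entry)) by [].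
  elim: s [::] => //= e s IH acc ua; apply: IH.
  rewrite /dedup_add; case: ifP => // /negbT h; rewrite /= ua andbT.
  by apply: contra h => /mapP[e' e'a ->]; apply/hasP; exists e'.
by rewrite -(size_map fst) -(card_uniqP u) max_card.
Qed.

Lemma csize_word_cons (a : L) (w : word) : csz (a :: w) = (csz w).+2.
Proof. by rewrite csize_cons csize_atom. Qed.

Lemma csize_word_cat (w1 w2 : word) : csz (w1 ++ w2) + 1 = csz w1 + csz w2.
Proof. exact: csize_cat. Qed.

Lemma maxword_lookup (T : table) B : maxword (lookup T B) <= table_maxword T.
Proof.
apply: maxword_dedup => _ /mapP[e + ->]; rewrite mem_filter => /andP[_ eT] /=.
by rewrite /table_maxword (big_rem e) //= leq_maxl.
Qed.

Lemma maxword_comb1 f (s : seq entry) : maxword (comb1 delta f s) <= (maxword s).+2.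
Proof.
apply: maxword_dedup => _ /mapP[e es ->] /=; rewrite csize_word_cons !ltnS.
exact: leq_maxword.
Qed.

Lemma maxword_comb2 f (s1 s2 : seq entry) :
  maxword (comb2 delta f s1 s2) <= (maxword s1 + maxword s2).+2.
Proof.
apply: maxword_dedup => _ /allpairsP[[e1 e2] [/= h1 h2 ->]] /=; rewrite csize_word_cons !ltnS.
rewrite -(leq_add2r 1) csize_word_cat.
exact: leq_trans (leq_add (leq_maxword h1) (leq_maxword h2)) (leq_addr _ _).
Qed.

(** A binary symbol replaces maxima m1 and m2 by at most m1 + m2 + 2, and the offset saved makes up
    for the 2. The constant 5 is the weight pushed by a nullary symbol: its one-letter word has
    [csize] 3. *)
Lemma stack_weight_eval_step (T : table) st (t : tok) :
  stack_weight (eval_step delta T st t) <= stack_weight st + (table_maxword T + 5).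
Proof.
have sc s st' : stack_weight (s :: st') = (maxword s).+2 + stack_weight st'.
  by rewrite /stack_weight big_cons.
have s0 : maxword [::] = 0 by rewrite /maxword big_nil.
rewrite /eval_step; case: t.1 => [f|]; last first.
  by rewrite sc; have := maxword_lookup T t.2; lia.
rewrite /combine; case: (drank f) => [|[|n]].
- by rewrite sc /maxword big_seq1 /= csize_word_cons csize_nil; lia.
- rewrite sc; apply: (@leq_trans ((maxword (head [::] st)).+4 + stack_weight (behead st))).
    by rewrite leq_add2r !ltnS maxword_comb1.
  by case: st => [|s st] /=; rewrite ?sc ?s0; lia.
- rewrite sc; apply: (@leq_trans ((maxword (head [::] st) + maxword (head [::] (behead st))).+4 +
    stack_weight (behead (behead st)))); first by rewrite leq_add2r !ltnS maxword_comb2.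
  by case: st => [|s1 [|s2 st]] /=; rewrite ?sc ?s0; lia.
Qed.

Lemma stack_weight_eval (T : table) st (ts : seq tok) :
  stack_weight (foldl (eval_step delta T) st ts) <=
  stack_weight st + size ts * (table_maxword T + 5).
Proof.
elim: ts st => [|t ts IH] st /=; first by lia.
apply: leq_trans (IH _) _; have := stack_weight_eval_step T st t; rewrite mulSn; lia.
Qed.

(** Every list pushed is the result of a [dedup] or the singleton of a nullary symbol; [#|Q|.+1]
    covers both. *)
Lemma small_stack_eval (T : table) st (ts : seq tok) :
  all (fun s => size s <= #|Q|.+1) st ->
  all (fun s => size s <= #|Q|.+1) (foldl (eval_step delta T) st ts).
Proof.
elim: ts st => //= t ts IH st hst; apply: IH.
have hd (s : seq entry) : size (dedup s) <= #|Q|.+1 by apply: leqW; exact: size_dedup.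
rewrite /eval_step; case: t.1 => [f|]; last by rewrite /= hd.
rewrite /combine; case: (drank f) => [|[|n]] /=; rewrite ?hd ?hst //=.
  by case: st hst => //= s st /andP[].
by case: st hst => //= s [|s' st] //= /and3P[].
Qed.

Lemma csize_entries (s : seq entry) : csz s <= size s * (maxword s + 3) + 1.
Proof.
have H m : (forall e, e \in s -> csz e.2 <= m) -> csz s <= size s * (m + 3) + 1.
  elim: s => [|e s IH] h //.
  have h1 : csz e.2 <= m by apply: h; exact: mem_head.
  have h2 : csz s <= size s * (m + 3) + 1 by apply: IH => e' es; apply: h; rewrite inE es orbT.
  rewrite csize_cons mulSn -addnA -addSn; apply: leq_add h2.
  by case: e h1 {h} => q w h1; rewrite csize_pair csize_atom add1n addn3 !ltnS.
by apply: H => e; exact: leq_maxword.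
Qed.

Lemma csize_stack (st : seq (seq entry)) :
  all (fun s => size s <= #|Q|.+1) st -> csz st <= 3 * #|Q|.+1 * stack_weight st + 1.
Proof.
elim: st => [_|s st IH]; first exact: leq_addl.
case/andP=> hs /IH h; have h1 := leq_trans (csize_entries s)
  (leq_add (leq_mul hs (leqnn (maxword s + 3))) (leqnn 1)).
rewrite csize_cons /stack_weight big_cons -/(stack_weight st).
apply: leq_trans (_ : (#|Q|.+1 * (maxword s + 3) + 1 +
  (3 * #|Q|.+1 * stack_weight st + 1)).+1 <= _).
  by rewrite ltnS leq_add.
by move: #|Q| (maxword s) (stack_weight st) => c m w; nia.
Qed.

Lemma size_eval (T : table) (ts : seq tok) :
  size (head [::] (foldl (eval_step delta T) [::] ts)) <= #|Q|.+1.
Proof.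
have := @small_stack_eval T [::] ts isT.
by case: (foldl _ _ _) => //= s st /andP[].
Qed.

Lemma maxword_eval (T : table) (ts : seq tok) :
  maxword (head [::] (foldl (eval_step delta T) [::] ts)) <= size ts * (table_maxword T + 5).
Proof.
have := stack_weight_eval T [::] ts.
have -> : stack_weight [::] = 0 by rewrite /stack_weight big_nil.
case: (foldl _ _ _) => [|s st] /=; first by rewrite /maxword big_nil.
by rewrite /stack_weight big_cons; lia.
Qed.

Lemma table_maxword_csize (T : table) : table_maxword T <= csz T.
Proof.
apply/bigmax_leqP_seq => e + _; elim: T => // e' T IH; rewrite inE csize_cons => /orP[/eqP ->|/IH h].
  by case: e' => a w; rewrite csize_pair /=; lia.
by apply: leq_trans h _; apply: leqW; apply: leq_addl.
Qed.

(** [comb2] joins words that are already on the stack, which rules out [pt_fold_add]. Instead the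
    stack weight grows by a fixed amount per token and [dedup] limits the number of entries: a step
    is polynomial in the table, however large the table has become. *)
Lemma pt_eval : polytime (fun p : table * seq tok => foldl (eval_step delta p.1) [::] p.2).
Proof.
apply: (pt_fold (step := fun (p : table * seq tok) st t => eval_step delta p.1 st t) _ _ _
  (q := fun p => 3 * #|Q|.+1 * (csz p.2 * (csz p.1 + 5)) + 1)); pt.
- by apply: pt_eval_step; pt.
- by pb.
move=> [T ts] m /=; apply: leq_trans (csize_stack _) _; first exact: small_stack_eval.
rewrite leq_add2r leq_mul2l; apply/orP; right.
apply: leq_trans (stack_weight_eval _ _ _) _; rewrite /stack_weight big_nil add0n.
apply: leq_mul; last by rewrite leq_add2r table_maxword_csize.
have h : (size ts).*2 < csz ts by exact: size_csize.
by rewrite size_take_min; lia.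
Qed.

Lemma pt_table_step X {cX : Coded W X} (T : X -> table) (pr : X -> nat * seq tok) :
  polytime T -> polytime pr -> polytime (fun x => table_step (T x) (pr x)).
Proof.
move=> pT ppr; rewrite /table_step /saturate_step; apply: pt_cat => //.
apply: (pt_map (f := fun x (e : entry) => (((pr x).1, e.1), e.2))).
  have p1 : polytime (fun q : X * entry => q.1) by pt.
  have pr1 : polytime (fun q : X * entry => pr q.1) := pt_comp p1 ppr.
  by pt.
apply: pt_head.
have p2 : polytime (fun x => (T x, (pr x).2)) by pt.
exact: pt_comp p2 pt_eval.
Qed.

(** The shift by 5 makes the recurrence purely multiplicative: new words have size at most [size ts]
    times the shifted maximum, and [size ts <= M]. *)
Lemma table_step_maxword (T : table) pr M : csz pr <= M ->
  table_maxword (table_step T pr) + 5 <= M.+1 * (table_maxword T + 5).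
Proof.
case: pr => B ts; rewrite csize_pair => hM.
have hs : (size ts).*2 < csz ts by exact: size_csize.
have hw := maxword_eval T ts.
rewrite /table_maxword /table_step /saturate_step big_cat big_map /=.
rewrite -/(table_maxword T) -/(maxword _) mulSn.
move: (maxword _) (table_maxword T) hw => a b hw.
have : size ts * (b + 5) <= M * (b + 5) by apply: leq_mul => //; lia.
by rewrite maxnE; lia.
Qed.

Lemma table_step_csize (T : table) pr M : csz pr <= M ->
  csz (table_step T pr) <= csz T + #|Q|.+1 * (M + 5 + M.+1 * (table_maxword T + 5)).
Proof.
case: pr => B ts; rewrite csize_pair => hM.
have hs : (size ts).*2 < csz ts by exact: size_csize.
have hw := maxword_eval T ts; have hz := size_eval T ts.
rewrite /table_step /saturate_step /=.
move: (head _ _) hw hz => s hw hz.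
set N := map _ _.
have hN : csz N <= size s * (csz B + maxword s + 5) + 1.
  have H m : (forall e, e \in s -> csz e.2 <= m) -> csz N <= size s * (csz B + m + 5) + 1.
    rewrite /N; elim: {N hw hz} s => [|e s IH] h //.
    have h1 : csz e.2 <= m by apply: h; exact: mem_head.
    have h2 := IH (fun e' es => h e' (mem_behead (s := e :: s) es)).
    rewrite map_cons csize_cons mulSn -addnA -addSn; apply: leq_add h2.
    by case: e h1 {h} => q w h1; rewrite !csize_pair csize_atom; move: h1 => /=; lia.
  by apply: H => e; exact: leq_maxword.
have hc : csz (N ++ T) + 1 = csz N + csz T by exact: csize_cat.
have h1 : size s * (csz B + maxword s + 5) <= #|Q|.+1 * (M + 5 + M.+1 * (table_maxword T + 5)).
  apply: leq_mul => //.
  have : size ts * (table_maxword T + 5) <= M * (table_maxword T + 5) by apply: leq_mul => //; lia.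
  by rewrite mulSn; lia.
rewrite -(leq_add2r 1) hc addnC -addnA leq_add2l.
by apply: leq_trans hN _; rewrite leq_add2r.
Qed.

(** The leading 5 is the shifted maximum of the empty table; the 1 is the [csize] of that table. *)
Lemma table_bound (ps : seq (nat * seq tok)) M :
  (forall pr, pr \in ps -> csz pr <= M) ->
  let T := foldl (@table_step tau k k' ar) [::] ps in
  table_maxword T + 5 <= 5 * M.+1 ^ size ps /\
  csz T <= 1 + size ps * (#|Q|.+1 * (M + 5 + 5 * M.+1 ^ size ps)).
Proof.
elim/last_ind: ps => [|ps pr IH] h.
  by rewrite /= /table_maxword big_nil.
have [|h1 h2] := IH; first by move=> pr' hp; apply: h; rewrite mem_rcons inE hp orbT.
have hM : csz pr <= M by apply: h; rewrite mem_rcons mem_head.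
rewrite /= foldl_rcons size_rcons; move: (foldl _ _ _) h1 h2 => T h1 h2.
have h3 := table_step_maxword T hM; have h4 := table_step_csize T hM.
have h5 : M.+1 * (table_maxword T + 5) <= 5 * M.+1 ^ (size ps).+1.
  by rewrite expnS mulnCA leq_mul2l h1 orbT.
split; first exact: leq_trans h3 h5.
apply: leq_trans h4 _; rewrite [(size ps).+1 * _]mulSn.
have hX : #|Q|.+1 * (M + 5 + M.+1 * (table_maxword T + 5)) <=
    #|Q|.+1 * (M + 5 + 5 * M.+1 ^ (size ps).+1) by rewrite leq_mul2l leq_add2l h5 orbT.
have hn : #|Q|.+1 * (M + 5 + 5 * M.+1 ^ size ps) <=
    #|Q|.+1 * (M + 5 + 5 * M.+1 ^ (size ps).+1).
  by rewrite leq_mul2l leq_add2l leq_mul2l leq_pexp2l ?leqnSn ?orbT.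
have {}hn := leq_mul (leqnn (size ps)) hn.
rewrite addnCA [X in X <= _]addnC; apply: (leq_add hX).
by apply: leq_trans h2 _; rewrite leq_add2l.
Qed.

Lemma pt_table_steps : polytime (@table_steps tau k k' ar).
Proof.
apply: pt_repeated; last by pt.
apply: pt_flatten.
apply: (pt_map_const (g := fun _ (E : environment tau k ar) => nseq E.1.2.1 tt)) => _.
by apply: pt_nseq_tt; pt.
Qed.

Lemma et_table : exptime (L := L) (fun E : environment tau k ar =>
  (E, foldl (@table_step tau k k' ar) [::] (table_steps E))).
Proof.
apply: (et_fold (step := fun _ : environment tau k ar => @table_step tau k k' ar) _ _ _
  (q := fun E => 1 + csz (table_steps E) *
    (#|Q|.+1 * (csz E + 5 + 5 * 2 ^ (csz E * csz (table_steps E)))))).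
- exact: pt_table_steps.
- by pt.
- by apply: pt_table_step; pt.
- have ps : polybounded (fun E => csz (@table_steps tau k k' ar E)).
    by apply: pt_size; exact: pt_table_steps.
  have pE : polybounded (fun E : environment tau k ar => csz E) by exact: pb_csize.
  have c n : expbounded (L := L) (fun _ : environment tau k ar => n).
    by apply: eb_pb; exact: pb_const.
  apply: eb_add => //; apply: eb_mul; first exact: eb_pb.
  apply: eb_mul => //; apply: eb_add; first by apply: eb_add => //; exact: eb_pb.
  by apply: eb_mul => //; apply: eb_exp2; exact: pb_mul.
move=> E m; have [|_ h] := @table_bound (take m (table_steps E)) (csz E).
  move=> pr /mem_take; rewrite /table_steps /repeated => /flatten_mapP[_ _].
  case: E => E ps /= h; rewrite csize_pair; apply: leqW; apply: leq_trans (leq_addl _ _).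
  elim: ps h => // p ps IH; rewrite inE csize_cons => /orP[/eqP ->|/IH h].
    by apply: leqW; apply: leq_addr.
  by apply: leqW; apply: leq_trans h (leq_addl _ _).
apply: leq_trans h _.
have hs : size (take m (table_steps E)) <= csz (table_steps E).
  have h : (size (table_steps E)).*2 < csz (table_steps E) by exact: size_csize.
  by rewrite size_take_min; lia.
rewrite leq_add2l; apply: leq_mul => //.
(* Here M is [csz E], as all productions are part of [E]; the estimate M + 1 <= 2^M turns the power
   into 2 to a polynomial. *)
rewrite leq_mul2l leq_add2l leq_mul2l /= expnM.
apply: leq_trans (_ : (2 ^ csz E) ^ size (take m (table_steps E)) <= _).
  by case: (size _) => // j; rewrite leq_exp2r // ltn_expl.
by rewrite leq_pexp2l // expn_gt0.
Qed.

Lemma pt_answer_word : polytime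
  (fun p : environment tau k ar * table => answer_word p.1 p.2).
Proof.
pose X := (environment tau k ar * table)%type.
apply: (pt_foldl_const (g := fun q (p : X) acc =>
  if candidate p.1 p.2 q is w :: _ then inl true :: w else acc)); last by pt.
move=> q; pose Y := (X * word)%type.
apply: (pt_seq_case (l := fun p : Y => candidate p.1.1 p.1.2 q) (f0 := fun p => p.2)
  (f1 := fun _ w _ => inl true :: w)); pt.
rewrite /candidate; case: q.1 => [p|]; last by pt.
apply: pt_if; pt; first by apply: pt_good; pt.
apply: (pt_map (f := fun _ (e : (nat * Q) * word) => e.2)); first by pt.
apply: (pt_filter (f := fun (p : Y) (e : (nat * Q) * word) => e.1 == (p.1.1.1.2.2, q))); last by pt.
apply: pt_eq; [|pt|pt].
by apply: eqpt_pair; [exact: eqpt_nat | exact: eqpt_abs].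
Qed.

(** The exponential stage sits between two polynomial ones. The outer [rev] cancels the reversal of
    the output in [exptime_machine]. *)
Lemma et_rev_solve : exptime (L := L) (fun rw => rev (@solve tau k k' ar rw)).
Proof.
have p1 : polytime (fun rw : seq L => parse_instance (tokenize rw)).
  have pt1 : polytime (fun rw : seq L => tokenize rw) by apply: pt_tokenize; pt.
  exact: pt_comp pt1 pt_parse_instance.
have p2 := pt_rev pt_answer_word.
exact: et_comp_l (et_comp_r p1 et_table) p2.
Qed.

End Complexity.

Theorem theoremG1 (tau : signature) (k k' : nat) (ar : 'I_k' -> nat) :
  exptime_solvable (@enc_instance tau k k' ar) (@enc_answer tau k k' ar)
    (@correct_answer tau k k' ar).
Proof.
have [M [c H]] := exptime_machine (et_rev_solve tau k ar).
exists M, c => I; have [ans ok E] := solve_correct I.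
by exists ans; split=> //; have := H (enc_instance I); rewrite revK E.
Qed.
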